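(* The stable Specht polynomials $s^\dagger_\nu$ are alternatingly Schur positive. Precisely, for every partition $\nu$, $$ s^\dagger_\nu=\sum_\lambda b_\lambda^\nu\, s_\lambda,$$ where $(-1)^{|\lambda|-|\nu|}b_\lambda^\nu\ge 0$ for all partitions $\lambda$.
   Context: All representations are over $\mathbb{C}$. For a partition $\lambda$, $|\lambda|$ is the sum of its parts. $\mathbb{S}_\lambda$ is the Schur functor, and $\mathrm{Sp}_\nu$ is the Specht module of $\mathfrak{S}_t$ for $\nu$ a partition of $t$. The group $\mathfrak{S}_t$ is embedded in $\mathrm{GL}_t$ as permutation matrices. For $\nu=(\nu_1,\ldots,\nu_r)$ and $t\ge\nu_1+|\nu|$, let $\nu^{(t)}=(t-|\nu|,\nu_1,\ldots,\nu_r)$. Define $a_\lambda^\nu(t)\ge0$ by $\mathrm{Res}^{\mathrm{GL}_t}_{\mathfrak{S}_t}\mathbb{S}_\lambda(\mathbb{C}^t)\cong\bigoplus_\nu\mathrm{Sp}_{\nu^{(t)}}^{\oplus a_\lambda^\nu(t)}$. By Littlewood, $a_\lambda^\nu(t)$ is independent of $t$ for $t$ large; set $a_\lambda^\nu=\lim_{t\to\infty}a_\lambda^\nu(t)$. Moreover $a_\lambda^\nu=\delta_{\lambda,\nu}$ whenever $|\lambda|\le|\nu|$. The matrix $[b_\lambda^\nu]$ is the inverse of the uni-triangular matrix $[a_\lambda^\nu]$, indexed as follows: the $b_\lambda^\nu$ are the unique integers with $b_\lambda^\nu=0$ unless $|\lambda|\le|\nu|$ and $\sum_\lambda b_\lambda^\nu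 a_\lambda^\kappa=\delta_{\nu,\kappa}$ for all partitions $\nu,\kappa$. With $s_\lambda$ the Schur functions, the stable Specht polynomials $s^\dagger_\nu$ are the inhomogeneous basis of symmetric functions determined by $s_\lambda=\sum_\nu a_\lambda^\nu\,s^\dagger_\nu$ for all partitions $\lambda$. *)

(* Defs.v *)
From HB Require Import structures.
From mathcomp Require Import all_boot all_order all_algebra all_fingroup.
From mathcomp Require Import mxrepresentation character finmap.
From mathcomp Require Import all_classical all_reals all_analysis complex.

Set Implicit Arguments.
Unset Strict Implicit.
Unset Printing Implicit Defensive.

Import Order.TTheory GRing.Theory Num.Theory.

Local Open Scope ring_scope.

Record intpart := IntPart {
  intparts :> seq nat;
  _ : sorted geq intparts && (0%N \notin intparts)
}.
HB.instance Definition _ := [isSub for intparts].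
HB.instance Definition _ := [Countable of intpart by <:].

Definition psize (l : intpart) : nat := sumn l.

(* nu^(t); it is a partition of t as soon as nu_1 + |nu| <= t.  For t = 0 and
   nu empty it is [:: 0], a shape with no cell. *)
Definition padded (t : nat) (nu : intpart) : seq nat :=
  (t - psize nu)%N :: nu.

Definition paddable (t : nat) : set intpart :=
  [set nu : intpart | (head 0 nu + psize nu <= t)%N]%classic.

(* The cells of a shape [l] with [sumn l = n] are numbered by ['I_n], row after
   row; [reshape_index l k] and [reshape_offset l k] are the row and the column
   of cell [k].  The shape and the number of cells are separate arguments so
   that the group acting is syntactically ['S_n]; these notions are only
   meaningful when [sumn l = n]. *)

Definition row_group (n : nat) (l : seq nat) : {set 'S_n} :=
  [set s : 'S_n | [forall k, reshape_index l (s k) == reshape_index l k]].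

Definition col_group (n : nat) (l : seq nat) : {set 'S_n} :=
  [set s : 'S_n | [forall k, reshape_offset l (s k) == reshape_offset l k]].

Section Representations.

Variable F : fieldType.

(* Image of the Young symmetrizer sum_(p, q) sgn(q) p q under the linear
   extension of f to the group algebra. *)
Definition young_sum (n : nat) (l : seq nat) (V : lmodType F) (f : 'S_n -> V) :=
  \sum_(p in row_group n l) \sum_(q in col_group n l)
    (-1) ^+ odd_perm q *: f (p * q)%g.

(* The submodule generated by the Young symmetrizer in the right regular
   representation: matrices act on row vectors, on the right. *)
Definition specht (n : nat) (l : seq nat) :=
  submod_repr (cyclic_mx_module (regular_repr F [set: 'S_n])
    (young_sum l (fun s => gring_row (regular_repr F [set: 'S_n] s)))).

(* The n-th tensor power of F^t has the basis e_f, f : 'I_n -> 'I_t. *)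

Local Notation tensor_index n t := {ffun 'I_n -> 'I_t}.

Definition tensor_mx (n t u : nat) (g : 'M[F]_(t, u)) :
    'M[F]_(#|tensor_index n t|, #|tensor_index n u|) :=
  \matrix_(i, j) \prod_k g ((enum_val i : tensor_index n t) k)
                          ((enum_val j : tensor_index n u) k).

(* Moves the tensor factor at place k to place s k. *)
Definition place_mx (n t : nat) (s : 'S_n) : 'M[F]_#|tensor_index n t| :=
  \matrix_(i, j) [forall k, (enum_val j : tensor_index n t) (s k)
                             == (enum_val i : tensor_index n t) k]%:R.

Definition young_mx (l : intpart) (t : nat) :
    'M[F]_#|tensor_index (psize l) t| :=
  young_sum l (@place_mx (psize l) t).

(* The Schur functor on a linear map of F^t: the restriction of the tensor power
   of g to the image (row space) of the Young symmetrizer. *)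
Definition schur_mx (l : intpart) (t : nat) (g : 'M[F]_t) :
    'M[F]_(\rank (young_mx l t)) :=
  in_submod (young_mx l t)
    (val_submod (1%:M : 'M[F]_(\rank (young_mx l t))) *m tensor_mx (psize l) g).

Lemma tensor_mx1 (n t : nat) : tensor_mx n (1%:M : 'M[F]_t) = 1%:M.
Proof.
apply/matrixP => i j; rewrite !mxE.
have [->|neij] := eqVneq i j; first by rewrite big1 // => k _; rewrite mxE eqxx.
have [k nek] : exists k, (enum_val i : tensor_index n t) k != (enum_val j : tensor_index n t) k.
  apply/existsP; apply: contraR neij; rewrite negb_exists => /forallP eqij.
  by apply/eqP/enum_val_inj/ffunP => k; apply/eqP; have := eqij k; rewrite negbK.
by rewrite (bigD1 k) //= mxE (negbTE nek) mul0r.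
Qed.

Lemma tensor_mxM (n t u v : nat) (g : 'M[F]_(t, u)) (h : 'M[F]_(u, v)) :
  tensor_mx n (g *m h) = tensor_mx n g *m tensor_mx n h.
Proof.
apply/matrixP => i j; rewrite !mxE.
under eq_bigr do rewrite mxE.
rewrite bigA_distr_bigA (reindex (@enum_val {ffun 'I_n -> 'I_u} predT)) /=; last first.
  by apply: onW_bij; exact: enum_val_bij.
by apply: eq_bigr => m _; rewrite !mxE -big_split.
Qed.

Lemma place_tensorC (n t : nat) (s : 'S_n) (g : 'M[F]_t) :
  place_mx t s *m tensor_mx n g = tensor_mx n g *m place_mx t s.
Proof.
have placeE (i j : 'I_#|tensor_index n t|) : place_mx t s i j =
    (j == enum_rank [ffun k => (enum_val i : tensor_index n t) (s^-1%g k)])%:R :> F.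
  rewrite mxE; congr (_ : bool)%:R; apply/forallP/eqP => [eqij | -> k].
    apply: enum_val_inj; apply/ffunP => k.
    by rewrite enum_rankK ffunE -(eqP (eqij _)) permKV.
  by rewrite enum_rankK ffunE permK.
have placeE' (i j : 'I_#|tensor_index n t|) : place_mx t s i j =
    (i == enum_rank [ffun k => (enum_val j : tensor_index n t) (s k)])%:R :> F.
  rewrite mxE; congr (_ : bool)%:R; apply/forallP/eqP => [eqij | -> k].
    apply: enum_val_inj; apply/ffunP => k.
    by rewrite enum_rankK ffunE (eqP (eqij _)).
  by rewrite enum_rankK ffunE.
apply/matrixP => i j; rewrite !mxE.
rewrite (bigD1 (enum_rank [ffun k => (enum_val i : tensor_index n t) (s^-1%g k)])) //=.
rewrite [X in _ + X]big1 ?addr0; last first.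
  by move=> m /negbTE nem; rewrite placeE nem mul0r.
rewrite (bigD1 (enum_rank [ffun k => (enum_val j : tensor_index n t) (s k)])) //=.
rewrite [X in _ = _ + X]big1 ?addr0; last first.
  by move=> m /negbTE nem; rewrite placeE' nem mulr0.
rewrite placeE placeE' !eqxx mul1r mulr1 !mxE !enum_rankK.
rewrite (reindex_inj (@perm_inj _ s)) /=.
by apply: eq_bigr => k _; rewrite !ffunE permK.
Qed.

Lemma young_tensorC (l : intpart) (t : nat) (g : 'M[F]_t) :
  young_mx l t *m tensor_mx (psize l) g = tensor_mx (psize l) g *m young_mx l t.
Proof.
rewrite mulmx_suml mulmx_sumr; apply: eq_bigr => p _.
rewrite mulmx_suml mulmx_sumr; apply: eq_bigr => q _.
by rewrite -scalemxAl -scalemxAr place_tensorC.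
Qed.

Lemma tensor_mx_stable (l : intpart) (t : nat) (g : 'M[F]_t) :
  (val_submod (1%:M : 'M[F]_(\rank (young_mx l t))) *m tensor_mx (psize l) g
     <= young_mx l t)%MS.
Proof.
apply: submx_trans (submxMr _ (val_submodP _)) _.
by rewrite young_tensorC submxMl.
Qed.

Lemma schur_mx1 (l : intpart) (t : nat) :
  schur_mx l (1%:M : 'M[F]_t) = 1%:M.
Proof. by rewrite /schur_mx tensor_mx1 mulmx1 val_submodK. Qed.

Lemma schur_mxM (l : intpart) (t : nat) (g h : 'M[F]_t) :
  schur_mx l (g *m h) = schur_mx l g *m schur_mx l h.
Proof.
rewrite /schur_mx tensor_mxM mulmxA.
rewrite -[in LHS](in_submodK (tensor_mx_stable l g)).
by rewrite val_submodE -mulmxA in_submodE -mulmxA -in_submodE.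
Qed.

(* Restriction of S_l(F^t) along the embedding of 'S_t as permutation
   matrices. *)
Definition res_schur_mx (l : intpart) (t : nat) (s : 'S_t) :=
  schur_mx l (perm_mx s : 'M[F]_t).

Lemma res_schur_repr (l : intpart) (t : nat) :
  mx_repr [set: 'S_t] (@res_schur_mx l t).
Proof.
split=> [|x y _ _]; first by rewrite /res_schur_mx perm_mx1 schur_mx1.
by rewrite /res_schur_mx perm_mxM schur_mxM.
Qed.

Definition res_schur (l : intpart) (t : nat) :=
  MxRepresentation (res_schur_repr l t).

(* [a nu] is the multiplicity of Sp_(nu^(t)) in the restriction of S_l(F^t).
   The set [paddable t] is finite. *)
Definition restriction_mult (l : intpart) (t : nat) (a : intpart -> nat) :=
  mx_rsim (res_schur l t)
    (\big[dadd_grepr/grepr0]_(nu <- fset_set (paddable t))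
       muln_grepr (Representation (specht t (padded t nu))) (a nu)).

End Representations.

(* Formal power series in the variables x_0, x_1, ... over the integers, given
   by their coefficients; only the additive structure is used. *)

Definition exponent := {fsfun nat -> nat with 0%N}.

Definition fseries := exponent -> int.

Definition symmetric_function (f : fseries) : Prop :=
  (forall (w : nat -> nat) (m m' : exponent),
     bijective w -> (forall i, m' i = m (w i)) -> f m' = f m)
  /\ (exists d : nat, forall m : exponent,
        f m != 0 -> (\sum_(i <- finsupp m) m i <= d)%N).

Definition semistandard (l : intpart) (T : 'I_(psize l) -> nat) : bool :=
  [forall i : 'I_(psize l), forall j : 'I_(psize l),
    ((reshape_index l i == reshape_index l j) &&
     (reshape_offset l i < reshape_offset l j)%N ==> (T i <= T j)%N) &&
    ((reshape_offset l i == reshape_offset l j) &&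
     (reshape_index l i < reshape_index l j)%N ==> (T i < T j)%N)].

(* The coefficient of x^m in the Schur function s_l is the number of
   semistandard tableaux of shape l and content m; the entries of such a tableau
   lie in the support of m. *)
Definition schur_function (l : intpart) : fseries := fun m =>
  #|[set T : {ffun 'I_(psize l) -> finsupp m} |
      semistandard (fun k => val (T k)) &&
      [forall v, #|[set k | T k == v]| == m (val v)]]|%:Z.

(* Main.v *)
(* Write [S_l] for the character of the Schur functor of [l] restricted to 'S_t.
   Inducing from centralizers of permutations [c] the characters that are
   primitive on every cycle gives genuine characters of 'S_m x 'S_n, built from
   Lie representations; their multiplicities [cycle_mult nu l], with [nu] of size
   [m] and [l] of size [n], are natural numbers, equal to [nu == l] for m = n and
   to 0 for n > m.
   The alternating sum of the corresponding Schur functors is, by a cancellation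
   over the centralizers, a signed count of equivariant injective partial maps
   into 'I_t; hence the virtual character
   G_nu = sum_l (-1)^(|nu| + |l|) cycle_mult nu l S_l
   is orthogonal to S_l for |l| < |nu| and pairs to [nu == l] for |l| = |nu|, as
   soon as t >= 2 |nu|. So G_nu has norm 1: up to sign it is an irreducible
   character. The integral matrices [cycle_mult] and [a] being triangular, the
   product of the signed [cycle_mult] with [a] is then a permutation matrix in
   each range of sizes, and [b] is up to this permutation the signed [cycle_mult]. *)

Require Import Defs.
From HB Require Import structures.
From mathcomp Require Import all_boot all_order all_algebra all_fingroup.
From mathcomp Require Import cyclic separable cyclotomic mxrepresentation character.

Set Implicit Arguments.
Unset Strict Implicit.
Unset Printing Implicit Defensive.

Import Order.TTheory GRing.Theory Num.Theory.

Local Open Scope ring_scope.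

(** The conclusion depends on the index of a row only through its size, so the irreducible equal to
    G_nu up to sign need not be identified; the sign is settled because the entry concerned is an
    entry of [a]. The multiplicities come from the theorem of Klyachko that the Lie representation
    of degree n is induced from a primitive linear character of an n-cycle: replacing it by all
    cycles of a permutation [c] gives a monomial character, so positivity is the integrality of a
    rank. The signs are those of an Euler characteristic, evaluated here by sign-reversing changes
    of [c] inside a centralizer. The bound t >= 2 |nu| leaves |nu| points outside the image of a map
    from at most |nu| points. Translating centralizer sums into Schur functors requires that Specht
    characters span the class functions; this is deduced, by induction on the degree, from the
    assumed decompositions of the restrictions at finite t. *)

Lemma mxtrace_quasi_idem (F : fieldType) (n : nat) (s : F) (A : 'M[F]_n) :
  A *m A = s *: A -> \tr A = s * (\rank A)%:R.
Proof.
move=> AA; move: (mulmx_base A) (row_base_free A) (col_base_full A).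
move: (row_base A) (col_base A) => B C CB fB fC.
have BC : B *m C = s%:M.
  apply: (row_full_inj fC); apply: (row_free_inj fB).
  by rewrite /= mulmxA CB -mulmxA CB AA mul_mx_scalar -scalemxAl CB.
by rewrite -{1}CB mxtrace_mulC BC mxtrace_scalar mulr_natr.
Qed.

(** An idempotent with row space [U] computes traces on [U] without a basis of [U]; Specht modules
    and Schur functors are both treated this way. *)
Lemma mxtrace_in_submod (F : fieldType) (n : nat) (U P A : 'M[F]_n) :
    P *m P = P -> (P :=: U)%MS -> (U *m A <= U)%MS ->
  \tr (in_submod U (val_submod (1%:M : 'M[F]_(\rank U)) *m A)) = \tr (P *m A).
Proof.
move=> PP eqPU UA; set B := val_submod _; pose J := in_submod U 1%:M.
have PJB : P *m J *m B = P.
  by rewrite -in_submodE -val_submodE in_submodK // eqPU.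
have stabP m (W : 'M[F]_(m, n)) : (W <= U)%MS -> W *m P = W.
  by rewrite -eqPU => /submxP[D ->]; rewrite -mulmxA PP.
rewrite in_submodE -/J; transitivity (\tr ((B *m A) *m (P *m J))).
  by rewrite [_ *m (P *m J)]mulmxA stabP // (submx_trans _ UA) // submxMr // val_submodP.
by rewrite mxtrace_mulC mulmxA PJB.
Qed.

(** * Young symmetrizers *)

Section YoungSymmetrizer.
Variables (F : fieldType) (n : nat).
Implicit Types (l : seq nat) (x : 'S_n).

Definition young_coef l x : F := young_sum l (fun s => (s == x)%:R : F^o).

Lemma young_coefE l (V : lmodType F) (f : 'S_n -> V) :
  \sum_g young_coef l g *: f g = young_sum l f.
Proof.
rewrite /young_coef /young_sum.
under eq_bigr do rewrite scaler_suml.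
rewrite exchange_big /=; apply: eq_bigr => p _.
under eq_bigr do rewrite scaler_suml.
rewrite exchange_big /=; apply: eq_bigr => q _.
rewrite (bigD1 (p * q)%g) //= eqxx big1 ?addr0 => [|g /negbTE neg].
  by rewrite -[LHS]/(((-1) ^+ q * 1) *: _) mulr1.
by rewrite eq_sym neg -[LHS]/(((-1) ^+ q * 0) *: _) mulr0 scale0r.
Qed.

Lemma row_groupP l (s : 'S_n) :
  reflect (forall k, reshape_index l (s k) = reshape_index l k) (s \in row_group n l).
Proof. by rewrite inE; apply: (iffP forallP) => H k; apply/eqP/H. Qed.

Lemma col_groupP l (s : 'S_n) :
  reflect (forall k, reshape_offset l (s k) = reshape_offset l k) (s \in col_group n l).
Proof. by rewrite inE; apply: (iffP forallP) => H k; apply/eqP/H. Qed.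

Lemma row_group_set l : group_set (row_group n l).
Proof.
apply/group_setP; split=> [|p q /row_groupP Hp /row_groupP Hq]; apply/row_groupP => k.
  by rewrite perm1.
by rewrite permM Hq Hp.
Qed.

Lemma col_group_set l : group_set (col_group n l).
Proof.
apply/group_setP; split=> [|p q /col_groupP Hp /col_groupP Hq]; apply/col_groupP => k.
  by rewrite perm1.
by rewrite permM Hq Hp.
Qed.

Canonical row_group_group l := group (row_group_set l).
Canonical col_group_group l := group (col_group_set l).

(** The transposition [t] preserves the rows of [l], and its conjugate [t'] by [x] is an odd column
    permutation of [l']. Replacing [p], [q] by [p t], [t' q] keeps [p x q] and reverses the sign. *)
Lemma young_sum_vanish l l' (V : lmodType F) (f : 'S_n -> V) x (k k' : 'I_n) :
    2%:R != 0 :> F -> k != k' ->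
    reshape_index l k = reshape_index l k' ->
    reshape_offset l' (x k) = reshape_offset l' (x k') ->
  \sum_(p in row_group n l) \sum_(q in col_group n l')
    (-1) ^+ odd_perm q *: f (p * x * q)%g = 0.
Proof.
move=> nz2 nek rk ck; set S := LHS.
pose t := tperm k k'; pose t' := tperm (x k) (x k').
have tR : t \in row_group n l.
  by apply/row_groupP => i; rewrite /t; case: tpermP => // ->.
have tC : t' \in col_group n l'.
  by apply/col_groupP => i; rewrite /t'; case: tpermP => // ->.
have tx : (t * x = x * t')%g by rewrite /t' -tpermJ conjgE !mulgA mulgV mul1g.
have : S = - S.
  rewrite {1}/S (reindex_inj (mulIg t)) /= -sumrN.
  apply: eq_big => [p|p _]; first by rewrite groupMr.
  rewrite (reindex_inj (mulgI t')) /= -sumrN.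
  apply: eq_big => [q|q _]; first by rewrite groupMl.
  rewrite odd_permM odd_tperm (inj_eq perm_inj) nek signr_addb expr1 mulN1r scaleNr.
  suff -> : (p * t * x * (t' * q) = p * x * q)%g by [].
  by rewrite -(mulgA p) tx !mulgA -(mulgA _ t' t') tperm2 mulg1.
by move/eqP; rewrite -addr_eq0 -mulr2n -scaler_nat scaler_eq0 (negbTE nz2) => /eqP.
Qed.

End YoungSymmetrizer.

Section Shapes.
Variable n : nat.
Implicit Types (l : seq nat) (x : 'S_n).

Definition transversal_perm l l' x := [forall k : 'I_n, forall k' : 'I_n,
  [&& reshape_index l k == reshape_index l k'
    & reshape_offset l' (x k) == reshape_offset l' (x k')] ==> (k == k')].

Lemma transversal_permP l l' x : transversal_perm l l' x -> forall k k' : 'I_n,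
  reshape_index l k = reshape_index l k' ->
  reshape_offset l' (x k) = reshape_offset l' (x k') -> k = k'.
Proof.
move=> /forallP tx k k' rk ck; apply/eqP.
by move/forallP/(_ k')/implyP: (tx k) => -> //; rewrite rk ck !eqxx.
Qed.

Lemma transversal_permPn l l' x : ~~ transversal_perm l l' x -> exists k k' : 'I_n,
  [/\ k != k', reshape_index l k = reshape_index l k' &
      reshape_offset l' (x k) = reshape_offset l' (x k')].
Proof.
rewrite negb_forall => /existsP[k]; rewrite negb_forall => /existsP[k'].
by rewrite negb_imply => /andP[/andP[/eqP rk /eqP ck] nek]; exists k, k'.
Qed.

(** A transversal [x] sends the cells of a row to distinct columns, so the count is bounded by [c]
    and by the row length; the identity attains the smaller of the two bounds. *)
Lemma row_count_leq l l' x (c i : nat) :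
    sumn l = n -> transversal_perm l l' x ->
  (#|[set k : 'I_n | (reshape_index l k == i) && (reshape_offset l' (x k) < c)]|
   <= #|[set k : 'I_n | (reshape_index l k == i) && (reshape_offset l k < c)]|)%N.
Proof.
move=> ln tx; case: (leqP (nth 0%N l i) c) => [lic | cli].
  apply/subset_leq_card/subsetP => k; rewrite !inE => /andP[/eqP ki _].
  by rewrite ki eqxx /= (leq_trans _ lic) // -ki reshape_offsetP ?ln.
apply: (@leq_trans c).
  case: c cli => [|c] _; first by rewrite leqn0 cards_eq0; apply/eqP/setP => k; rewrite !inE andbF.
  rewrite -[X in (_ <= X)%N](card_ord c.+1).
  apply: (@leq_card_in _ _ (fun k : 'I_n => inord (reshape_offset l' (x k)))).
  move=> k k'; rewrite !inE => /andP[/eqP ki kc] /andP[/eqP k'i k'c] /(congr1 val).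
  by rewrite /= !inordK // => /(transversal_permP tx); apply; rewrite ki.
have fP (j : 'I_c) : (flatten_index l i j < n)%N.
  by rewrite -ln flatten_indexP // (leq_trans (ltn_ord j)) // ltnW.
have jl (j : 'I_c) : (j < nth 0%N l i)%N by rewrite (leq_trans (ltn_ord j)) // ltnW.
rewrite -[X in (X <= _)%N](card_ord c) -(@card_imset _ _ (fun j => Ordinal (fP j))); last first.
  move=> j j' /(congr1 val) /= /(congr1 (reshape_offset l)).
  by rewrite !flatten_indexKr // => /val_inj.
apply/subset_leq_card/subsetP => _ /imsetP[j _ ->].
by rewrite inE /= flatten_indexKl // flatten_indexKr // eqxx ltn_ord.
Qed.

Lemma card_row_split l (P : pred 'I_n) :
  sumn l = n ->
  #|[set k | P k]| =
  (\sum_(i < size l) #|[set k : 'I_n | (reshape_index l k == i) && P k]|)%N.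
Proof.
move=> ln; rewrite -sum1_card.
have rP (k : 'I_n) : (reshape_index l k < size l)%N by rewrite reshape_indexP ?ln.
rewrite (partition_big (fun k => Ordinal (rP k)) predT) //=.
apply: eq_bigr => i _; rewrite -sum1_card; apply: eq_bigl => k.
by rewrite !inE andbC -val_eqE.
Qed.

Lemma card_perm_preim (P : pred 'I_n) x : #|[set k | P (x k)]| = #|[set k | P k]|.
Proof.
rewrite -[RHS](card_imset _ (@perm_inj _ x^-1%g)); congr #|pred_of_set _|; apply/setP => k.
rewrite inE; apply/idP/imsetP => [Pk | [k' + ->]]; last by rewrite inE permKV.
by exists (x k); rewrite ?inE ?permK.
Qed.

(** Summed over rows, this is the dominance comparison of the two shapes. Transversals in both
    directions therefore force equal column counts. *)
Lemma col_count_leq l l' x (c : nat) :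
    sumn l = n -> transversal_perm l l' x ->
  (#|[set k : 'I_n | (reshape_offset l' k < c)]|
   <= #|[set k : 'I_n | (reshape_offset l k < c)]|)%N.
Proof.
move=> ln tx; rewrite -(card_perm_preim (fun k => reshape_offset l' k < c)%N x).
by rewrite !(card_row_split _ ln) leq_sum // => i _; exact: row_count_leq.
Qed.

(** Combinatorial lemma of von Neumann. As [x] permutes the cells, the totals of the row
    inequalities agree, so each of them is an equality. Hence the row of [k] has a cell in the
    column of [x k]; moving [k] there is [p], and [q] is what remains. *)
Lemma transversal_factor l x :
    sumn l = n -> transversal_perm l l x ->
  exists2 p, p \in row_group n l & exists2 q, q \in col_group n l & x = (p * q)%g.
Proof.
move=> ln tx.
have offP (k : 'I_n) : (reshape_offset l (x k) < nth 0%N l (reshape_index l k))%N.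
  set i := reshape_index l k; set c := nth 0%N l i.
  have il : (i < size l)%N by rewrite reshape_indexP ?ln.
  have := leqif_sum (P := predT) (fun (i : 'I_(size l)) _ =>
    leqif_eq (row_count_leq c i ln tx)) .
  rewrite -!card_row_split // (card_perm_preim (fun k => reshape_offset l k < c)%N x) => -[_]; rewrite eqxx => /esym/forallP/(_ (Ordinal il)).
  rewrite /= => /eqP eqc.
  have sub : [set k0 : 'I_n | (reshape_index l k0 == i) && (reshape_offset l (x k0) < c)%N]
     \subset [set k0 : 'I_n | (reshape_index l k0 == i) && (reshape_offset l k0 < c)%N].
    apply/subsetP => k0; rewrite !inE => /andP[/eqP ki _].
    by rewrite ki eqxx /c -ki reshape_offsetP ?ln.
  have /eqP/setP/(_ k) : [set k0 : 'I_n | (reshape_index l k0 == i) && (reshape_offset l (x k0) < c)%N]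
     == [set k0 : 'I_n | (reshape_index l k0 == i) && (reshape_offset l k0 < c)%N].
    by rewrite eqEcard sub eqc leqnn.
  by rewrite !inE eqxx /= reshape_offsetP ?ln.
have fP (k : 'I_n) : (flatten_index l (reshape_index l k) (reshape_offset l (x k)) < n)%N.
  by rewrite -[X in (_ < X)%N]ln flatten_indexP.
pose f k := Ordinal (fP k).
have fI : injective f.
  move=> k k' /(congr1 val) /= e; apply: (transversal_permP tx).
    by rewrite -(flatten_indexKl (offP k)) e flatten_indexKl.
  by rewrite -(flatten_indexKr (offP k)) e flatten_indexKr.
exists (perm fI).
  by apply/row_groupP => k; rewrite permE /= flatten_indexKl.
exists ((perm fI)^-1 * x)%g; last by rewrite mulKVg.
apply/col_groupP => k; rewrite permM -{2}(permKV (perm fI) k) permE /=.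
by rewrite flatten_indexKr.
Qed.

Lemma col_countE l c : sumn l = n ->
  #|[set k : 'I_n | (reshape_offset l k < c)%N]| = sumn [seq minn y c | y <- l].
Proof.
move=> ln; rewrite (card_row_split _ ln) sumnE big_map (big_nth 0%N) big_mkord.
apply: eq_bigr => i _.
have jP (j : 'I_(minn (nth 0%N l i) c)) : (j < nth 0%N l i)%N && (j < c)%N.
  by rewrite -ltn_min ltn_ord.
have fP (j : 'I_(minn (nth 0%N l i) c)) : (flatten_index l i j < n)%N.
  by rewrite -[X in (_ < X)%N]ln flatten_indexP //; case/andP: (jP j).
rewrite -[RHS]card_ord -(@card_imset _ _ (fun j => Ordinal (fP j))); last first.
  move=> j j' /(congr1 val) /= /(congr1 (reshape_offset l)).
  by rewrite !flatten_indexKr; [move/val_inj|case/andP: (jP j')|case/andP: (jP j)].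
congr #|pred_of_set _|; apply/setP => k; rewrite inE; apply/andP/imsetP.
  move=> [/eqP ki kc].
  have kl : (reshape_offset l k < nth 0%N l i)%N by rewrite -ki reshape_offsetP ?ln.
  have kP : (reshape_offset l k < minn (nth 0%N l i) c)%N by rewrite ltn_min kl kc.
  by exists (Ordinal kP) => //; apply: val_inj; rewrite /= -ki reshape_indexK.
move=> [j _ ->] /=; case/andP: (jP j) => jl jc.
by rewrite flatten_indexKl // flatten_indexKr // eqxx.
Qed.

End Shapes.

Lemma sumn_minnS (s : seq nat) c :
  sumn [seq minn x c.+1 | x <- s] =
  (sumn [seq minn x c | x <- s] + count (fun x => c < x) s)%N.
Proof.
elim: s => //= x s ->; rewrite addnACA; congr (_ + _)%N.
by rewrite /minn ltnS; case: (ltngtP x c) => // [xc | xc | ->]; rewrite ?addn0 ?addn1.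
Qed.

Lemma intpart_sorted (l : intpart) : sorted geq l.
Proof. by case: l => l /= /andP[]. Qed.

(** The increments of the column counts are the numbers of parts exceeding [c], and the differences
    of these are the multiplicities of the parts. *)
Lemma intpart_col_inj n (l l' : intpart) :
    psize l = n -> psize l' = n ->
    (forall c, #|[set k : 'I_n | reshape_offset l k < c]|
               = #|[set k : 'I_n | reshape_offset l' k < c]|)%N ->
  l = l'.
Proof.
move=> ln l'n eqc; apply: val_inj; apply: (@sorted_eq _ geq).
- by move=> a b c ab bc; exact: leq_trans bc ab.
- by move=> a b; rewrite /geq /= andbC => /anti_leq.
- exact: intpart_sorted.
- exact: intpart_sorted.
have eqcount c : count (fun x => c < x)%N l = count (fun x => c < x)%N l'.
  have := eqc c.+1; have := eqc c.
  by rewrite !col_countE // !sumn_minnS => -> /addnI.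
have countS (s : seq nat) x :
  count (fun y => x < y)%N s = (count_mem x.+1 s + count (fun y => x.+1 < y)%N s)%N.
  elim: s => //= y s ->; rewrite addnACA; congr (_ + _)%N.
  by case: (ltngtP y x.+1) => //; rewrite ltnS => xy; rewrite leqNgt ltnS xy.
apply/allP => x _ /=; apply/eqP; case: x => [|x].
  by rewrite !(count_memPn _) //; [case: (l') | case: (l)] => s /= /andP[].
by have := countS l x; rewrite eqcount countS -!eqcount => /addIn.
Qed.

Section Symmetrizer.
Variables (F : numFieldType) (n : nat) (l : seq nat).
Hypothesis ln : sumn l = n.
Implicit Types x : 'S_n.

Lemma row_col_group1 x : x \in row_group n l -> x \in col_group n l -> x = 1%g.
Proof.
move=> /row_groupP xR /col_groupP xC; apply/permP => k; rewrite perm1; apply: val_inj => /=.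
by rewrite -[LHS](reshape_indexK l) -[RHS](reshape_indexK l) xR xC.
Qed.

Lemma young_coef_prod p q : p \in row_group n l -> q \in col_group n l ->
  young_coef F l (p * q)%g = (-1) ^+ odd_perm q.
Proof.
move=> pR qC; rewrite /young_coef /young_sum (bigD1 p) //= (bigD1 q) //= eqxx.
rewrite [X in _ + X + _]big1 => [|q' /andP[_ /negbTE nq]]; last first.
  by rewrite (inj_eq (mulgI p)) nq; exact: mulr0.
rewrite [X in _ + X]big1 => [|p' /andP[p'R np]]; first by rewrite !addr0; exact: mulr1.
rewrite big1 // => q' q'C; suff /negbTE -> : (p' * q' != p * q)%g by exact: mulr0.
apply: contra np => /eqP e.
have e' : (p^-1 * p' = q * q'^-1)%g by rewrite -(mulgK q' p') e !mulgA mulVg mul1g.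
have := @row_col_group1 (p^-1 * p')%g; rewrite groupM ?groupV // e' groupM ?groupV //.
by move=> /(_ isT isT); rewrite -e' => /(congr1 (mulg p)); rewrite mulKVg mulg1 => ->.
Qed.

(** Either [x] factors into a row and a column permutation, absorbed by reindexing at the cost of a
    sign, or it is not transversal and both sides vanish. *)
Lemma young_sum_mid (V : lmodType F) (f : 'S_n -> V) x :
  \sum_(p in row_group n l) \sum_(q in col_group n l)
    (-1) ^+ odd_perm q *: f (p * x * q)%g = young_coef F l x *: young_sum l f.
Proof.
case: (boolP (transversal_perm l l x)) => [tx | ].
  have [p0 p0R [q0 q0C ->]] := transversal_factor ln tx.
  rewrite young_coef_prod // /young_sum scaler_sumr.
  rewrite (reindex_inj (mulIg p0^-1%g)) /=; apply: eq_big => [p|p _].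
    by rewrite groupMr ?groupV.
  rewrite scaler_sumr (reindex_inj (mulgI q0^-1%g)) /=; apply: eq_big => [q|q _].
    by rewrite groupMl ?groupV.
  rewrite odd_permM odd_permV signr_addb scalerA; congr (_ *: f _).
  by rewrite !mulgA mulgKV mulgK.
move/transversal_permPn => [k [k' [nek rk ck]]].
rewrite (young_sum_vanish _ _ nek rk ck) ?pnatr_eq0 //.
rewrite /young_coef /young_sum big1 ?scale0r // => p /row_groupP pR.
rewrite big1 // => q /col_groupP qC; case: eqP => [xE|_]; last exact: mulr0.
case/eqP: nek; move: ck; rewrite -xE !permM !qC => ck; apply: (@perm_inj _ p).
by apply: val_inj => /=; rewrite -[LHS](reshape_indexK l) -[RHS](reshape_indexK l) ck !pR rk.
Qed.

End Symmetrizer.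

(** * Idempotents of a group algebra *)

Definition fun_mx (F : fieldType) (T : finType) (a : T -> T) : 'M[F]_#|T| :=
  \matrix_(i, j) (enum_val j == a (enum_val i))%:R.

Lemma fun_mxM (F : fieldType) (T : finType) (a b : T -> T) :
  fun_mx F a *m fun_mx F b = fun_mx F (b \o a).
Proof.
apply/matrixP => i j; rewrite !mxE (bigD1 (enum_rank (a (enum_val i)))) //=.
rewrite !mxE enum_rankK eqxx mul1r big1 ?addr0 // => k nk; rewrite !mxE.
by case: eqP => [e|]; [rewrite -e enum_valK eqxx in nk | rewrite mul0r].
Qed.

Lemma mxtrace_fun_mx (F : fieldType) (T : finType) (a : T -> T) :
  \tr (fun_mx F a) = #|[set x | a x == x]|%:R.
Proof.
rewrite /mxtrace -sum1_card natr_sum [RHS]big_mkcond /=.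
rewrite [RHS](reindex (@enum_val T predT)) /=; last exact/onW_bij/enum_val_bij.
by apply: eq_bigr => i _; rewrite !mxE !inE eq_sym; case: eqP.
Qed.

Lemma eq_fun_mx (F : fieldType) (T : finType) (a b : T -> T) :
  a =1 b -> fun_mx F a = fun_mx F b.
Proof. by move=> ab; apply/matrixP => i j; rewrite !mxE ab. Qed.

Section GroupAlgebra.
Variables (F : numFieldType) (gT : finGroupType).

Definition idem_fun (e : gT -> F) :=
  forall x, \sum_h e h * e (h^-1 * x)%g = e x.

Lemma idem_funE (V : lmodType F) (e : gT -> F) (f : gT -> V) : idem_fun e ->
  \sum_g \sum_h (e g * e h) *: f (g * h)%g = \sum_g e g *: f g.
Proof.
move=> ie; under [RHS]eq_bigr do rewrite -ie scaler_suml.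
rewrite [RHS]exchange_big /=; apply: eq_bigr => g _.
by rewrite [RHS](reindex_inj (mulgI g)) /=; apply: eq_bigr => h _; rewrite mulKg.
Qed.

(** The sum is the trace of [g |-> e g d] on the group algebra. This operator is idempotent, so its
    trace is its rank. *)
Lemma idem_pair_nat (e d : gT -> F) : idem_fun e -> idem_fun d ->
  exists k : nat, \sum_g \sum_h \sum_j (e h * d j) * (h * g * j == g)%g%:R = k%:R.
Proof.
move=> ie id.
pose M := \sum_h \sum_j (e h * d j) *: fun_mx F (fun g => h * g * j)%g.
exists (\rank M); rewrite -[RHS]mul1r -(@mxtrace_quasi_idem _ _ 1 M).
  rewrite /M linear_sum exchange_big /=; apply: eq_bigr => h _.
  rewrite linear_sum exchange_big /=; apply: eq_bigr => j _.
  rewrite linearZ /= mxtrace_fun_mx -mulr_sumr; congr (_ * _).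
  rewrite -sum1_card natr_sum [RHS]big_mkcond /=.
  by apply: eq_bigr => g _; rewrite inE; case: eqP.
rewrite scale1r.
transitivity (\sum_h \sum_h' (e h * e h') *: \sum_j \sum_j' (d j * d j') *:
    fun_mx F (fun g => h' * h * g * (j * j'))%g).
  rewrite {1}/M mulmx_suml; apply: eq_bigr => h _.
  rewrite /M mulmx_sumr; apply: eq_bigr => h' _.
  rewrite mulmx_suml scaler_sumr; apply: eq_bigr => j _.
  rewrite mulmx_sumr scaler_sumr; apply: eq_bigr => j' _.
  rewrite -scalemxAl -scalemxAr !scalerA fun_mxM mulrACA; congr (_ *: _).
  by apply: eq_fun_mx => g /=; rewrite !mulgA.
(* Left multiplications compose in the reverse order, so [h] and [h'] are exchanged before the
   idempotence of [e] applies. *)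
rewrite exchange_big /=.
pose G y := \sum_j d j *: fun_mx F (fun g => y * g * j)%g.
transitivity (\sum_h' \sum_h (e h' * e h) *: G (h' * h)%g).
  apply: eq_bigr => h' _; apply: eq_bigr => h _; rewrite mulrC; congr (_ *: _).
  exact: (idem_funE (fun y => fun_mx F (fun g => h' * h * g * y)%g) id).
rewrite (idem_funE G) // /G.
by apply: eq_bigr => h _; rewrite scaler_sumr; apply: eq_bigr => j _; rewrite scalerA.
Qed.

(* Each orbit contributes the trace of [x |-> e x eps] on the group algebra, with
   [eps] the idempotent of the linear character [th x] of a stabilizer: the sum
   is the pairing of [e] with a monomial character. *)
Lemma monomial_pair_nat (X : finType) (D : {pred X}) (act : X -> gT -> X)
    (th : X -> gT -> F) (e : gT -> F) :
    idem_fun e ->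
    (forall x, act x 1%g = x) ->
    (forall x g h, act x (g * h)%g = act (act x g) h) ->
    (forall x g, x \in D -> act x g \in D) ->
    (forall x, x \in D -> th x 1%g = 1) ->
    (forall x g h, x \in D -> act x g = x -> act x h = x ->
       th x (g * h)%g = th x g * th x h) ->
    (forall x g k, x \in D -> act x g = x -> th (act x k) (g ^ k)%g = th x g) ->
  exists k : nat,
    \sum_(x in D) \sum_(g | act x g == x) e g * th x g = k%:R.
Proof.
move=> ie act1 actM actD th1 thM thJ.
pose Phi x := \sum_(g | act x g == x) e g * th x g.
have actV x g : act (act x g) g^-1%g = x by rewrite -actM mulgV act1.
pose orb x y := [exists g, act x g == y].
have orb_refl x : orb x x by apply/existsP; exists 1%g; rewrite act1.
have orbE x y : orb x y -> orb x =1 orb y.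
  move=> /existsP[g /eqP <-] z; apply/existsP/existsP => -[h /eqP <-].
    by exists (g^-1 * h)%g; rewrite actM actV.
  by exists (g * h)%g; rewrite actM.
(* [pick] depends only on the orbit as a predicate, so [rep] is constant on orbits. *)
pose rep x := odflt x [pick y | orb x y].
have repP x : orb x (rep x).
  by rewrite /rep; case: pickP => [y //|/(_ x)]; rewrite orb_refl.
have orbC x y : orb x y -> orb y x by move=> xy; rewrite -(orbE _ _ xy).
have rep_orb x y : orb x y -> rep x = rep y.
  move=> xy; rewrite /rep (eq_pick (orbE _ _ xy)).
  by case: pickP => // /(_ y); rewrite orb_refl.
have key x : x \in D -> exists k : nat, \sum_(y | orb x y) Phi y = k%:R.
  move=> xD; pose St := [set g | act x g == x].
  have St1 : 1%g \in St by rewrite inE act1.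
  have nzSt : #|St|%:R != 0 :> F by rewrite pnatr_eq0 -lt0n; apply/card_gt0P; exists 1%g.
  have StV g : (g^-1%g \in St) = (g \in St).
    rewrite !inE; apply/eqP/eqP => [gx|gx]; last by rewrite -{1}gx actV.
    by rewrite -{1}gx -actM mulVg act1.
  have StM g h : g \in St -> (h \in St) = ((g * h)%g \in St).
    by rewrite !inE actM => /eqP ->.
  pose d g := (g \in St)%:R * th x g^-1%g / #|St|%:R.
  have id : idem_fun d.
    move=> g; rewrite /d; transitivity (\sum_(h in St) (g \in St)%:R * th x g^-1%g / #|St|%:R / #|St|%:R).
      rewrite [RHS]big_mkcond /=; apply: eq_bigr => h _.
      case: (boolP (h \in St)) => hS; last by rewrite !mul0r.
      rewrite mul1r -[(h^-1 * g)%g \in _]StM ?StV //.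
      case: (boolP (g \in St)) => gS; last by rewrite !mul0r mulr0.
      have gx : act x (g^-1 * h)%g = x.
        by rewrite actM; move: gS hS; rewrite -StV !inE => /eqP -> /eqP.
      have hx : act x h^-1%g = x by move: hS; rewrite -StV inE => /eqP.
      rewrite !mul1r invMg invgK mulrACA [th x h^-1%g * _]mulrC -thM // mulgK.
      by rewrite mulrA.
    rewrite sumr_const -[LHS]mulr_natr mulfVK //.
  have [k Ek] := idem_pair_nat ie id; exists k; rewrite -{}Ek.
  have PhiJ u : \sum_(j in St) e (j ^ u)%g * th x j = Phi (act x u).
    rewrite /Phi [RHS](reindex_inj (conjg_inj u)) /=; apply: eq_big => j.
      rewrite inE -actM conjgE !mulgA mulgV mul1g actM.
      by apply/eqP/eqP => [-> //|/(congr1 (act^~ u^-1%g))]; rewrite !actV.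
    by rewrite inE => /eqP jx; rewrite thJ.
  (* Each point of the orbit is reached by as many group elements as [St] has. *)
  transitivity (\sum_k Phi (act x k) / #|St|%:R).
    rewrite (partition_big (act x) predT) //= [LHS]big_mkcond /=.
    apply: eq_bigr => y _; case: (boolP (orb x y)) => [/existsP[g /eqP gx]|nxy].
      rewrite (eq_bigr (fun=> Phi y / #|St|%:R)) => [|g' /eqP -> //].
      rewrite sumr_const -[RHS]mulr_natr.
      transitivity (Phi y / #|St|%:R * #|St|%:R); first by rewrite divfK.
      congr (_ * _%:R); rewrite -(card_imset _ (mulIg g)); apply: eq_card => g'.
      apply/imsetP/eqP => [[h + ->]|g'x].
        by rewrite inE actM => /eqP ->.
      by exists (g' * g^-1)%g; rewrite ?mulgKV // inE actM g'x -gx actV.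
    rewrite big1 // => g /eqP gx; case/negP: nxy.
    by apply/existsP; exists g; rewrite gx.
  rewrite (reindex_inj invg_inj) /=; apply: eq_bigr => g _.
  rewrite -PhiJ exchange_big mulr_suml /= [LHS]big_mkcond /= [RHS](reindex_inj invg_inj) /=.
  apply: eq_bigr => j _; rewrite (bigD1 (j ^ g^-1)%g) //= [X in _ + X]big1; last first.
    move=> h nh; case: eqP => [hE|_]; last by rewrite mulr0.
    case/eqP: nh; apply: (mulIg g); apply: (mulIg j^-1%g).
    by rewrite hE conjgE invgK !mulgA mulgKV mulgK.
  rewrite conjgE invgK !mulgA mulgKV mulgK eqxx mulr1 addr0 /d -[j^-1%g \in St]StV invgK.
  by case: (j \in St); rewrite ?mul1r ?mul0r ?mulr0 // mulrA.
rewrite (partition_big rep (mem D)) /=; last first.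
  move=> x xD; have /existsP[g /eqP <-] := repP x; exact: actD.
apply: (big_ind (fun v => exists k : nat, v = k%:R)); first by exists 0%N.
  by move=> _ _ [k1 ->] [k2 ->]; exists (k1 + k2)%N; rewrite natrD.
move=> x xD; case: (eqVneq (rep x) x) => [rx|nrx]; last first.
  exists 0%N; rewrite big1 // => y /andP[_ /eqP ry]; case/eqP: nrx.
  by rewrite -ry; apply/esym/rep_orb.
have [k Ek] := key x xD; exists k; rewrite -Ek; apply: eq_bigl => y; apply/andP/idP.
  by move=> [yD /eqP <-]; apply/orbC.
move=> xy; split; last by rewrite -(rep_orb _ _ xy) rx.
by have /existsP[g /eqP <-] := xy; apply: actD.
Qed.

End GroupAlgebra.

(** * Idempotents and characters of shapes *)

Section YoungIdempotent.
Variables (F : numFieldType) (n : nat).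
Implicit Types (l : seq nat) (x : 'S_n).

(** The scalar relating [Y x Y] to the Young symmetrizer [Y]: in the words [p q x p' q'],
    [young_sum_mid] turns the inner part [q x p'] into its coefficient. *)
Definition sandwich_coef l x : F :=
  \sum_(q in col_group n l) \sum_(p in row_group n l)
    (-1) ^+ odd_perm q * young_coef F l (q * x * p)%g.

Lemma young_pairE l l' (V : lmodType F) (f : 'S_n -> V) x :
  \sum_g \sum_h (young_coef F l g * young_coef F l' h) *: f (g * x * h)%g =
  \sum_(p in row_group n l) \sum_(q in col_group n l)
  \sum_(p' in row_group n l') \sum_(q' in col_group n l')
    ((-1) ^+ odd_perm q * (-1) ^+ odd_perm q') *: f (p * q * x * (p' * q'))%g.
Proof.
under eq_bigr do under eq_bigr do rewrite -scalerA.
under eq_bigr do rewrite -scaler_sumr (young_coefE l' (fun h => f (_ * h)%g)).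
rewrite (young_coefE l (fun g => young_sum l' (fun h => f (g * x * h)%g))).
rewrite /young_sum; apply: eq_bigr => p _; apply: eq_bigr => q _.
rewrite scaler_sumr; apply: eq_bigr => p' _.
by rewrite scaler_sumr; apply: eq_bigr => q' _; rewrite scalerA.
Qed.

Lemma young_sandwich l (V : lmodType F) (f : 'S_n -> V) x : sumn l = n ->
  \sum_g \sum_h (young_coef F l g * young_coef F l h) *: f (g * x * h)%g =
  sandwich_coef l x *: young_sum l f.
Proof.
move=> ln; rewrite young_pairE /sandwich_coef.
rewrite exchange_big scaler_suml /=; apply: eq_bigr => q _.
under eq_bigr do under eq_bigr do under eq_bigr do rewrite -scalerA.
rewrite exchange_big scaler_suml /=; apply: eq_bigr => p' _.
rewrite -scalerA -(young_sum_mid ln) scaler_sumr; apply: eq_bigr => p _.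
by rewrite scaler_sumr; apply: eq_bigr => q' _; rewrite !mulgA.
Qed.

Lemma young_coef1 l : sumn l = n -> young_coef F l (1 : 'S_n)%g = 1.
Proof.
by move=> ln; rewrite -(mulg1 1%g) young_coef_prod ?group1 ?odd_perm1.
Qed.

(* The element acts on the group algebra with trace [n!], and its square is
   [sandwich_coef l 1] times itself. *)
Lemma sandwich_coef1_neq0 l : sumn l = n -> sandwich_coef l (1 : 'S_n)%g != 0.
Proof.
move=> ln; pose L (g : 'S_n) := fun_mx F (fun x => x * g)%g.
pose M := \sum_g young_coef F l g *: L g.
have LM g h : L g *m L h = L (g * h)%g.
  by rewrite /L fun_mxM; apply: eq_fun_mx => x /=; rewrite mulgA.
have MM : M *m M = sandwich_coef l 1%g *: M.
  rewrite {3}/M young_coefE -young_sandwich // {1}/M mulmx_suml.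
  apply: eq_bigr => g _; rewrite /M mulmx_sumr; apply: eq_bigr => h _.
  by rewrite -scalemxAl -scalemxAr scalerA LM mulg1.
have trM : \tr M = #|'S_n|%:R.
  rewrite linear_sum (bigD1 1%g) //= big1 ?addr0 => [|g ng]; last first.
    rewrite linearZ /= mxtrace_fun_mx (_ : [set _ | _] = finset.set0) ?cards0 ?mulr0 //.
    apply/setP => x; rewrite !inE; apply/negbTE; apply: contra ng => /eqP.
    by rewrite -[RHS]mulg1 => /mulgI ->.
  rewrite linearZ /= young_coef1 // mul1r mxtrace_fun_mx; congr _%:R.
  by apply: eq_card => x; rewrite !inE mulg1 eqxx.
apply/eqP => s0; move: (mxtrace_quasi_idem MM); rewrite s0 mul0r trM => /eqP.
by rewrite pnatr_eq0 -leqn0 leqNgt; case/negP; apply/card_gt0P; exists 1%g.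
Qed.

Definition young_idem l x : F := young_coef F l x / sandwich_coef l (1 : 'S_n)%g.

Lemma young_idem_sandwich l (V : lmodType F) (f : 'S_n -> V) x : sumn l = n ->
  \sum_g \sum_h (young_idem l g * young_idem l h) *: f (g * x * h)%g =
  (sandwich_coef l x / sandwich_coef l (1 : 'S_n)%g) *: \sum_g young_idem l g *: f g.
Proof.
move=> ln; rewrite /young_idem; set s := sandwich_coef l 1%g.
transitivity (s^-1 ^+ 2 *: (sandwich_coef l x *: young_sum l f)).
  rewrite -young_sandwich // scaler_sumr; apply: eq_bigr => g _.
  rewrite scaler_sumr; apply: eq_bigr => h _; rewrite scalerA; congr (_ *: _).
  by rewrite expr2 mulrACA mulrC.
rewrite -young_coefE !scaler_sumr; apply: eq_bigr => g _; rewrite !scalerA expr2.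
by congr (_ *: _); rewrite [RHS]mulrACA [RHS]mulrC mulrA.
Qed.

Lemma young_idem_idem l : sumn l = n -> idem_fun (young_idem l).
Proof.
move=> ln x; pose f y : F^o := (y == x)%:R.
have := young_idem_sandwich f 1%g ln.
have fE (e : 'S_n -> F) g : \sum_h e h *: f (g * h)%g = e (g^-1 * x)%g.
  rewrite (bigD1 (g^-1 * x)%g) //= big1 => [|h nh].
    by rewrite addr0 /f mulKVg eqxx; exact: mulr1.
  rewrite /f (_ : (g * h == x)%g = false) ?scaler0 //; apply/negbTE; apply: contra nh.
  by move=> /eqP <-; rewrite mulKg.
rewrite divff ?sandwich_coef1_neq0 // scale1r.
have -> : \sum_g young_idem l g *: f g = young_idem l x.
  by have := fE (young_idem l) 1%g; under eq_bigr do rewrite mul1g; rewrite invg1 mul1g.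
move=> <-; apply: eq_bigr => g _; rewrite -(fE (young_idem l)).
rewrite [LHS](scaler_sumr (young_idem l g)); apply: eq_bigr => h _.
by rewrite scalerA mulg1.
Qed.

Lemma young_sum_vanish_rev l l' (V : lmodType F) (f : 'S_n -> V) x (k k' : 'I_n) :
    k != k' ->
    reshape_index l' k = reshape_index l' k' ->
    reshape_offset l (x^-1%g k) = reshape_offset l (x^-1%g k') ->
  \sum_(q in col_group n l) \sum_(p in row_group n l')
    (-1) ^+ odd_perm q *: f (q * x * p)%g = 0.
Proof.
move=> nek rk ck.
rewrite -[RHS](@young_sum_vanish F n l' l V (fun g => f g^-1%g) x^-1%g k k') ?pnatr_eq0 //.
rewrite exchange_big (reindex_inj invg_inj) /=; apply: eq_big => p; first by rewrite groupV.
rewrite groupV => pR; rewrite (reindex_inj invg_inj) /=; apply: eq_big => q; first by rewrite groupV.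
by rewrite odd_permV !invMg !invgK mulgA.
Qed.

(** If some permutation is transversal from [l] to [l'], none is from [l'] to [l], since the column
    counts would agree. So either the inner sum, over columns of [l] and rows of [l'], vanishes for
    every middle word, or the outer sum, over rows of [l] and columns of [l'], does. *)
Lemma young_idem_orthogonal (l l' : intpart) (V : lmodType F) (f : 'S_n -> V) x :
    psize l = n -> psize l' = n -> l != l' ->
  \sum_g \sum_h (young_idem l g * young_idem l' h) *: f (g * x * h)%g = 0.
Proof.
move=> ln l'n nel; set s := sandwich_coef l 1%g; set s' := sandwich_coef l' 1%g.
transitivity ((s^-1 * s'^-1) *: \sum_g \sum_h
    (young_coef F l g * young_coef F l' h) *: f (g * x * h)%g).
  rewrite scaler_sumr; apply: eq_bigr => g _; rewrite scaler_sumr; apply: eq_bigr => h _.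
  by rewrite scalerA; congr (_ *: _); rewrite mulrACA mulrC.
rewrite young_pairE; apply/eqP; rewrite scaler_eq0; apply/orP; right; apply/eqP.
have vanish1 y : ~~ transversal_perm l l' y ->
  \sum_(p in row_group n l) \sum_(q' in col_group n l')
    (-1) ^+ odd_perm q' *: f (p * y * q')%g = 0.
  move=> /transversal_permPn[k [k' [nek rk ck]]].
  by rewrite (young_sum_vanish _ _ nek rk ck) ?pnatr_eq0.
have vanish2 (g : 'S_n -> V) y : ~~ transversal_perm l' l y^-1%g ->
  \sum_(q in col_group n l) \sum_(p' in row_group n l')
    (-1) ^+ odd_perm q *: g (q * y * p')%g = 0.
  by move=> /transversal_permPn[k [k' [nek rk ck]]]; exact: young_sum_vanish_rev nek rk ck.
have [/existsP[y ty]|] := boolP [exists y : 'S_n, transversal_perm l l' y].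
  have ntr (z : 'S_n) : ~~ transversal_perm l' l z.
    apply: contra nel => tz; apply/eqP/(intpart_col_inj ln l'n) => c.
    by apply/eqP; rewrite eqn_leq (col_count_leq _ ln ty) (col_count_leq _ l'n tz).
  rewrite big1 // => p _.
  transitivity (\sum_(q' in col_group n l') \sum_(q in col_group n l)
      \sum_(p' in row_group n l') (-1) ^+ odd_perm q *:
      ((-1) ^+ odd_perm q' *: f (p * (q * x * p') * q')%g)).
    rewrite [RHS]exchange_big /=; apply: eq_bigr => q _.
    rewrite [RHS]exchange_big /=; apply: eq_bigr => p' _; apply: eq_bigr => q' _.
    by rewrite scalerA !mulgA.
  rewrite big1 // => q' _.
  exact: (vanish2 (fun z => (-1) ^+ odd_perm q' *: f (p * z * q')%g)).
rewrite negb_exists => /forallP ntr.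
rewrite exchange_big big1 //= => q _; rewrite exchange_big big1 //= => p' _.
transitivity ((-1) ^+ odd_perm q *: \sum_(p in row_group n l) \sum_(q' in col_group n l')
    (-1) ^+ odd_perm q' *: f (p * (q * x * p') * q')%g).
  rewrite scaler_sumr; apply: eq_bigr => p _; rewrite scaler_sumr; apply: eq_bigr => q' _.
  by rewrite scalerA !mulgA.
by rewrite vanish1 ?scaler0.
Qed.

(** The character of the Specht module, see [specht_trace]: the trace of a translation on the ideal
    of an idempotent sums that idempotent over a conjugacy class. *)
Definition young_char l x : F := \sum_g young_idem l (x ^ g)%g.

Lemma young_charJ l x y : young_char l (x ^ y)%g = young_char l x.
Proof.
rewrite /young_char [RHS](reindex_inj (mulgI y)) /=.
by apply: eq_bigr => g _; rewrite conjgM.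
Qed.

(* The sum of the conjugates of [a b] is also that of [b a]. *)
Lemma young_charV l x : young_char l x^-1%g = young_char l x.
Proof.
rewrite /young_char /young_idem -!mulr_suml; congr (_ / _).
rewrite /young_coef /young_sum.
rewrite exchange_big [RHS]exchange_big /= (reindex_inj invg_inj) /=.
apply: eq_big => p; first by rewrite groupV.
move=> _; rewrite exchange_big [RHS]exchange_big /= (reindex_inj invg_inj) /=.
apply: eq_big => q; first by rewrite groupV.
move=> _; rewrite [RHS](reindex_inj (mulIg p^-1%g)) /=; apply: eq_bigr => g _.
rewrite odd_permV conjVg -invMg (inj_eq invg_inj) conjgM.
by rewrite -(inj_eq (conjg_inj p) (p * q)%g) /= conjgKV [((p * q) ^ p)%g]conjgE !mulgA mulVg mul1g.
Qed.

(** The left side is the trace of [g |-> e g e'] on the group algebra, [e] and [e'] being the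
    idempotents of [l] and [l']. It is zero by orthogonality unless the shapes agree. *)
Lemma young_char_idem (l l' : intpart) : psize l = n -> psize l' = n ->
  \sum_w young_idem l w * young_char l' w = (l == l')%:R.
Proof.
move=> ln l'n; under eq_bigr do rewrite -young_charV.
pose f y : 'S_n -> F^o := fun z => (z == y)%:R.
transitivity (\sum_g \sum_w \sum_k
    (young_idem l w * young_idem l' k) *: f g (w * g * k)%g).
  under eq_bigr do rewrite mulr_sumr.
  rewrite exchange_big /=; apply: eq_bigr => g _; apply: eq_bigr => w _.
  rewrite (bigD1 (w^-1 ^ g)%g) //= big1 => [|k nk].
    rewrite addr0 /f (_ : (w * g * w^-1 ^ g)%g = g) ?eqxx; first by exact/esym/mulr1.
    by rewrite conjgE !mulgA mulgK mulgV mul1g.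
  rewrite /f; case: eqP => [e|_]; last exact: mulr0.
  case/eqP: nk; apply: (mulgI (w * g)%g); rewrite e conjgE !mulgA mulgK mulgV mul1g //.
case: (eqVneq l l') => [<-|nl]; last first.
  by rewrite big1 // => g _; rewrite young_idem_orthogonal.
under eq_bigr do rewrite young_idem_sandwich //.
have fE (e : 'S_n -> F) g : \sum_h e h *: f g h = e g.
  rewrite (bigD1 g) //= big1 => [|h /negbTE nh]; last by rewrite /f nh scaler0.
  by rewrite addr0 /f eqxx; exact: mulr1.
under eq_bigr do rewrite fE.
pose f1 : 'S_n -> F^o := f 1%g.
(* With [s] the sandwich coefficient, what remains is the sum of [e(g) s(g) / s(1)]. As [e g e] is
   [s(g) / s(1)] times [e], multiplying by [e(1)] turns it into the coefficient of [e e e = e] at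
   the identity. *)
have e1 : young_idem l 1%g != 0.
  by rewrite /young_idem young_coef1 // div1r invr_eq0 sandwich_coef1_neq0.
apply: (mulIf e1); rewrite mul1r.
transitivity (\sum_g young_idem l g * \sum_w \sum_k
    (young_idem l w * young_idem l k) *: f1 (w * g * k)%g).
  rewrite mulr_suml; apply: eq_bigr => g _; rewrite young_idem_sandwich // fE.
  by rewrite -[RHS]/(_ * (_ * _)) [RHS]mulrCA [RHS]mulrA.
pose h1 w k : F^o := young_idem l k *: f1 (w * k)%g.
transitivity (\sum_w \sum_g (young_idem l w * young_idem l g) *:
   \sum_k h1 (w * g)%g k).
  rewrite exchange_big /=; apply: eq_bigr => g _; rewrite mulr_sumr; apply: eq_bigr => w _.
  rewrite scaler_sumr mulr_sumr; apply: eq_bigr => k _; rewrite /h1.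
  move: (young_idem l g) (young_idem l w) (young_idem l k) (f1 _) => u v a d.
  by rewrite scalerA -[LHS]/(u * (v * a * d)) -[RHS]/(v * u * a * d) [v * u]mulrC !mulrA.
have iel : idem_fun (young_idem l) by exact: young_idem_idem.
rewrite (idem_funE (fun w => \sum_k h1 w k) iel).
transitivity (\sum_w \sum_k (young_idem l w * young_idem l k) *: f1 (w * k)%g).
  by apply: eq_bigr => w _; rewrite scaler_sumr; apply: eq_bigr => k _; rewrite scalerA.
rewrite (idem_funE f1 iel); exact: fE.
Qed.

End YoungIdempotent.

(** * Characters of centralizers *)

Section OrbitRepresentatives.
Variable T : finType.
Implicit Types (c s k : {perm T}) (x y : T).

Lemma eq_permX c x i j :
  ((c ^+ i)%g x == (c ^+ j)%g x) = (i == j %[mod #|porbit c x|])%N.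
Proof.
have n_gt0 : (0 < #|porbit c x|)%N by apply/card_gt0P; exists x; exact: porbit_id.
have modE m : (c ^+ m)%g x = (c ^+ (m %% #|porbit c x|)%N)%g x.
  rewrite {1}(divn_eq m #|porbit c x|) expgD mulnC expgM permM; congr (fun_of_perm _ _).
  elim: (m %/ _)%N => [|d IH]; first by rewrite expg0 perm1.
  by rewrite expgSr permM IH permX iter_porbit.
rewrite modE [in X in _ == X]modE.
have lt m := ltn_pmod m n_gt0.
have nthE m : (m < #|porbit c x|)%N ->
    (c ^+ m)%g x = nth x (traject c x #|porbit c x|) m.
  by move=> lm; rewrite nth_traject // permX.
by rewrite !nthE // nth_uniq ?size_traject // uniq_traject_porbit.
Qed.

Lemma permXK c x i : (c ^+ i)%g x = x <-> (#|porbit c x| %| i)%N.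
Proof.
rewrite -[RHS in _ = RHS](perm1 x) -(expg0 c); split => [/eqP|di].
  by rewrite eq_permX mod0n.
by apply/eqP; rewrite eq_permX mod0n.
Qed.

Definition porep c x : T := odflt x [pick y in porbit c x].

Lemma porep_mem c x : porep c x \in porbit c x.
Proof. by rewrite /porep; case: pickP => [y //|_] /=; exact: porbit_id. Qed.

Lemma mem_porbit_eq c x y : (y \in porbit c x) = (porbit c x == porbit c y).
Proof. by rewrite eq_porbit_mem porbit_sym. Qed.

Lemma eq_porep c x y : (porep c x == porep c y) = (y \in porbit c x).
Proof.
rewrite mem_porbit_eq; apply/eqP/eqP => [e|e].
  have := porep_mem c x; have := porep_mem c y.
  by rewrite e !mem_porbit_eq => /eqP -> /eqP ->.
rewrite /porep e; case: pickP => // /(_ y).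
by rewrite porbit_id.
Qed.

Lemma porepK c x : porep c (porep c x) = porep c x.
Proof. by apply/eqP; rewrite eq_sym eq_porep porep_mem. Qed.

Lemma porep_perm c x i : porep c ((c ^+ i)%g x) = porep c x.
Proof. by apply/eqP; rewrite eq_sym eq_porep; exact: mem_porbit. Qed.

Lemma commute_perm c s x : commute c s -> s (c x) = c (s x).
Proof. by rewrite -!permM => ->. Qed.

Lemma commute_permX c s x i j : commute c s ->
  (s ^+ i)%g ((c ^+ j)%g x) = (c ^+ j)%g ((s ^+ i)%g x).
Proof. by move=> cs; apply/commute_perm/commuteX2. Qed.

Lemma mem_porbit_commute c s x y : commute c s ->
  (s y \in porbit c (s x)) = (y \in porbit c x).
Proof.
move=> cs; apply/porbitP/porbitP => -[i e]; exists i.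
  have := commute_permX x 1 i cs; rewrite expg1 => e'.
  by apply: (@perm_inj _ s); rewrite e e'.
by rewrite e; have := commute_permX x 1 i cs; rewrite expg1.
Qed.

Lemma card_porbit_commute c s x : commute c s -> #|porbit c (s x)| = #|porbit c x|.
Proof.
move=> cs; rewrite -[RHS](card_imset _ (@perm_inj _ s)); congr #|pred_of_set _|.
apply/setP => y; rewrite -(permKV s y) mem_porbit_commute //.
apply/idP/imsetP => [yo | [y' y'o /perm_inj ->] //].
by exists (s^-1%g y).
Qed.

(** A product over orbits does not depend on the transversal. The properties of [theta] rest on
    replacing its representatives by others. *)
Lemma prod_porbits (R : comNzRingType) c (q : T -> R) (O : {set T}) (I : finType)
    (D : {pred I}) (h : I -> T) :
    (forall x, q (c x) = q x) ->
    (forall i, i \in D -> h i \in O) ->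
    (forall x, x \in O -> c x \in O) ->
    {in D &, forall i j, h j \in porbit c (h i) -> i = j} ->
    (forall x, x \in O -> exists2 i, i \in D & x \in porbit c (h i)) ->
  \prod_(x in O | porep c x == x) q x = \prod_(i in D) q (h i).
Proof.
move=> qc hO cO hI hS.
have qo x y : y \in porbit c x -> q y = q x.
  by case/porbitP=> i ->; elim: i => [|i IH]; rewrite ?expg0 ?perm1 // expgSr permM qc.
have Oo x y : y \in porbit c x -> x \in O -> y \in O.
  case/porbitP=> i -> xO; elim: i => [|i IH]; rewrite ?expg0 ?perm1 //.
  by rewrite expgSr permM cO.
transitivity (\prod_(x in [set porep c (h i) | i in D]) q x).
  apply: eq_bigl => x; apply/andP/imsetP => [[xO /eqP rx]|[i iD ->]].
    have [i iD xi] := hS x xO; exists i => //.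
    by rewrite -rx; apply/eqP; rewrite eq_sym eq_porep.
  by rewrite porepK; split=> //; apply: Oo (hO i iD); exact: porep_mem.
rewrite big_imset /=; last first.
  by move=> i j iD jD /eqP; rewrite eq_porep; exact: hI.
by apply: eq_bigr => i _; apply: qo; exact: porep_mem.
Qed.
End OrbitRepresentatives.

Section LinearCharacter.
Variables (F : numFieldType) (zeta : nat -> F).
Hypothesis zetaP : forall n, (0 < n)%N -> n.-primitive_root (zeta n).
Variable T : finType.
Implicit Types (c s k z : {perm T}) (x y : T) (g : T -> F).

Lemma porbit_gt0 c x : (0 < #|porbit c x|)%N.
Proof. by apply/card_gt0P; exists x; exact: porbit_id. Qed.

Lemma zeta1 : zeta 1 = 1.
Proof. by have := prim_expr_order (zetaP (isT : (0 < 1)%N)); rewrite expr1. Qed.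

(** Two gauges differ by a [c]-invariant factor, which cancels in [theta]; so [theta] may be
    computed in the most convenient one. *)
Definition gauge c g :=
  (forall x, g x != 0) /\ (forall x, g (c x) = zeta #|porbit c x| * g x).

Definition std_gauge c x : F :=
  zeta #|porbit c x| ^+ index x (traject c (porep c x) #|porbit c x|).

Lemma card_porbit_perm c x : #|porbit c (c x)| = #|porbit c x|.
Proof. by rewrite card_porbit_commute. Qed.

Lemma std_gaugeP c : gauge c (std_gauge c).
Proof.
have gE x i : x = (c ^+ i)%g (porep c x) -> std_gauge c x = zeta #|porbit c x| ^+ i.
  move=> xE; rewrite /std_gauge; set n := #|porbit c x|; set r := porep c x.
  have nE : n = #|porbit c r|.
    have /eqP e : porbit c x == porbit c r by rewrite -mem_porbit_eq porep_mem.
    by rewrite /n e.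
  apply/eqP; rewrite (eq_prim_root_expr (zetaP (porbit_gt0 c x))) -/n nE -eq_permX -/r -xE.
  have lt : (index x (traject c r n) < n)%N.
    by rewrite -{2}(size_traject c r n) index_mem nE -porbit_traject porbit_sym porep_mem.
  rewrite -nE permX -(nth_traject c lt) nth_index // -index_mem size_traject //.
split=> x.
  by rewrite expf_neq0 // (prim_root_eq0 (zetaP (porbit_gt0 c x))) -lt0n porbit_gt0.
have /porbitP[i xE] : x \in porbit c (porep c x) by rewrite porbit_sym porep_mem.
have rc : porep c (c x) = porep c x by have := porep_perm c x 1; rewrite expg1.
rewrite (gE x i xE) (gE (c x) i.+1) ?card_porbit_perm ?exprS // rc.
by rewrite expgSr permM -xE.
Qed.

(* On the centralizer of [c] this is the linear character whose restriction to the
   cyclic group of each cycle of [c] is primitive. *)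
Definition theta c s : F :=
  \prod_(x | porep c x == x) (std_gauge c (s x) / std_gauge c x).

Lemma ratio_perm c s g x : commute c s -> gauge c g ->
  g (s (c x)) / g (c x) = g (s x) / g x.
Proof.
move=> cs [g0 gc]; rewrite (commute_perm _ cs) !gc card_porbit_commute //.
have nz : zeta #|porbit c x| != 0.
  by rewrite (prim_root_eq0 (zetaP (porbit_gt0 c x))) -lt0n porbit_gt0.
by rewrite invfM mulrACA divff // mul1r.
Qed.

Lemma prod_porbits_all (I : finType) (D : {pred I}) (h : I -> T) c (q : T -> F) :
    (forall x, q (c x) = q x) ->
    {in D &, forall i j, h j \in porbit c (h i) -> i = j} ->
    (forall x, exists2 i, i \in D & x \in porbit c (h i)) ->
  \prod_(x | porep c x == x) q x = \prod_(i in D) q (h i).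
Proof.
move=> qc hI hS; rewrite -(@prod_porbits T F c q [set: T] I D h) //.
by apply: eq_bigl => x; rewrite inE.
Qed.

Lemma porep_transversal c s : commute c s ->
  [/\ {in [pred x | porep c x == x] &, forall i j, s j \in porbit c (s i) -> i = j} &
      (forall x, exists2 i, i \in [pred x | porep c x == x] & x \in porbit c (s i))].
Proof.
move=> cs; split=> [i j /eqP ri /eqP rj|x].
  by rewrite mem_porbit_commute // -eq_porep ri rj => /eqP.
exists (porep c (s^-1%g x)); first by rewrite inE porepK.
by rewrite -{1}(permKV s x) mem_porbit_commute // porbit_sym porep_mem.
Qed.

(** The quotient [q] of the two gauges is constant on the cycles of [c], and [s] permutes these
    cycles, so the product of [q] over representatives is unchanged by [s]. *)
Lemma theta_gauge c s g : commute c s -> gauge c g ->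
  theta c s = \prod_(x | porep c x == x) (g (s x) / g x).
Proof.
move=> cs [g0 gc]; rewrite /theta; have [h0 hc] := std_gaugeP c.
set h := std_gauge c in h0 hc *; pose q x := g x / h x.
have qc x : q (c x) = q x.
  have nz : zeta #|porbit c x| != 0.
    by rewrite (prim_root_eq0 (zetaP (porbit_gt0 c x))) -lt0n porbit_gt0.
  by rewrite /q gc hc invfM mulrACA divff // mul1r.
have [tI tS] := porep_transversal cs.
have E : \prod_(x | porep c x == x) q x = \prod_(x | porep c x == x) q (s x).
  exact: (prod_porbits_all qc tI tS).
have q0 : \prod_(x | porep c x == x) q x != 0.
  by apply/prodf_neq0 => x _; rewrite mulf_neq0 ?invr_eq0.
apply: (mulfI q0); rewrite {1}E -!big_split /=; apply: eq_bigr => x _; rewrite /q.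
by rewrite mulrA divfK // [RHS]mulrC mulrA divfK.
Qed.

Lemma thetaM c s s' : commute c s -> commute c s' ->
  theta c (s * s')%g = theta c s * theta c s'.
Proof.
move=> cs cs'; have gP := std_gaugeP c; set g := std_gauge c in gP.
have g0 := gP.1; pose q x := g (s' x) / g x.
have qc x : q (c x) = q x by exact: ratio_perm.
have [tI tS] := porep_transversal cs.
have E : \prod_(x | porep c x == x) q x = \prod_(x | porep c x == x) q (s x).
  exact: (prod_porbits_all qc tI tS).
rewrite [X in _ = _ * X]E /theta -big_split /=; apply: eq_bigr => x _.
by rewrite permM /q [RHS]mulrC mulrA divfK.
Qed.

Lemma theta_id c : theta c 1%g = 1.
Proof.
by rewrite /theta big1 // => x _; rewrite perm1 divff // (std_gaugeP c).1.
Qed.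

Lemma porbit_conj c k x y : (k y \in porbit (c ^ k)%g (k x)) = (y \in porbit c x).
Proof.
have cE i : ((c ^ k) ^+ i)%g (k x) = k ((c ^+ i)%g x).
  by rewrite -conjXg conjgE !permM permK.
apply/porbitP/porbitP => -[i e]; exists i; last by rewrite cE e.
by apply: (@perm_inj _ k); rewrite e cE.
Qed.

Lemma card_porbit_conj c k x : #|porbit (c ^ k)%g (k x)| = #|porbit c x|.
Proof.
rewrite -[RHS](card_imset _ (@perm_inj _ k)); congr #|pred_of_set _|.
apply/setP => y; rewrite -(permKV k y) porbit_conj.
apply/idP/imsetP => [yo | [y' y'o /perm_inj ->] //].
by exists (k^-1%g y).
Qed.

Lemma theta_conj c s k : commute c s -> theta (c ^ k)%g (s ^ k)%g = theta c s.
Proof.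
move=> cs; have [g0 gc] := std_gaugeP c; set g := std_gauge c in g0 gc.
have cs' : commute (c ^ k)%g (s ^ k)%g by rewrite /commute -!conjMg cs.
have ck x : (c ^ k)%g x = k (c (k^-1%g x)) by rewrite conjgE !permM.
have gP' : gauge (c ^ k)%g (fun x => g (k^-1%g x)).
  split=> x //; rewrite ck permK gc; congr (zeta _ * _).
  by rewrite -(card_porbit_conj c k) permKV.
rewrite (theta_gauge cs' gP').
pose q x := g (k^-1%g ((s ^ k)%g x)) / g (k^-1%g x).
have qE x : q (k x) = g (s x) / g x by rewrite /q conjgE !permM !permK.
rewrite (@prod_porbits_all T [pred x | porep c x == x] k _ q).
- by apply: eq_bigr => x _; rewrite qE.
- by move=> x; rewrite -(permKV k x) ck permK !qE; exact: ratio_perm.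
- by move=> i j /eqP ri /eqP rj; rewrite porbit_conj -eq_porep ri rj => /eqP.
move=> x; exists (porep c (k^-1%g x)); first by rewrite inE porepK.
by rewrite -{1}(permKV k x) porbit_conj porbit_sym porep_mem.
Qed.

End LinearCharacter.

Section PhaseSum.
Variables (F : numFieldType) (zeta : nat -> F).
Hypothesis zetaP : forall n, (0 < n)%N -> n.-primitive_root (zeta n).

Lemma sum_inj_unity_roots q (u : 'I_q -> F) : (1 < q)%N -> injective u ->
  (forall i, u i ^+ q = 1) -> \sum_i u i = 0.
Proof.
move=> q1 uI uq; have xiP := zetaP (ltnW q1); set xi := zeta q in xiP.
have kP i : exists k : 'I_q, u i == xi ^+ k.
  by have [k ->] := prim_rootP xiP (uq i); exists k.
pose k i := xchoose (kP i).
have kE i : u i = xi ^+ k i by apply/eqP; exact: (xchooseP (kP i)).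
have kI : injective k by move=> i j kij; apply: uI; rewrite !kE kij.
under eq_bigr do rewrite kE.
have -> : \sum_i xi ^+ k i = \sum_(i < q) xi ^+ i by rewrite [RHS](reindex_inj kI).
have xi1 : xi - 1 != 0.
  rewrite subr_eq0 -{1}[xi]expr1 -[1](expr0 xi) (eq_prim_root_expr xiP).
  by rewrite mod0n modn_small.
by apply: (mulfI xi1); rewrite mulr0 -subrX1 prim_expr_order ?subrr.
Qed.

(** The roots [zeta n] are chosen independently for each [n], so terms are compared through their
    orders: [om w] has order [q %/ gcdn w q], which determines the gcd, and then its exponent [j],
    inverse to [w %/ gcdn w q], determines [w] modulo [q]. The terms are thus all the [q]-th roots
    of unity. *)
Lemma sum_phase q b v (om : nat -> F) : (1 < q)%N -> (0 < b)%N ->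
    (forall w, exists2 j, (w * j = gcdn w q %[mod q])%N &
       om w = zeta (b * (q %/ gcdn w q))%N ^+ (b * j)%N) ->
  \sum_(i < q) om (v + i)%N = 0.
Proof.
move=> q1 b0 omP; have q0 : (0 < q)%N := ltnW q1.
have G0 w : (0 < gcdn w q)%N by rewrite gcdn_gt0 q0 orbT.
have qE w : (q = q %/ gcdn w q * gcdn w q)%N by rewrite divnK ?dvdn_gcdr.
have e0 w : (0 < q %/ gcdn w q)%N by rewrite divn_gt0 // dvdn_leq ?dvdn_gcdr.
have ZP w : (q %/ gcdn w q)%N.-primitive_root (zeta (b * (q %/ gcdn w q))%N ^+ b).
  have := dvdn_prim_root (zetaP (_ : 0 < b * (q %/ gcdn w q))%N) (dvdn_mull b (dvdnn _)).
  by rewrite mulnK //; apply; rewrite muln_gt0 b0 e0.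
have jP w : exists2 j, (w %/ gcdn w q * j = 1 %[mod q %/ gcdn w q])%N &
    om w = (zeta (b * (q %/ gcdn w q))%N ^+ b) ^+ j.
  have [j jE omE] := omP w; exists j; last by rewrite omE exprM.
  move: jE (G0 w) (divnK (dvdn_gcdl w q)) (qE w).
  move: (gcdn w q) (w %/ _)%N (q %/ _)%N => G w1 e jE G_gt0 wE qE'.
  have : ((w1 * j * G) %% (e * G) = (1 * G) %% (e * G))%N.
    by rewrite mul1n mulnAC wE -qE'.
  by rewrite -!muln_modl // => /eqP; rewrite eqn_pmul2r // => /eqP.
apply: sum_inj_unity_roots => // [i i'|i]; last first.
  have [j _ ->] := jP (v + i)%N; move: (v + i)%N => w; rewrite exprAC.
  have -> : (zeta (b * (q %/ gcdn w q))%N ^+ b) ^+ q = 1.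
    apply/eqP; rewrite -(prim_order_dvd (ZP w)); apply/dvdnP.
    by exists (gcdn w q); rewrite mulnC -qE.
  by rewrite expr1n.
have prim_om w : (q %/ gcdn w q)%N.-primitive_root (om w).
  have [j jE ->] := jP w; rewrite prim_root_exp_coprime ?ZP //.
  have : coprime (w %/ gcdn w q * j) (q %/ gcdn w q).
    by rewrite -coprime_modl jE coprime_modl coprime1n.
  by rewrite coprimeMl => /andP[].
move=> om_eq; set w := (v + i)%N in om_eq; set w' := (v + i')%N in om_eq.
have prim_inj e e' (x : F) : e.-primitive_root x -> e'.-primitive_root x -> e = e'.
  move=> xe xe'; apply/eqP; rewrite eqn_dvd; apply/andP; split.
    by rewrite (prim_order_dvd xe) prim_expr_order.
  by rewrite (prim_order_dvd xe') prim_expr_order.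
have eE : (q %/ gcdn w q = q %/ gcdn w' q)%N.
  by apply: (prim_inj _ _ (om w)); [exact: prim_om | rewrite om_eq; exact: prim_om].
have GE : gcdn w q = gcdn w' q.
  by apply/eqP; rewrite -(eqn_pmul2l (e0 w)) -qE eE -qE.
have [j jE oE] := jP w; have [j' j'E oE'] := jP w'.
have /eqP : om w = om w' by [].
rewrite oE oE' -eE (eq_prim_root_expr (ZP w)); move: jE j'E (qE w).
have := divnK (dvdn_gcdl w q); have := divnK (dvdn_gcdl w' q); rewrite -eE -GE.
move: (gcdn w q) (q %/ _)%N (w %/ _)%N (w' %/ _)%N => G e y y' w'E wE jE j'E qE' /eqP jj.
have yy : (y = y' %[mod e])%N.
  transitivity ((y * (y' * j')) %% e)%N; first by rewrite -modnMmr j'E modnMmr muln1.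
  transitivity ((y' * (y * j)) %% e)%N; last by rewrite -modnMmr jE modnMmr muln1.
  have yj : ((y * j') %% e = (y * j) %% e)%N by rewrite -modnMmr -jj modnMmr.
  by rewrite mulnCA -modnMmr yj modnMmr.
apply: val_inj => /=; move: (modn_small (ltn_ord i)) (modn_small (ltn_ord i')) => <- <-.
apply/eqP; rewrite -(eqn_modDl v) -/w -/w' -w'E -wE qE' -!muln_modl ?yy //.
Qed.
End PhaseSum.

Section QuotientPermutation.
Variable T : finType.
Implicit Types (c s z : {perm T}) (x y : T).

Definition quo_fun s c x := if porep s x == x then porep s (c x) else x.

(* The permutation induced by [c] on the orbits of [s], each orbit being
   identified with its representative; meaningful when [c] and [s] commute. *)
Definition quo_perm s c : {perm T} :=
  odflt 1%g [pick p : {perm T} | [forall x, p x == quo_fun s c x]].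

Lemma porep_commute s c x : commute c s -> porep s (c (porep s x)) = porep s (c x).
Proof.
move=> cs; apply/eqP; rewrite eq_porep mem_porbit_commute; last exact: commute_sym.
by rewrite porbit_sym porep_mem.
Qed.

Lemma quo_permE s c x : commute c s -> quo_perm s c x = quo_fun s c x.
Proof.
move=> cs; suff fI : injective (quo_fun s c).
  rewrite /quo_perm; case: pickP => [p /forallP/(_ x)/eqP //|/(_ (perm fI))].
  by move/negP; case; apply/forallP => y; rewrite permE.
move=> y y'; rewrite /quo_fun; case: eqP => [ry|nry]; case: eqP => [ry'|nry'] //.
- move/eqP; rewrite eq_porep mem_porbit_commute; last exact: commute_sym.
  by rewrite -eq_porep ry ry' => /eqP.
- by move=> e; case: nry'; rewrite -e porepK.
- by move=> e; case: nry; rewrite e porepK.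
Qed.

Lemma quo_perm_rep s c x : commute c s -> quo_perm s c (porep s x) = porep s (c x).
Proof. by move=> cs; rewrite quo_permE // /quo_fun porepK eqxx porep_commute. Qed.

Lemma quo_permX_rep s c x i : commute c s ->
  (quo_perm s c ^+ i)%g (porep s x) = porep s ((c ^+ i)%g x).
Proof.
move=> cs; elim: i => [|i IH]; first by rewrite !expg0 !perm1.
by rewrite !expgSr !permM IH quo_perm_rep.
Qed.

Lemma quo_perm1 s : quo_perm s 1%g = 1%g.
Proof.
apply/permP => x; rewrite quo_permE; last exact/commute_sym/commute1.
by rewrite /quo_fun !perm1; case: eqP.
Qed.

End QuotientPermutation.

(** * Cancellation over a centralizer *)

Section KeySum.
Variables (F : numFieldType) (zeta : nat -> F).
Hypothesis zetaP : forall n, (0 < n)%N -> n.-primitive_root (zeta n).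
Variables (T : finType) (Y : eqType) (s : {perm T}) (kap : T -> Y).
Hypothesis kap_s : forall x y, kap x = kap y -> kap (s x) = kap (s y).
Implicit Types (c z : {perm T}) (x y : T).

Definition kap_centralizer c := (c * s == s * c)%g && [forall x, kap (c x) == kap x].

Lemma kap_sX x y i : kap x = kap y -> kap ((s ^+ i)%g x) = kap ((s ^+ i)%g y).
Proof.
move=> xy; elim: i => [|i IH]; first by rewrite !expg0 !perm1.
by rewrite !expgSr !permM; apply: kap_s.
Qed.

Lemma kap_cX c x i : kap_centralizer c -> kap ((c ^+ i)%g x) = kap x.
Proof.
case/andP=> _ /forallP kc; elim: i => [|i IH]; first by rewrite expg0 perm1.
by rewrite expgSr permM (eqP (kc _)).
Qed.

Lemma kap_centralizerM c z : kap_centralizer c -> kap_centralizer z ->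
  kap_centralizer (c * z)%g.
Proof.
case/andP=> /eqP cs /forallP kc /andP[/eqP zs /forallP kz]; apply/andP; split.
  by rewrite -mulgA zs !mulgA cs.
by apply/forallP => x; rewrite permM (eqP (kz _)).
Qed.

Lemma kap_centralizerMr c z : kap_centralizer z ->
  kap_centralizer (c * z)%g = kap_centralizer c.
Proof.
move=> kz; apply/idP/idP => [kcz|kc]; last exact: kap_centralizerM.
have : kap_centralizer z^-1%g.
  case/andP: (kz) => /eqP zs /forallP kzx; apply/andP; split.
    by apply/eqP/commute_sym; apply: commuteV; apply: commute_sym.
  by apply/forallP => x; rewrite -{2}(permKV z x) (eqP (kzx _)).
by move=> kzV; rewrite -(mulgK z c); apply: kap_centralizerM.
Qed.

(** The factor depending on [c] that remains in [cycle_char_sum] once labellings and maps are summed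
    out by [labelled_sum_h]. *)
Definition key_weight c : F := (-1) ^+ odd_perm (quo_perm s c) * theta zeta c s.

Lemma porbit_perm1 x : porbit 1%g x = [set x].
Proof.
apply/setP => y; rewrite inE; apply/porbitP/eqP => [[i ->]|->].
  by rewrite expg1n perm1.
by exists 0%N; rewrite perm1.
Qed.

Lemma theta_invariant c (g : T -> F) : commute c s -> gauge zeta c g ->
  (forall x, g (s x) = g x) -> theta zeta c s = 1.
Proof.
move=> cs gP gs; rewrite (theta_gauge zetaP cs gP) big1 // => x _.
by rewrite gs divff // gP.1.
Qed.

Lemma theta_perm1 : theta zeta 1%g s = 1.
Proof.
apply: (@theta_invariant 1%g (fun=> 1)) => //; first exact/commute_sym/commute1.
split=> x; first exact: oner_neq0.
by rewrite porbit_perm1 cards1 (zeta1 zetaP) mulr1.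
Qed.

Lemma key_weight1 : key_weight 1%g = 1.
Proof. by rewrite /key_weight quo_perm1 odd_perm1 mul1r theta_perm1. Qed.

Lemma key_sum_inj : injective kap -> \sum_(c | kap_centralizer c) key_weight c = 1.
Proof.
move=> kI; rewrite (big_pred1 1%g) ?key_weight1 // => c.
rewrite /kap_centralizer; apply/andP/eqP => [[_ /forallP kc]|->].
  by apply/permP => x; apply: kI; rewrite perm1 (eqP (kc x)).
by rewrite mul1g mulg1; split=> //; apply/forallP => x; rewrite perm1.
Qed.

Section Swap.
Hypothesis kap_orbit : forall x y, y \in porbit s x -> kap y = kap x -> y = x.
Variables x0 y0 : T.
Hypotheses (neq0 : x0 != y0) (kap0 : kap x0 = kap y0).

Let idx a u := index u (traject s a #|porbit s a|).

Let idxP a u : u \in porbit s a -> (s ^+ idx a u)%g a = u.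
Proof.
rewrite porbit_traject => ua; rewrite permX -(nth_traject s (_ : idx a u < #|porbit s a|)%N).
  exact: nth_index.
by rewrite -[X in (_ < X)%N](size_traject s a) index_mem.
Qed.

(** Equal labels move together under [s], and labels separate the points of an orbit; so points with
    equal labels have the same period. *)
Let eqX a b i j : kap a = kap b -> (s ^+ i)%g a = (s ^+ j)%g a -> (s ^+ i)%g b = (s ^+ j)%g b.
Proof.
move=> ab e; apply: kap_orbit; last by rewrite -(kap_sX i ab) e; exact: kap_sX.
apply/porbitP.
suff [m mE] : exists m, (s ^+ m)%g ((s ^+ j)%g b) = (s ^+ i)%g b by exists m.
exists (i + j * #[s]%g.-1)%N.
rewrite -permM -expgD addnCA -mulnS prednK ?order_gt0 // mulnC addnC expgD expgM.
by rewrite expg_order expg1n mul1g.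
Qed.

Let swapf u :=
  if u \in porbit s x0 then (s ^+ idx x0 u)%g y0
  else if u \in porbit s y0 then (s ^+ idx y0 u)%g x0 else u.

Let y0x0 : y0 \notin porbit s x0.
Proof.
by apply: contra neq0 => /kap_orbit/(_ (esym kap0)) ->.
Qed.

Let sX_x0 i : (s ^+ i)%g y0 \in porbit s x0 = false.
Proof.
apply/negbTE; apply: contra y0x0; rewrite -!eq_porep porep_perm //.
Qed.

Let swapx i : swapf ((s ^+ i)%g x0) = (s ^+ i)%g y0.
Proof.
rewrite /swapf mem_porbit; apply: eqX (kap0) _.
by rewrite idxP // mem_porbit.
Qed.

Let swapy i : swapf ((s ^+ i)%g y0) = (s ^+ i)%g x0.
Proof.
rewrite /swapf sX_x0 mem_porbit; apply: eqX (esym kap0) _.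
by rewrite idxP // mem_porbit.
Qed.

Let swapC u : u \notin porbit s x0 -> u \notin porbit s y0 -> swapf u = u.
Proof. by rewrite /swapf => /negbTE -> /negbTE ->. Qed.

Let swapP u : [\/ exists i, u = (s ^+ i)%g x0, exists i, u = (s ^+ i)%g y0 |
  (u \notin porbit s x0) && (u \notin porbit s y0)].
Proof.
case: (boolP (u \in porbit s x0)) => [/porbitP|ux]; first by constructor 1.
case: (boolP (u \in porbit s y0)) => [/porbitP|uy]; first by constructor 2.
by constructor 3.
Qed.

(** The swap exchanges [s ^+ i] of [x0] and [s ^+ i] of [y0], which is well defined because both
    points have the same period, by [eqX]. *)
Lemma orbit_swap : exists2 z, kap_centralizer z &
  forall u, porep s (z u) = tperm (porep s x0) (porep s y0) (porep s u).
Proof.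
have fK : involutive swapf.
  move=> u; case: (swapP u) => [[i ->]|[i ->]|/andP[ux uy]].
  - by rewrite swapx swapy.
  - by rewrite swapy swapx.
  by rewrite !swapC.
have ss (a : T) : forall b, (s b \in porbit s a) = (b \in porbit s a).
  by move=> b; rewrite -!eq_porep; have := porep_perm s b 1; rewrite expg1 => ->.
exists (perm (inv_inj fK)).
  apply/andP; split.
    apply/eqP/permP => u; rewrite !permM !permE.
    case: (swapP u) => [[i ->]|[i ->]|/andP[ux uy]].
    - by rewrite swapx -!permM -!expgSr swapx.
    - by rewrite swapy -!permM -!expgSr swapy.
    by rewrite !swapC ?ss.
  apply/forallP => u; rewrite permE; apply/eqP.
  case: (swapP u) => [[i ->]|[i ->]|/andP[ux uy]]; last by rewrite swapC.
    by rewrite swapx (kap_sX _ kap0).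
  by rewrite swapy (kap_sX _ kap0).
move=> u; rewrite permE; case: (swapP u) => [[i ->]|[i ->]|/andP[ux uy]].
- by rewrite swapx !porep_perm tpermL.
- by rewrite swapy !porep_perm tpermR.
by rewrite swapC // tpermD // eq_porep.
Qed.

(** Labels are constant along a cycle of [c], which therefore meets each orbit of [s] at most once
    and embeds into the quotient. A gauge of the induced permutation then pulls back to an
    [s]-invariant gauge of [c]. *)
Lemma theta_kap_orbit c : kap_centralizer c -> theta zeta c s = 1.
Proof.
move=> kc; have /andP[/eqP cs _] := kc.
pose g x := std_gauge zeta (quo_perm s c) (porep s x).
have [g0 gq] := std_gaugeP zetaP (quo_perm s c).
apply: (@theta_invariant c g) => //; last first.
  by move=> x; rewrite /g; have := porep_perm s x 1; rewrite expg1 => ->.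
split=> x; first exact: g0.
rewrite /g -quo_perm_rep // gq; congr (zeta _ * _).
have inj : {in porbit c x &, injective (porep s)}.
  move=> u v /porbitP[i ->] /porbitP[j ->] /eqP; rewrite eq_porep => uv.
  by apply/esym/kap_orbit => //; rewrite !kap_cX.
rewrite -(card_in_imset inj); congr #|pred_of_set _|; apply/setP => u.
apply/porbitP/imsetP => [[i ->]|[v /porbitP[i ->] ->]].
  by exists ((c ^+ i)%g x); rewrite ?mem_porbit // quo_permX_rep.
by exists i; rewrite quo_permX_rep.
Qed.

(** Multiplying [c] by the swap composes the induced permutation with a transposition, while [theta]
    stays 1. *)
Lemma key_sum_swap : \sum_(c | kap_centralizer c) key_weight c = 0.
Proof.
have [z kz zE] := orbit_swap.
have zs : commute z s by case/andP: kz => /eqP.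
set S := LHS; suff : S = - S.
  by move/eqP; rewrite -addr_eq0 -mulr2n mulrn_eq0 => /eqP.
rewrite {1}/S (reindex_inj (mulIg z)) -sumrN; apply: eq_big => c.
  by rewrite kap_centralizerMr.
rewrite kap_centralizerMr // => kc; have /andP[/eqP cs _] := kc.
rewrite /key_weight !theta_kap_orbit ?kap_centralizerM // !mulr1.
have -> : quo_perm s (c * z)%g = (quo_perm s c * tperm (porep s x0) (porep s y0))%g.
  apply/permP => u; rewrite permM !quo_permE //; last first.
    by rewrite /commute -mulgA zs !mulgA cs.
  rewrite /quo_fun; case: eqP => [ru|nru]; first by rewrite permM zE.
  by rewrite tpermD //; apply/eqP => e; case: nru; rewrite -e porepK.
rewrite odd_permM odd_tperm eq_porep.
by rewrite y0x0 addbT signrN.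
Qed.
End Swap.

End KeySum.

Lemma modular_gcd q w : (0 < q)%N -> exists j, (w * j == gcdn w q %[mod q])%N.
Proof.
move=> q0; have [a aq /dvdnP[m mE]] := Bezoutl w q0; exists (q - a)%N.
rewrite -(eqn_modDr (w * a)%N) -mulnDr subnK ?(ltnW aq) //.
by rewrite gcdnC [(w * a)%N]mulnC mE modnMl mulnC modnMr.
Qed.

Section Rotation.
Variables (F : numFieldType) (zeta : nat -> F).
Hypothesis zetaP : forall n, (0 < n)%N -> n.-primitive_root (zeta n).
Variables (T : finType) (Y : eqType) (s : {perm T}) (kap : T -> Y).
Hypothesis kap_s : forall x y, kap x = kap y -> kap (s x) = kap (s y).
Implicit Types (c z : {perm T}) (x y : T).
Variables (a : T) (r q : nat).
Hypotheses (q1 : (1 < q)%N) (dE : #|porbit s a| = (r * q)%N).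
Hypothesis kap_r : forall i, kap ((s ^+ i)%g a) = kap a <-> (r %| i)%N.

Let r0 : (0 < r)%N.
Proof. by have := porbit_gt0 s a; rewrite dE muln_gt0 => /andP[]. Qed.

Let q0 : (0 < q)%N := ltnW q1.

Let porep_s x : porep s (s x) = porep s x.
Proof. by have := porep_perm s x 1; rewrite expg1. Qed.

(** The part of [T] on which rotating the orbit of [a] can change [theta]: the orbits of [s] lying
    in one cycle of the induced permutation. *)
Let comp c := [set x | porep s x \in porbit (quo_perm s c) (porep s a)].
Let height c := #|porbit (quo_perm s c) (porep s a)|.

Let height_dvd c m : commute c s ->
  (porep s ((c ^+ m)%g a) == porep s a) = (height c %| m)%N.
Proof.
move=> cs; rewrite -quo_permX_rep //; apply/eqP/idP => [/permXK//|dm].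
exact/permXK.
Qed.

Let mem_comp_c c x : commute c s -> (c x \in comp c) = (x \in comp c).
Proof.
move=> cs; rewrite !inE -quo_perm_rep // -!eq_porep.
by have := porep_perm (quo_perm s c) (porep s x) 1; rewrite expg1 => ->.
Qed.

Let mem_comp_s c x : (s x \in comp c) = (x \in comp c).
Proof. by rewrite !inE porep_s. Qed.

(** After one turn of the induced cycle, [a] is back in its orbit with the same label, hence
    displaced by a multiple of the label period [r]. *)
Lemma return_index c : kap_centralizer s kap c ->
  exists w, (c ^+ height c)%g a = (s ^+ (r * w))%g a.
Proof.
move=> kc; have /andP[/eqP cs _] := kc.
have : porep s ((c ^+ height c)%g a) == porep s a by rewrite height_dvd.
rewrite eq_sym eq_porep => /porbitP[i iE].
have /kap_r/dvdnP[w wE] : kap ((s ^+ i)%g a) = kap a by rewrite -iE (kap_cX _ _ kc).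
by exists w; rewrite iE wE mulnC.
Qed.

Lemma return_indexX c w j : commute c s -> (c ^+ height c)%g a = (s ^+ (r * w))%g a ->
  (c ^+ (height c * j))%g a = (s ^+ (r * (w * j)))%g a.
Proof.
move=> cs wE; elim: j => [|j IH]; first by rewrite !muln0 !expg0.
rewrite !mulnS mulnDr !expgD !permM wE -commute_permX // IH -!permM.
by rewrite -!expgD addnC.
Qed.

Lemma prod_telescope (u : nat -> F) n : (forall i, u i != 0) ->
  \prod_(i < n) (u i.+1 / u i) = u n / u 0%N.
Proof.
move=> u0; elim: n => [|n IH]; first by rewrite big_ord0 divff.
by rewrite big_ord_recr /= IH mulrC mulrA divfK.
Qed.

(** With [G = gcdn w q], the first [r * G] points of the orbit of [a] represent the cycles of [c] in
    [comp c], so the product telescopes to a ratio of [g] at [s ^+ (r * G)] of [a] and at [a]. The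
    former point is [c ^+ (height c * j)] of [a], in a cycle of length [height c * (q %/ G)]. *)
Lemma comp_phase c w j g : kap_centralizer s kap c -> gauge zeta c g ->
    (c ^+ height c)%g a = (s ^+ (r * w))%g a -> (w * j = gcdn w q %[mod q])%N ->
  \prod_(x in comp c | porep c x == x) (g (s x) / g x) =
  zeta (height c * (q %/ gcdn w q))%N ^+ (height c * j).
Proof.
move=> kc gP wE jE; have /andP[/eqP cs _] := kc.
have [g0 gc] := gP; set b := height c; set G := gcdn w q; set e := (q %/ G)%N.
have G0 : (0 < G)%N by rewrite gcdn_gt0 q0 orbT.
have qE : (q = e * G)%N by rewrite divnK ?dvdn_gcdr.
have w1E : (w = w %/ G * G)%N by rewrite divnK ?dvdn_gcdl.
have b0 : (0 < b)%N := porbit_gt0 _ _.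
have e0 : (0 < e)%N by move: q0; rewrite qE muln_gt0 => /andP[].
have coew : coprime e (w %/ G).
  have : coprime (w %/ G * j) e.
    rewrite -coprime_modl (_ : (_ %% e)%N = (1 %% e)%N) ?coprime_modl ?coprime1n //.
    have : ((w %/ G * j * G) %% (e * G) = (1 * G) %% (e * G))%N.
      by rewrite mul1n mulnAC -w1E -qE.
    by rewrite -!muln_modl // => /eqP; rewrite eqn_pmul2r // => /eqP.
  by rewrite coprimeMl coprime_sym => /andP[].
have cX m : (c ^+ (b * m))%g a = (s ^+ (r * (w * m)))%g a by apply: return_indexX.
have sRE : (s ^+ (r * G))%g a = (c ^+ (b * j))%g a.
  by rewrite cX; apply/eqP; rewrite eq_permX dE -!muln_modr jE.
have nE : #|porbit c a| = (b * e)%N.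
  apply/eqP; rewrite eqn_dvd; apply/andP; split.
    apply/permXK; rewrite cX; apply/permXK; rewrite dE dvdn_pmul2l //.
    by rewrite {1}w1E -mulnA [(G * e)%N]mulnC -qE dvdn_mull.
  have /permXK ca : (#|porbit c a| %| #|porbit c a|)%N by [].
  have bn : (b %| #|porbit c a|)%N by rewrite -height_dvd // ca.
  case/dvdnP: bn ca => n' ->; rewrite mulnC cX => /permXK.
  rewrite dE dvdn_pmul2l // {1}w1E qE mulnAC dvdn_pmul2r // Gauss_dvdr // => en.
  by rewrite dvdn_pmul2l.
rewrite (@prod_porbits T F c (fun x => g (s x) / g x) (comp c) 'I_(r * G) predT
  (fun k => (s ^+ k)%g a)).
- have -> : \prod_(i < r * G) (g (s ((s ^+ i)%g a)) / g ((s ^+ i)%g a)) =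
     \prod_(i < r * G) (g ((s ^+ i.+1)%g a) / g ((s ^+ i)%g a)).
    by apply: eq_bigr => i _; rewrite expgSr permM.
  rewrite (prod_telescope _ (u := fun i => g ((s ^+ i)%g a))) // sRE expg0 perm1 -nE.
  elim: (b * j)%N => [|m IH]; first by rewrite expg0 perm1 divff.
  rewrite expgSr permM gc (_ : #|porbit c ((c ^+ m)%g a)| = #|porbit c a|).
    by rewrite -mulrA IH exprS.
  by rewrite card_porbit_commute //; exact/commuteX.
- by move=> x; exact: (ratio_perm zetaP _ cs gP).
- by move=> i _; rewrite inE porep_perm porbit_id.
- by move=> x; rewrite mem_comp_c.
- move=> k k' _ _ /porbitP[m mE].
  have : porep s ((c ^+ m)%g a) == porep s a.
    by rewrite -(porep_perm s ((c ^+ m)%g a) k) commute_permX // -mE porep_perm.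
  rewrite height_dvd // -/b => /dvdnP[m' m'E].
  move: mE; rewrite -commute_permX // m'E [(m' * b)%N]mulnC cX -permM -expgD => /eqP.
  rewrite eq_permX dE => /eqP kk; apply: val_inj => /=.
  have dG : (r * G %| r * q)%N by rewrite dvdn_pmul2l // dvdn_gcdr.
  have := congr1 (modn^~ (r * G)%N) kk; rewrite !modn_dvdm //.
  rewrite (modn_small (ltn_ord k')) => ->.
  have -> : (r * (w * m') = (w %/ G * m') * (r * G))%N by rewrite {1}w1E mulnAC mulnCA.
  by rewrite ?modnMDl ?modnDr ?modnMDr (modn_small (ltn_ord k)).
move=> x; rewrite inE => /porbitP[i]; rewrite quo_permX_rep // => /esym/eqP.
rewrite eq_porep => /porbitP[j' ->]; rewrite commute_permX //.
have R0 : (0 < r * G)%N by rewrite muln_gt0 r0.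
exists (Ordinal (ltn_pmod j' R0)) => //=.
rewrite {1}(divn_eq j' (r * G)) addnC expgD permM.
move: (j' %/ _)%N (j' %% _)%N => j1 k.
have -> : (s ^+ (j1 * (r * G)))%g ((s ^+ k)%g a) = (c ^+ (b * (j * j1)))%g ((s ^+ k)%g a).
  rewrite -permM -expgD addnC expgD permM -commute_permX // cX; congr (fun_of_perm _ _).
  apply/eqP; rewrite eq_permX dE mulnC -mulnA -!muln_modr mulnA.
  by rewrite -[in X in _ == X]modnMml jE modnMml.
by rewrite -permM -expgD mem_porbit.
Qed.

Let rotf i u := if u \in porbit s a then (s ^+ (r * i))%g u else u.

Let mem_sX i u : ((s ^+ i)%g u \in porbit s a) = (u \in porbit s a).
Proof. by rewrite -!eq_porep porep_perm. Qed.

Let rot_inj : injective (rotf 1).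
Proof.
move=> u v; rewrite /rotf; case: ifP => uA; case: ifP => vA //.
- exact: perm_inj.
- by move=> e; rewrite -e mem_sX uA in vA.
- by move=> e; rewrite e mem_sX vA in uA.
Qed.

Let z := perm rot_inj.

Let zX i u : (z ^+ i)%g u = rotf i u.
Proof.
elim: i => [|i IH]; first by rewrite /rotf muln0 !expg0 perm1 if_same.
rewrite expgSr permM IH permE /rotf; case: (boolP (u \in porbit s a)) => [uA|/negbTE -> //].
by rewrite mem_sX uA -permM -expgD muln1 mulnS addnC.
Qed.

Let z_centralizer i : kap_centralizer s kap (z ^+ i)%g.
Proof.
apply/andP; split.
  apply/eqP/permP => u; rewrite !permM !zX /rotf.
  rewrite (_ : (s u \in porbit s a) = (u \in porbit s a)); last by rewrite -!eq_porep porep_s.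
  by case: ifP => // _; rewrite -!permM -expgS expgSr.
apply/forallP => u; rewrite zX /rotf; case: ifP => // /porbitP[j ->].
rewrite -permM -expgD addnC expgD permM; apply/eqP/kap_sX => //.
by apply/kap_r; rewrite dvdn_mulr.
Qed.

Let porep_z i u : porep s ((z ^+ i)%g u) = porep s u.
Proof. by rewrite zX /rotf; case: ifP => // _; rewrite porep_perm. Qed.

Let quo_z c i : commute c s -> quo_perm s (c * z ^+ i)%g = quo_perm s c.
Proof.
move=> cs; have /andP[/eqP zs _] := z_centralizer i.
apply/permP => u; rewrite !quo_permE //; last by rewrite /commute -mulgA zs !mulgA cs.
by rewrite /quo_fun permM porep_z.
Qed.

(** Within [height c] steps the orbit of [a] is entered only at the last one, so the rotation acts
    exactly once. *)
Let return_z c w i : commute c s -> (c ^+ height c)%g a = (s ^+ (r * w))%g a ->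
  ((c * z ^+ i) ^+ height c)%g a = (s ^+ (r * (w + i)))%g a.
Proof.
move=> cs; have: (0 < height c)%N := porbit_gt0 _ _.
case hE: (height c) => [//|b] _ wE.
have E k : (k < height c)%N -> ((c * z ^+ i) ^+ k)%g a = (c ^+ k)%g a.
  elim: k => [|k IH] kb; first by rewrite !expg0.
  rewrite !expgSr permM IH 1?ltnW // !permM zX /rotf ifN //.
  rewrite -permM -expgSr -eq_porep eq_sym height_dvd //.
  by apply/negP => /(dvdn_leq (ltn0Sn k)); rewrite leqNgt kb.
rewrite expgSr permM E ?hE // permM -(permM (c ^+ b)%g) -expgSr wE zX /rotf.
by rewrite mem_porbit -permM -expgD mulnDr.
Qed.

(** Along the coset the induced permutation is constant and the return index takes [q] consecutive
    values, whose phases sum to zero by [sum_phase]. *)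
Lemma rotation_coset_sum c : kap_centralizer s kap c ->
  \sum_(i < q) key_weight zeta s (c * z ^+ i)%g = 0.
Proof.
move=> kc; have /andP[/eqP cs _] := kc; have [v vE] := return_index kc.
have kcz i : kap_centralizer s kap (c * z ^+ i)%g by apply: kap_centralizerM.
have csz i : commute (c * z ^+ i)%g s by have /andP[/eqP] := kcz i.
pose jw w := xchoose (modular_gcd w q0).
have jwP w : (w * jw w = gcdn w q %[mod q])%N by exact/eqP/(xchooseP (modular_gcd w q0)).
pose om w := zeta (height c * (q %/ gcdn w q))%N ^+ (height c * jw w).
pose g0 := std_gauge zeta c.
pose off := \prod_(x | (x \notin comp c) && (porep c x == x)) (g0 (s x) / g0 x).
suff E i : key_weight zeta s (c * z ^+ i)%g =
    (-1) ^+ odd_perm (quo_perm s c) * off * om (v + i)%N.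
  under eq_bigr do rewrite E.
  rewrite -mulr_sumr (@sum_phase F zeta zetaP q (height c) v om) ?mulr0 //.
    exact: porbit_gt0.
  by move=> w; exists (jw w).
rewrite /key_weight quo_z // -mulrA; congr (_ * _); set c' := (c * z ^+ i)%g.
have compE : comp c' = comp c by apply/setP => x; rewrite !inE /c' quo_z.
have heightE : height c' = height c by rewrite /height /c' quo_z.
have offE x : x \notin comp c -> c' x = c x.
  move=> xO; rewrite permM zX /rotf ifN //; apply: contra xO => cxA.
  by rewrite -mem_comp_c // inE; move: cxA; rewrite -eq_porep => /eqP <-; exact: porbit_id.
have offX x m : x \notin comp c -> (c' ^+ m)%g x = (c ^+ m)%g x /\ (c ^+ m)%g x \notin comp c.
  move=> xO; elim: m => [|m [IH mO]]; first by rewrite !expg0 perm1.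
  by rewrite !expgSr [((c' ^+ m) * c')%g x]permM [((c ^+ m) * c)%g x]permM IH offE // mem_comp_c.
have porbitE x : x \notin comp c -> porbit c' x = porbit c x.
  move=> xO; apply/setP => y; apply/porbitP/porbitP => -[m ->]; exists m.
    by have [-> _] := offX x m xO.
  by have [-> _] := offX x m xO.
(* A gauge glued from those of [c'] on the component and of [c] elsewhere makes the outer factor of
   [theta] independent of [i]. *)
pose g x := if x \in comp c then std_gauge zeta c' x else g0 x.
have [g0nz g0c] := std_gaugeP zetaP c; have [hnz hc] := std_gaugeP zetaP c'.
have gP : gauge zeta c' g.
  split=> x; rewrite /g; first by case: ifP.
  have -> : (c' x \in comp c) = (x \in comp c) by rewrite -compE (mem_comp_c _ (csz i)).
  case: (boolP (x \in comp c)) => xO; first by rewrite hc.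
  by rewrite offE // porbitE // g0c.
rewrite (theta_gauge zetaP (csz i) gP) (bigID (mem (comp c))) /= mulrC; congr (_ * _).
  apply: eq_big => x; rewrite andbC; case: (boolP (x \in comp c)) => //= xO.
    by rewrite /porep porbitE.
  by move=> _; rewrite /g mem_comp_s (negbTE xO).
under eq_bigl do rewrite andbC -compE.
rewrite (comp_phase (kcz i) gP _ (jwP (v + i)%N)) ?heightE //.
exact: return_z.
Qed.

Lemma key_sum_rotation : \sum_(c | kap_centralizer s kap c) key_weight zeta s c = 0.
Proof.
set S := LHS; have SE i : S = \sum_(c | kap_centralizer s kap c) key_weight zeta s (c * z ^+ i)%g.
  rewrite /S (reindex_inj (mulIg (z ^+ i)%g)); apply: eq_bigl => c.
  exact: kap_centralizerMr.
have : S *+ q = 0.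
  rewrite -[X in _ *+ X]card_ord -sumr_const; under eq_bigr => i _ do rewrite (SE i).
  rewrite exchange_big big1 //= => c kc.
  exact: rotation_coset_sum.
by move/eqP; rewrite mulrn_eq0 eqn0Ngt q0 => /eqP.
Qed.

End Rotation.

(** A label repeated inside an orbit of [s] cancels the sum through [theta], by rotations of that
    orbit; a label repeated only between orbits cancels it through the sign, by a swap. *)
Lemma key_sum (F : numFieldType) (zeta : nat -> F) (T : finType) (Y : eqType)
    (s : {perm T}) (kap : T -> Y) :
    (forall n, (0 < n)%N -> n.-primitive_root (zeta n)) ->
    (forall x y, kap x = kap y -> kap (s x) = kap (s y)) ->
  \sum_(c | kap_centralizer s kap c) key_weight zeta s c = (injectiveb kap)%:R.
Proof.
move=> zetaP kap_s; case: (boolP (injectiveb kap)) => [/injectiveP kI | /injectivePn[x0 [y0 n0 k0]]].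
  exact: key_sum_inj.
case: (boolP [exists x, exists y, [&& y \in porbit s x, kap y == kap x & y != x]]).
  move=> /existsP[a /existsP[y /and3P[ya /eqP kya nya]]].
  have d0 := porbit_gt0 s a.
  have exr : exists i, (0 < i)%N && (kap ((s ^+ i)%g a) == kap a).
    by exists #|porbit s a|; rewrite d0 permX iter_porbit eqxx.
  (* The least return time [r] of the label divides all the others. The orbit is longer than [r]
     because [y] shares the label of [a], which gives [q > 1]. *)
  case: (ex_minnP exr) => r /andP[r0 /eqP rE] rmin.
  have rX m b : kap b = kap a -> kap ((s ^+ (m * r))%g b) = kap b.
    move=> ba; elim: m => [|m IH]; first by rewrite expg0 perm1.
    have rb : kap ((s ^+ r)%g b) = kap b by rewrite (kap_sX kap_s r ba) rE.
    by rewrite mulSn expgD permM (kap_sX kap_s _ rb).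
  have kap_r i : kap ((s ^+ i)%g a) = kap a <-> (r %| i)%N.
    split=> [ki|/dvdnP[m ->]]; last exact: rX.
    apply: contraT; rewrite /dvdn -lt0n => i0.
    suff : (r <= i %% r)%N by rewrite leqNgt ltn_pmod.
    apply: rmin; rewrite i0 /= -(kap_sX kap_s (i %% r) (rX (i %/ r) a erefl))%N.
    by rewrite -permM -expgD -divn_eq ki.
  have /dvdnP[q qE] : (r %| #|porbit s a|)%N by apply/kap_r; rewrite permX iter_porbit.
  rewrite mulnC in qE; apply: (key_sum_rotation zetaP kap_s _ qE kap_r).
  case/porbitP: ya kya nya => i -> /kap_r ri; apply: contraNT; rewrite -leqNgt => q1.
  have {q1} q1 : q = 1%N by case: q qE q1 => [|[|]] // e; move: d0; rewrite e muln0.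
  by apply/eqP/permXK; rewrite qE q1 muln1.
rewrite negb_exists => /forallP nex.
apply: (key_sum_swap zetaP kap_s _ n0 k0) => x y yx kyx; apply/eqP.
have := nex x; rewrite negb_exists => /forallP/(_ y).
by rewrite yx kyx eqxx /= negbK.
Qed.

(** * Labellings of cycles *)

Lemma eq_card_imset (T A B : finType) (f : T -> A) (g : T -> B) (K : {set T}) :
    {in K &, forall x y, (f x == f y) = (g x == g y)} ->
  #|[set f x | x in K]| = #|[set g x | x in K]|.
Proof.
move=> fg; pose h x := (f x, g x).
have -> : [set f x | x in K] = [set u.1 | u in [set h x | x in K]].
  by rewrite -imset_comp.
have -> : [set g x | x in K] = [set u.2 | u in [set h x | x in K]].
  by rewrite -imset_comp.
have i1 : {in [set h x | x in K] &, injective fst}.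
  move=> _ _ /imsetP[x xK ->] /imsetP[y yK ->] /= e.
  by congr pair => //; apply/eqP; rewrite -fg // e.
have i2 : {in [set h x | x in K] &, injective snd}.
  move=> _ _ /imsetP[x xK ->] /imsetP[y yK ->] /= e.
  by congr pair => //; apply/eqP; rewrite fg // e.
by rewrite (card_in_imset i1) (card_in_imset i2).
Qed.

Section LabelledCycles.
Variable T : finType.
Implicit Types (c s : {perm T}).

(* The unlabelled points are fixed by [c], and the other cycles of [c] are
   labelled bijectively by ['I_n]. *)
Definition labelling n c (phi : {ffun T -> option 'I_n}) :=
  [&& [forall j, exists i, phi i == Some j],
      [forall i, forall i', (phi i == phi i') && (phi i != None) ==> (i' \in porbit c i)],
      [forall i, phi (c i) == phi i]
    & [forall i, (phi i == None) ==> (c i == i)]].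

Section Labelling.
Variables (n : nat) (c : {perm T}) (phi : {ffun T -> option 'I_n}).
Hypothesis phiP : labelling c phi.

Lemma labelling_surj j : exists i, phi i = Some j.
Proof. by case/and4P: phiP => /forallP/(_ j)/existsP[i /eqP]; exists i. Qed.

Lemma labelling_orbit i i' : phi i = phi i' -> phi i != None -> i' \in porbit c i.
Proof.
case/and4P: phiP => _ /forallP/(_ i)/forallP/(_ i')/implyP H _ _ e n0.
by apply: H; rewrite e eqxx -e.
Qed.

Lemma labelling_perm i : phi (c i) = phi i.
Proof. by case/and4P: phiP => _ _ /forallP/(_ i)/eqP. Qed.

Lemma labelling_permX i k : phi ((c ^+ k)%g i) = phi i.
Proof. by elim: k => [|k IH]; rewrite ?expg0 ?perm1 // expgSr permM labelling_perm. Qed.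

Lemma labelling_fix i : phi i = None -> c i = i.
Proof. by case/and4P: phiP => _ _ _ /forallP/(_ i)/implyP H e; apply/eqP/H; rewrite e. Qed.

End Labelling.

Lemma labelling_unique n c (phi phi' : {ffun T -> option 'I_n}) :
    labelling c phi -> labelling c phi' ->
    (forall i, (phi i == None) = (phi' i == None)) ->
  exists t : 'S_n, forall i, phi' i = omap t (phi i).
Proof.
move=> P P' eN.
have secP j : exists i, phi i == Some j by have [i <-] := labelling_surj P j; exists i.
pose sec j := xchoose (secP j).
have secE j : phi (sec j) = Some j by apply/eqP; exact: (xchooseP (secP j)).
pose tf j := odflt j (phi' (sec j)).
have tfE j : phi' (sec j) = Some (tf j).
  rewrite /tf; case e: (phi' (sec j)) => [//|]; move/eqP: e.
  by rewrite -eN secE.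
have tI : injective tf.
  move=> j j' e; have /(labelling_orbit P') : phi' (sec j) = phi' (sec j') by rewrite !tfE e.
  rewrite tfE => /(_ isT)/porbitP[k kE].
  by have := secE j'; rewrite kE labelling_permX // secE => -[].
exists (perm tI) => i; case e: (phi i) => [j|] /=; last first.
  by apply/eqP; rewrite -eN e.
rewrite permE -tfE; have /(labelling_orbit P) : phi i = phi (sec j) by rewrite e secE.
by rewrite e => /(_ isT)/porbitP[k ->]; rewrite labelling_permX.
Qed.

Lemma labelling_omap n c (phi : {ffun T -> option 'I_n}) (t : 'S_n) :
  labelling c phi -> labelling c [ffun i => omap t (phi i)].
Proof.
move=> P; apply/and4P; split; apply/forallP => i.
- have [k kE] := labelling_surj P (t^-1%g i); apply/existsP; exists k.
  by rewrite ffunE kE /= permKV.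
- apply/forallP => i'; rewrite !ffunE; apply/implyP => /andP[/eqP e n0].
  case e1: (phi i) e n0 => [j|//]; case e2: (phi i') => [j'|//] /= [/perm_inj jj] _.
  by apply: (labelling_orbit P); rewrite e1 // e2 jj.
- by rewrite !ffunE labelling_perm.
apply/implyP; rewrite ffunE => e; apply/eqP/(labelling_fix P).
by case: (phi i) e.
Qed.

Lemma labelling_commute n c s (phi : {ffun T -> option 'I_n}) :
  commute c s -> labelling c phi -> labelling c [ffun i => phi (s i)].
Proof.
move=> cs P; apply/and4P; split; apply/forallP => i.
- have [k kE] := labelling_surj P i; apply/existsP; exists (s^-1%g k).
  by rewrite ffunE permKV kE.
- apply/forallP => i'; rewrite !ffunE; apply/implyP => /andP[/eqP e n0].
  by rewrite -(mem_porbit_commute i i' cs) (labelling_orbit P).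
- by rewrite !ffunE commute_perm // labelling_perm.
apply/implyP; rewrite ffunE => /eqP /(labelling_fix P); rewrite -commute_perm //.
by move/perm_inj ->.
Qed.

Lemma labelling_count n c (phi : {ffun T -> option 'I_n}) (N : {set T}) :
    labelling c phi -> (forall i, (phi i == None) = (i \in N)) ->
  n = #|[set porbit c i | i in ~: N]|.
Proof.
move=> P eN.
have -> : #|[set porbit c i | i in ~: N]| = #|[set phi i | i in ~: N]|.
  apply: eq_card_imset => i i' iN i'N; rewrite -mem_porbit_eq.
  apply/idP/eqP => [/porbitP[k ->]|e]; first by rewrite labelling_permX.
  by apply: (labelling_orbit P) => //; rewrite eN -in_setC.
have -> : [set phi i | i in ~: N] = [set Some j | j in [set: 'I_n]].
  apply/setP => u; apply/imsetP/imsetP => [[i + ->]|[j _ ->]].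
    by rewrite inE -eN; case: (phi i) => // j _; exists j.
  by have [i iE] := labelling_surj P j; exists i; rewrite // inE -eN iE.
by rewrite card_imset ?cardsT ?card_ord // => j j' [].
Qed.

Lemma labelling_exists c (N : {set T}) : (forall i, i \in N -> c i = i) ->
  exists2 phi : {ffun T -> option 'I_#|[set porbit c i | i in ~: N]|},
    labelling c phi & forall i, (phi i == None) = (i \in N).
Proof.
move=> cN; set A := [set porbit c i | i in ~: N].
have cX i k : ((c ^+ k)%g i \in N) = (i \in N).
  have cNX j l : j \in N -> (c ^+ l)%g j = j.
    by move=> jN; elim: l => [|l IH]; rewrite ?expg0 ?perm1 // expgSr permM IH cN.
  apply/idP/idP => [kN|/[dup] iN]; last by move/cNX ->.
  have := cNX _ (k * #[c]%g.-1)%N kN.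
  rewrite -permM -expgD -mulnS prednK ?order_gt0 // mulnC expgM expg_order expg1n perm1.
  by move=> ->.
pose ix i := index (porbit c i) (enum A).
have ixlt i : (ix i < #|A|)%N = (i \notin N).
  rewrite cardE index_mem mem_enum; apply/imsetP/idP => [[i' i'N e]|iN].
    have : i \in porbit c i' by rewrite mem_porbit_eq e.
    by case/porbitP=> k ->; rewrite cX -in_setC.
  by exists i; rewrite ?inE.
pose phi := [ffun i => if i \in N then None else insub (ix i) : option 'I_#|A|].
have phiN i : (phi i == None) = (i \in N).
  by rewrite ffunE; case: ifP => // iN; rewrite insubT ?ixlt ?iN.
have phic i : phi (c i) = phi i.
  have cN1 : (c i \in N) = (i \in N) by have := cX i 1%N; rewrite expg1.
  rewrite !ffunE cN1 /ix (_ : porbit c (c i) = porbit c i) //.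
  by apply/esym/eqP; rewrite -mem_porbit_eq; have := mem_porbit c 1 i; rewrite expg1.
exists phi => //; apply/and4P; split; apply/forallP => i.
- have := enum_valP i; rewrite -[in X in X -> _](mem_enum A) => _.
  have : nth finset.set0 (enum A) i \in A by rewrite -mem_enum mem_nth // -cardE.
  case/imsetP=> k kN kE; apply/existsP; exists k; rewrite ffunE.
  rewrite inE in kN; rewrite (negbTE kN) /ix -kE index_uniq ?enum_uniq -?cardE //.
  by rewrite valK.
- apply/forallP => i'; apply/implyP => /andP[/eqP e n0]; rewrite phiN in n0.
  have n0' : i' \notin N by rewrite -phiN -e phiN.
  move: e; rewrite !ffunE (negbTE n0) (negbTE n0') !insubT ?ixlt // => ? ? [].
  rewrite mem_porbit_eq /ix => e; apply/eqP; rewrite -(@nth_index _ finset.set0 (porbit c i) (enum A)); last first.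
    by rewrite mem_enum; apply/imsetP; exists i; rewrite ?inE.
  by rewrite e nth_index // mem_enum; apply/imsetP; exists i'; rewrite ?inE.
- by rewrite phic.
by rewrite phiN; apply/implyP => /cN ->.
Qed.

(** Relabelling by ['S_n] is simply transitive on the labellings with unlabelled set [N], and these
    exist only when [n] is the number of cycles outside [N]. *)
Lemma labelling_card n c (N : {set T}) : (forall i, i \in N -> c i = i) ->
  #|[set phi : {ffun T -> option 'I_n} |
      labelling c phi & [forall i, (phi i == None) == (i \in N)]]| =
  ((n == #|[set porbit c i | i in ~: N]|) * n`!)%N.
Proof.
move=> cN; case: eqP => [->|nn]; last first.
  rewrite mul0n; apply/eqP; rewrite cards_eq0; apply/eqP/setP => phi; rewrite !inE.
  apply/negbTE/negP => /andP[P /forallP eN]; apply: nn.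
  by apply: (labelling_count P) => i; rewrite (eqP (eN i)).
have [phi0 P0 eN0] := labelling_exists cN; set k := #|_| in phi0 P0 eN0 *.
rewrite mul1n -card_Sn.
have oI : injective (fun t : 'S_k => [ffun i => omap t (phi0 i)]).
  move=> t t' e; apply/permP => j; have [i iE] := labelling_surj P0 j.
  by have := congr1 (fun f : {ffun _} => f i) e; rewrite !ffunE iE => -[].
rewrite -cardsT -(card_imset _ oI); apply: eq_card => phi; rewrite inE.
apply/andP/imsetP => [[P /forallP eN]|[t _ ->]]; last first.
  split; first exact: labelling_omap.
  by apply/forallP => i; rewrite ffunE -eN0; case: (phi0 i).
have [i|t tE] := labelling_unique P0 P; first by rewrite eN0 (eqP (eN i)).
by exists t; rewrite ?inE //; apply/ffunP => i; rewrite ffunE.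
Qed.

End LabelledCycles.

Section CycleSign.
Variables (T : finType) (n : nat) (c s : {perm T}) (phi : {ffun T -> option 'I_n}).
Variables (N : {set T}) (t : 'S_n).
Hypotheses (P : labelling c phi) (cs : commute c s).
Hypotheses (eN : forall i, (phi i == None) = (i \in N)).
Hypothesis (st : forall i, phi (s i) = omap t (phi i)).

Let phiX i k : phi ((s ^+ k)%g i) = omap (t ^+ k)%g (phi i).
Proof.
elim: k => [|k IH]; first by rewrite !expg0 perm1; case: (phi i) => //= j; rewrite perm1.
by rewrite !expgSr permM st IH; case: (phi i) => //= j; rewrite permM.
Qed.

Let sN i : (s i \in N) = (i \in N).
Proof. by rewrite -!eN st; case: (phi i). Qed.

Let K := [set x | (porep s x == x) && (x \notin N)].

Let memN x y : y \in porbit s x -> (y \in N) = (x \in N).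
Proof.
case/porbitP=> k ->; elim: k => [|k IH]; first by rewrite expg0 perm1.
by rewrite expgSr permM sN.
Qed.

(** Off [K] the induced permutation is the identity. On [K] its cycles correspond to the joint
    orbits of [s] and [c] on labelled points, which are the cycles of [t] on labels. *)
Lemma card_porbits_quo : (#|porbits (quo_perm s c)| + #|K| = #|T| + #|porbits t|)%N.
Proof.
set Q := quo_perm s c.
have fixK x : x \notin K -> Q x = x.
  rewrite inE negb_and negbK quo_permE // /quo_fun; case: eqP => //= rx xN.
  by rewrite (labelling_fix P) ?rx //; apply/eqP; rewrite eN.
have orb1 x : x \notin K -> porbit Q x = [set x].
  move=> xK; apply/setP => y; rewrite inE; apply/porbitP/eqP => [[k ->]|->].
    by elim: k => [|k IH]; rewrite ?expg0 ?perm1 // expgSr permM IH fixK.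
  by exists 0%N; rewrite expg0 perm1.
have -> : porbits Q = [set porbit Q x | x in ~: K] :|: [set porbit Q x | x in K].
  rewrite -imsetU finset.setUC finset.setUCr.
  by apply/setP => A; apply/imsetP/imsetP => -[x _ ->]; exists x.
have dis : [disjoint [set porbit Q x | x in ~: K] & [set porbit Q x | x in K]].
  rewrite -setI_eq0; apply/eqP/setP => A; rewrite !inE; apply/negbTE/negP.
  case/andP=> /imsetP[x xK ->] /imsetP[y yK e]; have := porbit_id Q y.
  rewrite inE in xK; rewrite -e orb1 // inE => /eqP yx.
  by rewrite -yx yK in xK.
rewrite cardsU disjoint_setI0 // cards0 subn0 addnAC; congr (_ + _)%N.
  rewrite card_in_imset; first by rewrite addnC cardsC.
  by move=> x y; rewrite !in_setC => xK yK; rewrite !orb1 // => /set1_inj.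
pose lab x := if phi x is Some j then porbit t j else finset.set0.
have lab_eq x y : x \notin N -> y \notin N ->
    (lab x == lab y) = [exists k : 'I_#[s]%g, phi y == phi ((s ^+ k)%g x)].
  rewrite -!eN /lab; case ex: (phi x) => [j|//]; case ey: (phi y) => [j'|//] _ _.
  rewrite -mem_porbit_eq; apply/porbitP/existsP => [[k kE]|[k]].
    have k_lt : (k %% #[s]%g < #[s]%g)%N by rewrite ltn_mod order_gt0.
    by exists (Ordinal k_lt); rewrite /= expg_mod_order phiX ex kE.
  by rewrite phiX ex /= => /eqP[->]; exists k.
have -> : #|[set porbit Q x | x in K]| = #|[set lab x | x in K]|.
  apply: eq_card_imset => x y; rewrite !inE => /andP[/eqP rx xN] /andP[/eqP ry yN].
  rewrite lab_eq // -mem_porbit_eq; apply/porbitP/existsP => [[i iE]|[k /eqP kE]].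
    rewrite -rx quo_permX_rep // in iE.
    have : y \in porbit s ((c ^+ i)%g x) by rewrite iE porbit_sym -eq_porep porepK.
    case/porbitP=> k kE; have k_lt : (k %% #[s]%g < #[s]%g)%N by rewrite ltn_mod order_gt0.
    exists (Ordinal k_lt); rewrite /= expg_mod_order kE commute_permX //.
    by rewrite (labelling_permX P).
  have : y \in porbit c ((s ^+ k)%g x).
    by apply: (labelling_orbit P) => //; rewrite -kE eN.
  case/porbitP=> i iE; exists i; rewrite -rx quo_permX_rep // -ry; apply/eqP.
  by rewrite eq_porep iE -commute_permX // porbit_sym mem_porbit.
have -> : [set lab x | x in K] = porbits t => //.
apply/setP => A; apply/imsetP/imsetP => [[x]|[j _ ->]].
  rewrite inE -eN /lab; case: (phi x) => [j _ ->|]; first by exists j.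
  by rewrite andbF.
have [i iE] := labelling_surj P j.
have iN : i \notin N by rewrite -eN iE.
exists (porep s i); first by rewrite inE porepK eqxx (memN (porep_mem s i)).
have /porbitP[k kE] := porep_mem s i.
rewrite /lab kE phiX iE /=; apply/eqP; rewrite -mem_porbit_eq; exact: mem_porbit.
Qed.

Lemma card_porbits_split : (#|[set porbit s i | i in N]| + #|K| = #|porbits s|)%N.
Proof.
have -> : porbits s = [set porbit s x | x in N] :|: [set porbit s x | x in K].
  apply/setP => A; rewrite inE; apply/imsetP/orP => [[x _ ->]|].
    case: (boolP (x \in N)) => xN; first by left; apply/imsetP; exists x.
    right; apply/imsetP; exists (porep s x).
      by rewrite inE porepK eqxx (memN (porep_mem s x)).
    by apply/eqP; rewrite -mem_porbit_eq porep_mem.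
  by case=> /imsetP[x _ ->]; exists x.
rewrite cardsU disjoint_setI0 ?cards0 ?subn0; last first.
  rewrite -setI_eq0; apply/eqP/setP => A; rewrite !inE; apply/negbTE/negP.
  case/andP=> /imsetP[x xN ->] /imsetP[y]; rewrite inE => /andP[_ yN] /eqP.
  by rewrite -mem_porbit_eq => /memN; rewrite xN (negbTE yN).
congr (_ + _)%N; rewrite card_in_imset // => x y.
rewrite !inE => /andP[/eqP rx _] /andP[/eqP ry _] /eqP.
by rewrite -mem_porbit_eq -eq_porep rx ry => /eqP.
Qed.

(** The parity of a permutation is that of its degree minus its number of cycles, so this is the two
    preceding counts modulo 2. *)
Lemma labelling_sign (R : pzRingType) :
  (-1) ^+ (#|T| + n) * (-1) ^+ odd_perm s * (-1) ^+ odd_perm t =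
  (-1) ^+ #|[set porbit s i | i in N]| * (-1) ^+ odd_perm (quo_perm s c) :> R.
Proof.
rewrite -(signr_odd _ (#|T| + n)) -(signr_odd _ #|[set _ | _ in _]|) -!signr_addb.
congr (_ ^+ nat_of_bool _).
have := congr1 odd card_porbits_quo; have := congr1 odd card_porbits_split.
rewrite !oddD /odd_perm card_ord.
move: (odd #|K|) (odd #|porbits s|) (odd #|porbits t|) (odd #|porbits (quo_perm s c)|).
move: (odd #|T|) (odd n) (odd #|[set porbit s i | i in N]|).
by case=> -[] [] [] [] [] [].
Qed.
End CycleSign.

(** The trace of the commuting actions of [t] and [y] on the [n]-th tensor power of the permutation
    module of [U]. *)
Definition fix_count (n : nat) (U : finType) (t : 'S_n) (y : {perm U}) :=
  #|[set f : {ffun 'I_n -> U} | [forall j, f (t j) == y (f j)]]|.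

(** * The cycle characters *)

Section CycleCharacter.
Variables (F : numFieldType) (zeta : nat -> F).
Hypothesis zetaP : forall n, (0 < n)%N -> n.-primitive_root (zeta n).
Variable T : finType.
Implicit Types (c s : {perm T}).

(* The two signs apart, the trace of [(s, t)] on the multilinear part, in letters
   indexed by [T], of the symmetric algebra on the letters times the [n]-th tensor
   power of the free Lie algebra: the unlabelled points are the commuting letters,
   and the Lie part is induced from the characters [theta zeta c]. *)
Definition cycle_char n s (t : 'S_n) : F :=
  \sum_(c | (c * s == s * c)%g)
  \sum_(phi : {ffun T -> option 'I_n} |
         labelling c phi && [forall i, phi (s i) == omap t (phi i)])
    (-1) ^+ odd_perm s * (-1) ^+ odd_perm t * theta zeta c s.

Variables (U : finType) (y : {perm U}) (s : {perm T}).
Implicit Types h : {ffun T -> option U}.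

Definition noneset h := [set i | h i == None].

Definition equivariant h := [forall i, h (s i) == omap y (h i)].

(* Injectivity of this map is that of [h] on the points with a value. *)
Definition partial_kap h (i : T) : T + U :=
  if h i is Some u then inr u else inl i.

Definition orbit_sign h : F := (-1) ^+ #|[set porbit s i | i in noneset h]|.

Lemma partial_kap_perm c h : [forall i, partial_kap h (c i) == partial_kap h i] =
  [forall i, h (c i) == h i] && [forall i in noneset h, c i == i].
Proof.
apply/forallP/andP => [H|[/forallP hc /forallP cN] i].
  have hi i : h (c i) = h i.
    by have /eqP := H i; rewrite /partial_kap; case: (h i) => [u|]; case: (h (c i)) => [v|] // [->].
  split; apply/forallP => i; first exact/eqP.
  apply/implyP; rewrite inE => /eqP hN; have /eqP := H i.
  by rewrite /partial_kap hi hN => -[->].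
rewrite /partial_kap (eqP (hc i)); case e: (h i) => [u|]; first by [].
by have := cN i; rewrite inE e => /eqP ->.
Qed.

(** For fixed [c] and [h], the labelling [phi] determines [t], by the action of [s] on labels, and
    [f], by the values of [h] on cycles. The sign does not depend on [phi] by [labelling_sign], so
    the labellings are merely counted. *)
Lemma labelled_sum_h c h n : commute c s ->
  \sum_(t : 'S_n) \sum_(phi : {ffun T -> option 'I_n} |
         labelling c phi && [forall i, phi (s i) == omap t (phi i)])
    \sum_(f : {ffun 'I_n -> U} | [forall j, f (t j) == y (f j)] &&
            ([ffun i => omap f (phi i)] == h))
      ((-1) ^+ (#|T| + n) * (-1) ^+ odd_perm s * (-1) ^+ odd_perm t : F) =
  if equivariant h && [forall i, partial_kap h (c i) == partial_kap h i]
  then ((n == #|[set porbit c i | i in ~: noneset h]|) * n`!)%:R *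
       (orbit_sign h * (-1) ^+ odd_perm (quo_perm s c))
  else 0.
Proof.
move=> cs; rewrite partial_kap_perm; case: ifP => [/and3P[eh hc cN]|nH]; last first.
  rewrite big1 // => t _; rewrite big1 // => phi /andP[P /forallP st].
  rewrite big1 // => f /andP[/forallP ft /eqP hE]; case/negP: nH; apply/and3P; split.
  - apply/forallP => i; rewrite -hE !ffunE (eqP (st i)); case: (phi i) => [j|] //=.
    exact: ft.
  - by apply/forallP => i; rewrite -hE !ffunE (labelling_perm P).
  apply/forallP => i; apply/implyP; rewrite -hE inE ffunE => e.
  by apply/eqP/(labelling_fix P); case: (phi i) e.
have cN' i : i \in noneset h -> c i = i.
  by move=> iN; apply/eqP; move/forallP/(_ i)/implyP: cN; apply.
rewrite -(labelling_card n cN') -sum1_card natr_sum mulr_suml.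
rewrite (exchange_big_dep xpredT) //= [RHS]big_mkcond /=; apply: eq_bigr => phi _.
rewrite inE; case: ifP => [/andP[P /forallP eN]|nPhi]; last first.
  rewrite big1 // => t /andP[P _]; rewrite big1 // => f /andP[_ /eqP hE].
  case/negP: nPhi; rewrite P; apply/forallP => i.
  by rewrite inE -hE ffunE; case: (phi i).
have [|t0 t0E] := labelling_unique P (labelling_commute cs P).
  move=> i; rewrite ffunE !(eqP (eN _)) !inE.
  by rewrite (eqP (forallP eh i)); case: (h i).
have st i : phi (s i) = omap t0 (phi i) by rewrite -t0E ffunE.
have hX i k : h ((c ^+ k)%g i) = h i.
  elim: k => [|k IH]; first by rewrite expg0 perm1.
  by rewrite expgSr permM (eqP (forallP hc _)).
have fP j : exists u, [exists i, (phi i == Some j) && (h i == Some u)].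
  have [i iE] := labelling_surj P j; have := eqP (eN i); rewrite iE inE.
  case e: (h i) => [u|//] _; exists u; apply/existsP; exists i.
  by rewrite iE e !eqxx.
pose f0 := [ffun j => xchoose (fP j)].
have f0E i : h i = omap f0 (phi i).
  case e: (phi i) => [j|] /=; last by apply/eqP; have := eqP (eN i); rewrite e inE => <-.
  have := xchooseP (fP j); rewrite -[xchoose _](ffunE (fun j => xchoose (fP j))) -/f0.
  case/existsP=> i' /andP[/eqP i'E /eqP <-].
  have : i' \in porbit c i by apply: (labelling_orbit P); rewrite e ?i'E.
  by case/porbitP=> k ->; rewrite hX.
rewrite (big_pred1 t0) => [|t]; last first.
  rewrite P /=; apply/forallP/eqP => [tE|-> i]; last by rewrite st.
  apply/permP => j; have [i iE] := labelling_surj P j.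
  by have := eqP (tE i); rewrite st iE => -[].
rewrite (big_pred1 f0) => [|f] /=; last first.
  apply/andP/eqP => [[_ /eqP fE]|->].
    apply/ffunP => j; have [i iE] := labelling_surj P j.
    by have := f0E i; rewrite -fE ffunE iE => -[].
  split; last by apply/eqP/ffunP => i; rewrite ffunE -f0E.
  apply/forallP => j; have [i iE] := labelling_surj P j; apply/eqP.
  have := eqP (forallP eh i); rewrite !f0E st iE /=.
  by move=> -[].
rewrite mul1r (labelling_sign P cs (N := noneset h)) // => i.
by rewrite (eqP (eN i)).
Qed.

Lemma fix_countE n (t : 'S_n) (phi : {ffun T -> option 'I_n}) (w : F) :
  w * (fix_count t y)%:R =
  \sum_h \sum_(f : {ffun 'I_n -> U} | [forall j, f (t j) == y (f j)] &&
            ([ffun i => omap f (phi i)] == h)) w.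
Proof.
rewrite /fix_count -sum1_card natr_sum mulr_sumr.
rewrite (partition_big (fun f : {ffun 'I_n -> U} => [ffun i => omap f (phi i)]) predT) //=.
apply: eq_bigr => h _; apply: eq_big => [f|f _]; first by rewrite inE.
by rewrite mulr1.
Qed.

Lemma card_labels_leq c (N : {set T}) : (#|[set porbit c i | i in N]| <= #|T|)%N.
Proof. by rewrite (leq_trans (leq_imset_card _ _)) // max_card. Qed.

(* The left side is the virtual character of the Chevalley-Eilenberg type
   complex of a free Lie algebra with coefficients in functions on [U]. *)
Theorem cycle_char_sum :
  \sum_(n < #|T|.+1) (n`!%:R)^-1 *
     \sum_(t : 'S_n) (-1) ^+ (#|T| + n) * cycle_char s t * (fix_count t y)%:R =
  \sum_(h | equivariant h) orbit_sign h * (injectiveb (partial_kap h))%:R.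
Proof.
transitivity (\sum_(n < #|T|.+1) \sum_h \sum_(c | (c * s == s * c)%g)
    (n`!%:R)^-1 * ((if equivariant h && [forall i, partial_kap h (c i) == partial_kap h i]
  then ((n == #|[set porbit c i | i in ~: noneset h]| :> nat) * n`!)%:R *
       (orbit_sign h * (-1) ^+ odd_perm (quo_perm s c))
  else 0) * theta zeta c s)).
  apply: eq_bigr => n _.
  rewrite exchange_big /=.
  transitivity (\sum_(c | (c * s == s * c)%g) \sum_h (n`!%:R)^-1 *
    ((\sum_(t : 'S_n) \sum_(phi : {ffun T -> option 'I_n} |
         labelling c phi && [forall i, phi (s i) == omap t (phi i)])
    \sum_(f : {ffun 'I_n -> U} | [forall j, f (t j) == y (f j)] &&
            ([ffun i => omap f (phi i)] == h))
      ((-1) ^+ (#|T| + n) * (-1) ^+ odd_perm s * (-1) ^+ odd_perm t : F)) * theta zeta c s)).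
    under [RHS]eq_bigr => c _ do rewrite -mulr_sumr -mulr_suml exchange_big /=.
    rewrite -mulr_sumr; congr (_ * _); rewrite /cycle_char.
    under eq_bigr => t _ do rewrite mulr_sumr mulr_suml.
    rewrite exchange_big /=; apply: eq_bigr => c _.
    rewrite mulr_suml; apply: eq_bigr => t _.
    rewrite mulr_sumr mulr_suml [in RHS]exchange_big mulr_suml /=; apply: eq_bigr => phi _.
    rewrite -fix_countE !mulrA -!mulrA; congr (_ * (_ * (_ * _))).
    by rewrite mulrC.
  apply: eq_bigr => c /eqP cs; apply: eq_bigr => h _.
  by rewrite labelled_sum_h.
rewrite exchange_big [RHS]big_mkcond /=; apply: eq_bigr => h _.
rewrite exchange_big /=; case: ifP => eh; last first.
  by rewrite big1 // => c _; rewrite big1 // => n _; rewrite mul0r mulr0.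
rewrite -(@key_sum F zeta T _ s (partial_kap h) zetaP); last first.
  move=> i i'; rewrite /partial_kap !(eqP (forallP eh _)).
  case: (h i) => [u|]; case: (h i') => [u'|] //= [->] //.
rewrite mulr_sumr [RHS]big_mkcond [LHS]big_mkcond /=; apply: eq_bigr => c _.
rewrite /kap_centralizer; case: (_ == _) => //=; case: ifP => kc; last first.
  by rewrite big1 // => n _; rewrite mul0r mulr0.
(* Given [c] and [h], only one [n] contributes, the number of labelled cycles, and its factorial
   cancels. *)
have lt : (#|[set porbit c i | i in ~: noneset h]| < #|T|.+1)%N by rewrite ltnS card_labels_leq.
rewrite (bigD1 (Ordinal lt)) //= eqxx mul1n big1 => [|n nn]; last first.
  by rewrite (_ : (_ == _ :> nat) = false) ?mul0n ?mul0r ?mulr0 //; apply: contraNF nn => /eqP e; apply/eqP/val_inj.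
rewrite addr0 !mulrA mulVf ?pnatr_eq0 -?lt0n ?fact_gt0 // mul1r /key_weight.
by rewrite -!mulrA.
Qed.

End CycleCharacter.

Lemma idem_fun_prod (F : numFieldType) (gT1 gT2 : finGroupType) (e1 : gT1 -> F) (e2 : gT2 -> F) :
  idem_fun e1 -> idem_fun e2 ->
  idem_fun (fun g : (gT1 * gT2)%type => e1 g.1 * e2 g.2).
Proof.
move=> i1 i2 x; rewrite -i1 -i2 mulr_suml /=.
under [RHS]eq_bigr do rewrite mulr_sumr.
by rewrite pair_big /=; apply: eq_bigr => h _; rewrite mulrACA.
Qed.

Section CyclePositivity.
Variables (F : numFieldType) (zeta : nat -> F).
Hypothesis zetaP : forall n, (0 < n)%N -> n.-primitive_root (zeta n).
Variables (T : finType) (n : nat).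
Implicit Types (c s k : {perm T}) (t : 'S_n).

(** [cycle_char] is the monomial character induced from the stabilizers of the pairs [(c, phi)],
    under conjugation and relabelling, with linear characters [th]. *)
Lemma cycle_pair_nat (e1 : {perm T} -> F) (e2 : 'S_n -> F) : idem_fun e1 -> idem_fun e2 ->
  exists k : nat, \sum_s \sum_t e1 s * e2 t * cycle_char zeta s t = k%:R.
Proof.
move=> i1 i2.
pose X := ({perm T} * {ffun T -> option 'I_n})%type.
pose act (u : X) (g : {perm T} * 'S_n) : X :=
  ((u.1 ^ g.1)%g, [ffun i => omap g.2 (u.2 (g.1^-1%g i))]).
pose D : {pred X} := [pred u | labelling u.1 u.2].
pose th (u : X) (g : {perm T} * 'S_n) : F :=
  (-1) ^+ odd_perm g.1 * (-1) ^+ odd_perm g.2 * theta zeta u.1 g.1.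
have actE u g : (act u g == u) = (u.1 * g.1 == g.1 * u.1)%g &&
    [forall i, u.2 (g.1 i) == omap g.2 (u.2 i)].
  case: u g => c phi [s t]; rewrite /act /= xpair_eqE; congr (_ && _).
    rewrite -(inj_eq (mulgI s)) conjgE !mulgA mulgV mul1g eq_sym; apply/eqP/eqP => <- //.
  apply/eqP/forallP => [/ffunP e i|e].
    by rewrite -(e (s i)) ffunE permK.
  by apply/ffunP => i; rewrite ffunE -(eqP (e _)) permKV.
have act_comm u g : act u g = u -> commute u.1 g.1.
  by move=> /eqP; rewrite actE => /andP[/eqP].
have [||||||k kE] := @monomial_pair_nat F _ X D act th (fun g => e1 g.1 * e2 g.2)
    (idem_fun_prod i1 i2).
- case=> c phi; rewrite /act /= conjg1; congr pair; apply/ffunP => i.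
  by rewrite ffunE invg1 perm1; case: (phi i) => //= j; rewrite perm1.
- case=> c phi [s t] [s' t']; rewrite /act /= conjgM; congr pair; apply/ffunP => i.
  by rewrite !ffunE /= invMg permM; case: (phi _) => //= j; rewrite permM.
- case=> c phi [s t]; rewrite /D !inE /= => P.
  have P' : labelling (c ^ s)%g [ffun i => phi (s^-1%g i)].
    apply/and4P; split; apply/forallP => i.
    + have [i' i'E] := labelling_surj P i; apply/existsP; exists (s i').
      by rewrite ffunE permK i'E.
    + apply/forallP => i'; rewrite !ffunE; apply/implyP => /andP[/eqP e n0].
      by rewrite -[i](permKV s) -[i'](permKV s) porbit_conj (labelling_orbit P).
    + by rewrite !ffunE conjgE !permM permK (labelling_perm P).
    apply/implyP; rewrite ffunE => /eqP/(labelling_fix P) e.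
    by rewrite conjgE !permM e permKV.
  have := labelling_omap t P'; congr (labelling _ _); apply/ffunP => i.
  by rewrite !ffunE.
- by move=> u _; rewrite /th !odd_perm1 !mulr1 theta_id ?mulr1.
- move=> u g h _ /act_comm ug /act_comm uh; rewrite /th /= thetaM // !odd_permM !signr_addb.
  rewrite [RHS]mulrACA; congr (_ * _); exact: mulrACA.
- by move=> u g h _ /act_comm ug; rewrite /th /= theta_conj // !odd_permJ.
exists k; rewrite -kE /cycle_char.
transitivity (\sum_g \sum_(u in D | act u g == u) e1 g.1 * e2 g.2 * th u g).
  rewrite pair_big /=; apply: eq_bigr => -[s t] _ /=.
  rewrite pair_big_dep mulr_sumr /=; apply: eq_big => [[c phi]|u _ //].
  by rewrite actE inE /= andbCA.
rewrite (exchange_big_dep (mem D)) /=; last by move=> g u _ /andP[].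
by apply: eq_bigr => u uD; apply: eq_bigl => g; rewrite uD.
Qed.

Lemma cycle_char_classfun s t (k' : 'S_n) : cycle_char zeta s (t ^ k')%g = cycle_char zeta s t :> F.
Proof.
rewrite /cycle_char; apply: eq_bigr => c _.
pose om (k : 'S_n) (phi : {ffun T -> option 'I_n}) := [ffun i => omap k (phi i)].
have omK (k : 'S_n) : cancel (om k) (om k^-1%g).
  move=> phi; apply/ffunP => i; rewrite !ffunE; case: (phi i) => //= j.
  by rewrite permK.
rewrite (reindex_inj (can_inj (omK k'))) /=; apply: eq_big => [phi|phi _].
  congr (_ && _).
    apply/idP/idP => [|P]; last exact: labelling_omap.
    by move/(labelling_omap k'^-1%g); rewrite -/(om k'^-1%g (om k' phi)) omK.
  apply: eq_forallb => i; rewrite !ffunE; case: (phi i) => [j|]; case: (phi (s i)) => [j'|] //=.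
  by rewrite conjgE !permM permK !(inj_eq (@Some_inj _)) (inj_eq perm_inj).
by rewrite odd_permJ.
Qed.

Lemma fix_count_classfun (U : finType) t (k : 'S_n) (y : {perm U}) :
  fix_count (t ^ k)%g y = fix_count t y.
Proof.
rewrite /fix_count; pose om (f : {ffun 'I_n -> U}) := [ffun j => f (k j)].
have omI : injective om.
  move=> f f' /ffunP e; apply/ffunP => j.
  by have := e (k^-1%g j); rewrite !ffunE permKV.
have omE f : [forall j, om f (t j) == y (om f j)] = [forall j, f ((t ^ k)%g j) == y (f j)].
  apply/forallP/forallP => H j.
    by have := H (k^-1%g j); rewrite !ffunE permKV conjgE !permM.
  by have := H (k j); rewrite !ffunE conjgE !permM permK.
rewrite -(card_imset _ omI); apply: eq_card => f; rewrite [in RHS]inE.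
apply/imsetP/idP => [[f' + ->]|H]; first by rewrite inE omE.
exists [ffun j => f (k^-1%g j)]; last first.
  by apply/ffunP => j; rewrite !ffunE permK.
rewrite inE -omE; apply: etrans H; apply: eq_forallb => j.
by rewrite !ffunE !permK.
Qed.

Lemma cycle_char_gt s t : (#|T| < n)%N -> cycle_char zeta s t = 0 :> F.
Proof.
move=> Tn; rewrite /cycle_char big1 // => c _; rewrite big1 // => phi /andP[P _].
have := labelling_count P (N := [set i | phi i == None]).
move=> nE; move: Tn; rewrite {1}nE => [|i]; last by rewrite inE.
by rewrite ltnNge card_labels_leq.
Qed.

End CyclePositivity.

(** With as many labels as points, every point is labelled and alone in its cycle. So [c] is 1,
    [phi] is a bijection conjugating [s] to [t], and the two signs cancel. *)
Lemma cycle_char_diag (F : numFieldType) (zeta : nat -> F) m (s t : 'S_m) :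
    (forall n, (0 < n)%N -> n.-primitive_root (zeta n)) ->
  cycle_char zeta s t = \sum_(g : 'S_m) (t == (s ^ g)%g)%:R.
Proof.
move=> zetaP; rewrite /cycle_char.
have lab c (phi : {ffun 'I_m -> option 'I_m}) : labelling c phi ->
    c = 1%g /\ exists g : 'S_m, phi = [ffun i => Some (g i)].
  pose N := [set i | phi i == None]; move=> P.
  have eN i : (phi i == None) = (i \in N) by rewrite inE.
  have mE := labelling_count P eN.
  have N0 : N = finset.set0.
    apply/eqP; rewrite -cards_eq0 -leqn0 -(leq_add2r #|~: N|) cardsC card_ord add0n {1}mE.
    exact: leq_imset_card.
  have phiS i : exists j, phi i = Some j.
    by have := eN i; rewrite N0 in_set0; case: (phi i) => // j; exists j.
  have orbI : injective (porbit c).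
    have : {in [set: 'I_m] &, injective (porbit c)}.
      by apply/imset_injP; rewrite cardsT card_ord -finset.setC0 -N0; apply/eqP/esym.
    by move=> H i j; apply: H.
  have c1 : c = 1%g.
    apply/permP => i; rewrite perm1; apply: orbI; apply/eqP.
    by rewrite eq_sym -mem_porbit_eq; have := mem_porbit c 1 i; rewrite expg1.
  split=> //.
  pose gf i := odflt i (phi i).
  have gfE i : phi i = Some (gf i) by rewrite /gf; have [j ->] := phiS i.
  have gI : injective gf.
    move=> i j e; have /(labelling_orbit P) : phi i = phi j by rewrite !gfE e.
    rewrite gfE => /(_ isT)/porbitP[k ->].
    by rewrite c1 expg1n perm1.
  by exists (perm gI); apply/ffunP => i; rewrite ffunE permE -gfE.
have lab1 (g : 'S_m) : labelling 1%g [ffun i => Some (g i)].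
  apply/and4P; split; apply/forallP => i.
  - by apply/existsP; exists (g^-1%g i); rewrite ffunE permKV.
  - apply/forallP => j; rewrite !ffunE; apply/implyP => /andP[/eqP[/perm_inj ->] _].
    exact: porbit_id.
  - by rewrite perm1.
  by rewrite ffunE.
rewrite (bigD1 1%g) /=; last by rewrite mul1g mulg1.
rewrite [X in _ + X]big1 ?addr0; last first.
  by move=> c /andP[_ nc]; rewrite big1 // => phi /andP[/lab[c1 _] _]; rewrite c1 eqxx in nc.
pose emb (g : 'S_m) := [ffun i => Some (g i)] : {ffun 'I_m -> option 'I_m}.
have embI : injective emb.
  by move=> g g' e; apply/permP => i; have := congr1 (fun f : {ffun _} => f i) e; rewrite !ffunE => -[].
have condE g : [forall i, emb g (s i) == omap t (emb g i)] = (t == (s ^ g)%g).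
  apply/forallP/eqP => [e|-> i].
    apply/permP => j; have := eqP (e (g^-1%g j)); rewrite !ffunE /= permKV => -[<-].
    by rewrite conjgE !permM.
  by rewrite !ffunE /= conjgE !permM permK.
rewrite (eq_bigl (fun phi => (phi \in [set emb g | g in 'S_m]) &&
    [forall i, phi (s i) == omap t (phi i)])); last first.
  move=> phi; congr (_ && _); apply/idP/imsetP => [/lab[_ [g ->]]|[g _ ->]].
    by exists g.
  exact: lab1.
rewrite big_mkcondr big_imset /=; last by move=> g g' _ _; apply: embI.
apply: eq_bigr => g _; rewrite condE; case: eqP => // ->.
by rewrite odd_permJ -signr_addb addbb mul1r (theta_perm1 zetaP).
Qed.

Lemma perm_on_extension (I U : finType) (Z : {set I}) (R : {set U}) (a b : I -> U) :
    (forall i, i \in Z -> a i \in R) -> (forall i, i \in Z -> b i \in R) ->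
    {in Z &, injective a} -> {in Z &, injective b} ->
  exists2 k : {perm U}, perm_on R k & forall i, i \in Z -> k (a i) = b i.
Proof.
elim: {Z}#|Z| {-2}Z (erefl #|Z|) => [|n IH] Z cZ aR bR aI bI.
  exists 1%g; first exact: perm_on1.
  by move=> i; rewrite (cards0_eq cZ) inE.
have /card_gt0P[i0 i0Z] : (0 < #|Z|)%N by rewrite cZ.
have subZ i : i \in Z :\ i0 -> i \in Z by rewrite !inE => /andP[].
have [|||||k kR kE] := IH (Z :\ i0).
- by move: cZ; rewrite (cardsD1 i0) i0Z => -[].
- by move=> i /subZ; exact: aR.
- by move=> i /subZ; exact: bR.
- by move=> i j /subZ iZ /subZ jZ; exact: aI.
- by move=> i j /subZ iZ /subZ jZ; exact: bI.
exists (k * tperm (k (a i0)) (b i0))%g.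
  apply: perm_onM => //; apply/subsetP => u; rewrite inE.
  case: tpermP => [-> _|-> _|]; rewrite ?eqxx //; last exact: bR.
  by rewrite (perm_closed _ kR) aR.
move=> i iZ; rewrite permM; case: (eqVneq i i0) => [->|ni]; first by rewrite tpermL.
rewrite (kE i) ?inE ?ni // tpermD //; last by apply: contra ni => /eqP /bI ->.
rewrite -(kE i) ?inE ?ni // (inj_eq perm_inj); apply: contra ni => /eqP /aI ->//.
Qed.

(** * Pairing with permutation characters *)

Section Averaging.
Variables (F : numFieldType) (T U : finType) (s : {perm T}) (J : {set U}) (y0 : {perm U}).
Hypothesis y0J : forall u, (y0 u \in J) = (u \in J).
Hypothesis TJ : (#|T| <= #|~: J|)%N.
Implicit Types (h : {ffun T -> option U}) (rho : {ffun T -> option (option U)}).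

Definition partial_inj h := injectiveb (partial_kap h).

Lemma partial_injP h :
  reflect (forall i i' u, h i = Some u -> h i' = Some u -> i = i') (partial_inj h).
Proof.
apply: (iffP (injectiveP _)) => H i i'.
  by move=> u hi hi'; apply: H; rewrite /partial_kap hi hi'.
rewrite /partial_kap; case e: (h i) => [u|]; case e': (h i') => [u'|] // [].
  by move=> uu; apply: (H _ _ u); rewrite // e' uu.
by [].
Qed.

(** [red h] forgets the values of [h] outside [J], which are what the permutations supported off [J]
    can move. *)
Let keep u := if u \in J then Some u else None.
Let red h : {ffun T -> option (option U)} := [ffun i => omap keep (h i)].
Let G := [set z | perm_on (~: J) z].

Let GJ z u : z \in G -> (z u \in J) = (u \in J).
Proof.
rewrite inE => zG; have := perm_closed u zG.
by rewrite !inE; case: (_ \in J); case: (_ \in J).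
Qed.

Let Gfix z u : z \in G -> u \in J -> z u = u.
Proof. by rewrite inE => zG uJ; apply: (out_perm zG); rewrite inE uJ. Qed.

Let good rho := [forall i, if rho i is Some (Some u) then u \in J else true] &&
  [forall i, forall i', [&& rho i == rho i', rho i != None & rho i != Some None] ==> (i == i')].

Let equiv rho := [forall i, rho (s i) == omap (omap y0) (rho i)].

Let Om rho := [set h | partial_inj h && (red h == rho)].

Let acth (z : {perm U}) h := [ffun i => omap z (h i)].

Let alpha h := [ffun i => omap y0 (h (s^-1%g i))].

Let actM z z' h : acth (z * z')%g h = acth z' (acth z h).
Proof. by apply/ffunP => i; rewrite !ffunE; case: (h i) => //= u; rewrite permM. Qed.

Let actV z h : acth z^-1%g (acth z h) = h.
Proof. by apply/ffunP => i; rewrite !ffunE; case: (h i) => //= u; rewrite permK. Qed.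

Let acth_Om z rho h : z \in G -> h \in Om rho -> acth z h \in Om rho.
Proof.
move=> zG; rewrite !inE => /andP[/partial_injP hI /eqP <-]; apply/andP; split.
  apply/partial_injP => i i' u; rewrite !ffunE.
  case e: (h i) => [v|//] [<-]; case e': (h i') => [v'|//] [/perm_inj v'v].
  by apply: (hI _ _ v); rewrite // e' v'v.
apply/eqP/ffunP => i; rewrite !ffunE; case: (h i) => //= u.
by rewrite /keep GJ //; case: ifP => // uJ; rewrite Gfix.
Qed.

Let Om_trans rho h h' : h \in Om rho -> h' \in Om rho -> exists2 z, z \in G & acth z h = h'.
Proof.
rewrite !inE => /andP[/partial_injP hI /eqP hr] /andP[/partial_injP hI' /eqP hr'].
have rE i : omap keep (h i) = omap keep (h' i).
  by have := congr1 (fun f : {ffun _} => f i) (etrans hr (esym hr')); rewrite !ffunE.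
case: (pickP (mem (~: J))) => [u0 u0J|noR]; last first.
  exists 1%g; first by rewrite inE perm_on1.
  apply/ffunP => i; rewrite ffunE; have := rE i.
  case: (h i) => [u|]; case: (h' i) => [u'|] //=; rewrite perm1 /keep.
  by have := noR u; have := noR u'; rewrite /= !inE => /negbFE -> /negbFE -> [->].
pose Z := [set i | if h i is Some u then u \notin J else false].
pose a i := odflt u0 (h i); pose b i := odflt u0 (h' i).
have ZE i : i \in Z -> [/\ h i = Some (a i), h' i = Some (b i), a i \notin J & b i \notin J].
  rewrite inE /a /b; have := rE i; case: (h i) => [u|//]; case: (h' i) => [u'|//] /=.
  rewrite /keep; case: (boolP (u \in J)) => // uJ; case: (boolP (u' \in J)) => // u'J _ _.
have [||||z zG zE] := @perm_on_extension T U Z (~: J) a b.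
- by move=> i /ZE[_ _ + _]; rewrite inE.
- by move=> i /ZE[_ _ _]; rewrite inE.
- by move=> i i' /ZE[hi _ _ _] /ZE[hi' _ _ _] e; apply: (hI _ _ (a i)); rewrite // hi' e.
- by move=> i i' /ZE[_ hi _ _] /ZE[_ hi' _ _] e; apply: (hI' _ _ (b i)); rewrite // hi' e.
exists z; first by rewrite inE.
apply/ffunP => i; rewrite ffunE; case: (boolP (i \in Z)) => iZ.
  by have [-> -> _ _] := ZE i iZ; rewrite /= zE.
have := rE i; move: iZ; rewrite inE; case: (h i) => [u|]; case: (h' i) => [u'|] //=.
rewrite negbK /keep => uJ; rewrite uJ; case: ifP => // _ [<-].
by rewrite Gfix ?inE.
Qed.

Let B h h' := #|[set z in G | acth z h == h']|.

(** [G] is transitive on each fibre [Om rho], so left and right translations by elements of [G]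
    match the two counts. *)
Let B_const rho h1 h1' h2 h2' : h1 \in Om rho -> h1' \in Om rho ->
  h2 \in Om rho -> h2' \in Om rho -> B h1 h1' = B h2 h2'.
Proof.
move=> o1 o1' o2 o2'; have [k kG kE] := Om_trans o2 o1; have [k' k'G k'E] := Om_trans o1' o2'.
have GM z z' : z \in G -> z' \in G -> (z * z')%g \in G.
  by rewrite !inE; exact: perm_onM.
have GV z : z \in G -> z^-1%g \in G by rewrite !inE; exact: perm_onV.
rewrite /B -[LHS](card_imset _ (mulgI k)) -[LHS](card_imset _ (mulIg k')).
congr #|pred_of_set _|; apply/setP => z; apply/imsetP/idP.
  move=> [_ /imsetP[x xP ->] ->]; move: xP; rewrite !in_set -[perm_on _ x]in_set -/G => /andP[xG /eqP xE].
  by rewrite -[perm_on _ _]in_set -/G !GM //= !actM kE xE k'E eqxx.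
rewrite [z \in _]in_set => /andP[zG /eqP zE]; exists (z * k'^-1)%g; last by rewrite mulgKV.
apply/imsetP; exists (k^-1 * (z * k'^-1))%g; last by rewrite mulKVg.
by rewrite in_set !GM ?GV //= !actM -kE actV zE -k'E actV.
Qed.

Let sumB rho h0 : h0 \in Om rho -> (\sum_(h in Om rho) B h0 h)%N = #|G|.
Proof.
move=> o0; rewrite -[RHS]sum1_card (partition_big (fun z => acth z h0) (mem (Om rho))) /=.
  apply: eq_bigr => h _; rewrite /B -sum1_card; apply: eq_bigl => z.
  by rewrite in_set.
by move=> z zG; exact: acth_Om.
Qed.

Let redE h i : red h i = omap keep (h i). Proof. by rewrite ffunE. Qed.

Let keep_y0 u : omap y0 (keep u) = keep (y0 u).
Proof. by rewrite /keep y0J; case: ifP. Qed.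

Let equivX rho i k : equiv rho -> exists2 y : {perm U}, (forall u, (y u \in J) = (u \in J)) &
  rho ((s ^+ k)%g i) = omap (omap y) (rho i).
Proof.
move=> /forallP er; elim: k => [|k [y yJ yE]].
  exists 1%g; first by move=> u; rewrite perm1.
  by rewrite expg0 perm1; case: (rho i) => [[u|]|] //=; rewrite perm1.
exists (y * y0)%g => [u|]; first by rewrite permM y0J.
by rewrite expgSr permM (eqP (er _)) yE; case: (rho i) => [[u|]|] //=; rewrite permM.
Qed.

Let alpha_Om rho h : equiv rho -> h \in Om rho -> alpha h \in Om rho.
Proof.
move=> /forallP er; rewrite !inE => /andP[/partial_injP hI /eqP hr]; apply/andP; split.
  apply/partial_injP => i i' u; rewrite !ffunE.
  case e: (h _) => [v|//] [<-]; case e': (h _) => [v'|//] [/perm_inj v'v].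
  by apply: (@perm_inj _ s^-1%g); apply: (hI _ _ v); rewrite // e' v'v.
apply/eqP/ffunP => i; rewrite redE ffunE.
have := eqP (er (s^-1%g i)); rewrite permKV => ->; rewrite -hr redE.
by case: (h _) => //= u; rewrite keep_y0.
Qed.

(** If [rho] is equivariant, [alpha] preserves the fibre and each term is the constant count summed
    in [sumB]; otherwise no [z] carries [alpha h] to [h]. *)
Let fiber_sum rho : good rho ->
  (\sum_(h in Om rho) B (alpha h) h)%N = (equiv rho * #|G|)%N.
Proof.
move=> gr; case: (boolP (equiv rho)) => er; last first.
  rewrite mul0n big1 // => h; rewrite inE => /andP[_ /eqP hr].
  apply/eqP; rewrite cards_eq0; apply/eqP/setP => z; rewrite in_set in_set0.
  apply/negbTE; apply: contra er => /andP[zG /eqP zh]; apply/forallP => i.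
  apply/eqP; rewrite -hr !redE -[in LHS]zh !ffunE permK; case: (h i) => //= u.
  rewrite keep_y0 /keep GJ //; case: ifP => // uJ.
  by rewrite Gfix.
rewrite mul1n.
(* [TJ] provides distinct values outside [J] for all unspecified points, so the fibre is not
   empty. *)
pose iota (i : T) := enum_val (widen_ord TJ (enum_rank i)).
have iotaJ i : iota i \notin J by have := enum_valP (widen_ord TJ (enum_rank i)); rewrite inE.
have iotaI : injective iota by move=> i i' /enum_val_inj /(congr1 val) /= /val_inj /enum_rank_inj.
pose h0 := [ffun i => if rho i is Some ou then Some (odflt (iota i) ou) else None].
case/andP: gr => /forallP gJ /forallP gI.
have o0 : h0 \in Om rho.
  rewrite inE; apply/andP; split.
    apply/partial_injP => i i' u; rewrite !ffunE.
    have := gJ i; have := gJ i'; have /forallP/(_ i') := gI i.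
    case: (rho i) => [[v|]|] //; case: (rho i') => [[v'|]|] //=.
    - by move=> H _ _ [e] [e']; move: H; rewrite e e' eqxx /= => /eqP.
    - by move=> _ _ vJ [<-] [e]; move: (iotaJ i'); rewrite e vJ.
    - by move=> _ vJ _ [<-] [e]; move: (iotaJ i); rewrite -e vJ.
    by move=> _ _ _ [<-] [/iotaI].
  apply/eqP/ffunP => i; rewrite redE ffunE; have := gJ i.
  case: (rho i) => [[v|]|] //=; rewrite /keep; first by move=> ->.
  by rewrite (negbTE (iotaJ i)).
rewrite -(sumB o0); apply: eq_bigr => h oh.
exact: (B_const (alpha_Om er oh) oh o0 oh).
Qed.

Let orho rho : F := (-1) ^+ #|[set porbit s i | i in [set i | rho i == None]]|.

Let full rho := [forall i, (rho i != None) && (rho i != Some None)].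

Let flip (o : option (option U)) :=
  match o with None => Some None | Some None => None | _ => o end.

(* In [rho], [None] is the absence of a value and [Some None] a value outside [J].
   Exchanging them on one orbit of [s] changes the sign [orho], so that only the
   [full] functions contribute. *)
Let tog rho : {ffun T -> option (option U)} :=
  if [pick i | ~~ ((rho i != None) && (rho i != Some None))] is Some i0 then
    [ffun i => if i \in porbit s i0 then flip (rho i) else rho i] else rho.

Let flipK : involutive flip. Proof. by case=> [[u|]|]. Qed.

Let tog_sum_eq rho rho' : (forall i, ((rho i != None) && (rho i != Some None)) =
    ((rho' i != None) && (rho' i != Some None))) ->
  [pick i | ~~ ((rho i != None) && (rho i != Some None))] =
  [pick i | ~~ ((rho' i != None) && (rho' i != Some None))].
Proof. by move=> e; apply: eq_pick => i /=; rewrite e. Qed.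

Let matched_tog rho i : ((tog rho i != None) && (tog rho i != Some None)) =
    ((rho i != None) && (rho i != Some None)).
Proof.
rewrite /tog; case: pickP => [i0 _|//]; rewrite ffunE; case: ifP => // _.
by case: (rho i) => [[u|]|].
Qed.

Let togK : involutive tog.
Proof.
move=> rho; apply/ffunP => i; rewrite {1}/tog (tog_sum_eq (matched_tog rho)) /tog.
case: pickP => [i0 _|_]; last by [].
by rewrite !ffunE; case: (i \in porbit s i0); rewrite ?flipK.
Qed.

Let tog_good rho : good (tog rho) = good rho.
Proof.
have unm i u : (tog rho i == Some (Some u)) = (rho i == Some (Some u)).
  rewrite /tog; case: pickP => [i0 _|//]; rewrite ffunE; case: ifP => // _.
  by case: (rho i) => [[v|]|].
rewrite /good; congr (_ && _).
  apply: eq_forallb => i; have := unm i.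
  case: (tog rho i) => [[u|]|]; case: (rho i) => [[v|]|] //= H.
  - by have := H u; rewrite eqxx => /esym/eqP[->].
  - by have := H u; rewrite eqxx.
  - by have := H u; rewrite eqxx.
  - by have := H v; rewrite eqxx.
  by have := H v; rewrite eqxx.
apply: eq_forallb => i; apply: eq_forallb => i'; congr (_ ==> _).
have := unm i; have := unm i'.
case: (tog rho i) => [[u|]|]; case: (rho i) => [[v|]|] //= H' H.
- by have := H u; rewrite eqxx => /esym/eqP[->]; rewrite !andbT eq_sym H' eq_sym.
- by have := H u; rewrite eqxx.
- by have := H u; rewrite eqxx.
- by have := H v; rewrite eqxx.
- by rewrite !andbF.
- by rewrite !andbF.
- by have := H v; rewrite eqxx.
- by rewrite !andbF.
by rewrite !andbF.
Qed.

Let tog_equiv rho : equiv rho -> equiv (tog rho).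
Proof.
move=> /forallP er; apply/forallP => i; rewrite /tog; case: pickP => [i0 _|_]; last exact: er.
rewrite !ffunE (eqP (er i)).
have -> : (s i \in porbit s i0) = (i \in porbit s i0).
  by rewrite -!eq_porep; have := porep_perm s i 1; rewrite expg1 => ->.
by case: ifP => // _; case: (rho i) => [[u|]|].
Qed.

Let card_orbits_setD (S : {set T}) i0 : porbit s i0 \subset S ->
  #|[set porbit s i | i in S]| = #|[set porbit s i | i in S :\: porbit s i0]|.+1.
Proof.
move=> /subsetP OS; rewrite -[RHS]add1n.
have <- : (porbit s i0 \notin [set porbit s i | i in S :\: porbit s i0]) = 1%N :> nat.
  suff -> : porbit s i0 \notin [set porbit s i | i in S :\: porbit s i0] by [].
  apply/imsetP => -[i]; rewrite inE => /andP[iO _] e.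
  by rewrite e porbit_id in iO.
rewrite -cardsU1; congr #|pred_of_set _|; apply/setP => A; rewrite !inE.
apply/imsetP/orP => [[i iS ->]|[/eqP ->|/imsetP[i + ->]]].
- case: (boolP (i \in porbit s i0)) => iO.
    by left; rewrite eq_sym -mem_porbit_eq.
  by right; apply/imsetP; exists i; rewrite // inE iO.
- by exists i0 => //; apply/OS/porbit_id.
by rewrite inE => /andP[_ iS]; exists i.
Qed.

Let orho_tog rho : equiv rho -> ~~ full rho -> orho (tog rho) = - orho rho.
Proof.
move=> er nf; rewrite /orho /tog; case: pickP => [i0 i0P|no]; last first.
  case/negP: nf; apply/forallP => i; have := no i.
  by move/negbFE.
set S := [set i | rho i == None]; set S' := [set i | _ == None].
have rO i : i \in porbit s i0 -> (rho i == None) = (rho i0 == None).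
  case/porbitP=> k ->; have [y _ ->] := equivX i0 k er.
  by case: (rho i0).
have i0E : rho i0 = None \/ rho i0 = Some None.
  by move: i0P; case: (rho i0) => [[u|]|] // _; [right | left].
case: i0E => i0E.
  have OS : porbit s i0 \subset S by apply/subsetP => i iO; rewrite inE rO // i0E.
  have -> : S' = S :\: porbit s i0.
    apply/setP => i; rewrite !inE ffunE; case: (boolP (i \in _)) => //= iO.
    by have := rO i iO; rewrite i0E eqxx => /eqP ->.
  by rewrite (card_orbits_setD OS) exprS mulN1r opprK.
have OS : porbit s i0 \subset S'.
  apply/subsetP => i iO; rewrite inE ffunE iO.
  case/porbitP: iO => k ->; have [y _ ->] := equivX i0 k er.
  by rewrite i0E.
have -> : S = S' :\: porbit s i0.
  apply/setP => i; rewrite !inE ffunE; case: (boolP (i \in _)) => //= iO.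
  by rewrite rO // i0E.
by rewrite (card_orbits_setD OS) exprS mulN1r.
Qed.

Let full_tog rho : full (tog rho) = full rho.
Proof. by apply: eq_forallb => i; exact: matched_tog. Qed.

Let orho_sum : \sum_(rho | good rho && equiv rho) orho rho =
  #|[set rho | [&& good rho, equiv rho & full rho]]|%:R.
Proof.
rewrite (bigID full) /= [X in _ + X](_ : _ = 0) ?addr0.
  rewrite -sum1_card natr_sum; apply: eq_big => [rho|rho /andP[_ /forallP fr]].
    by rewrite inE andbA.
  rewrite /orho (_ : [set i | _] = finset.set0) ?imset0 ?cards0 //.
  by apply/setP => i; rewrite !inE; have /andP[/negbTE] := fr i.
set S := \sum_(_ | _) _; suff : S = - S.
  by move/eqP; rewrite -addr_eq0 -mulr2n mulrn_eq0 => /eqP.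
rewrite {1}/S (reindex_inj (inv_inj togK)) -sumrN; apply: eq_big => rho.
  rewrite tog_good full_tog; congr (_ && _ && _).
  by apply/idP/idP => [/tog_equiv|/tog_equiv]; rewrite ?togK.
case/andP=> /andP[_ er] nf; apply: orho_tog; last by rewrite -full_tog.
by rewrite -(togK rho); apply: tog_equiv.
Qed.

(** Summation over [z] leaves a signed count of equivariant reductions, and the toggle cancels those
    with an absent or unspecified value. The survivors are the total injections into [J]. *)
Lemma averaged_sum :
  \sum_(z | perm_on (~: J) z) \sum_(h | equivariant (y0 * z)%g s h)
     orbit_sign F s h * (injectiveb (partial_kap h))%:R =
  (#|~: J|`!)%:R * #|[set g : {ffun T -> U} |
     [&& injectiveb g, [forall i, g i \in J] & [forall i, g (s i) == y0 (g i)]]]|%:R.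
Proof.
transitivity (\sum_(h | partial_inj h) orho (red h) * (B (alpha h) h)%:R).
  rewrite (exchange_big_dep xpredT) //= [RHS]big_mkcond /=; apply: eq_bigr => h _.
  rewrite -/(partial_inj h); case: (partial_inj h); last first.
    by rewrite big1 // => z _; rewrite mulr0.
  rewrite mulr1 sumr_const -[LHS]mulr_natr; congr (_ * _).
    rewrite /orbit_sign /orho (_ : noneset h = [set i | red h i == None]) //.
    by apply/setP => i; rewrite !inE ffunE; case: (h i).
  congr (_%:R); rewrite -cardsE /B; congr #|pred_of_set _|; apply/setP => z.
  rewrite !in_set unfold_in; congr (_ && _).
  apply/forallP/eqP => [e|/ffunP e i]; last first.
    by rewrite -(e (s i)) !ffunE permK; case: (h i) => //= u; rewrite permM.
  apply/ffunP => i; rewrite !ffunE -{2}(permKV s i) (eqP (e _)).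
  by case: (h _) => //= u; rewrite permM.
rewrite (partition_big red good) /=; last first.
  move=> h /partial_injP hI; apply/andP; split; apply/forallP => i.
    by rewrite redE; case: (h i) => //= u; rewrite /keep; case: ifP.
  apply/forallP => i'; rewrite !redE; apply/implyP => /and3P[/eqP e n1 n2].
  apply/eqP; move: e n1 n2; case e: (h i) => [u|//] /=; case e': (h i') => [u'|//] /=.
  rewrite /keep; case: ifP => //; case: ifP => // _ _ [uu] _ _.
  by apply: (hI _ _ u); rewrite // e' uu.
transitivity (\sum_(rho | good rho) orho rho * (equiv rho * #|G|)%:R).
  apply: eq_bigr => rho gr; rewrite -fiber_sum // natr_sum mulr_sumr.
  by apply: eq_big => [h|h /andP[_ /eqP ->]] //; rewrite inE.
transitivity (#|G|%:R * \sum_(rho | good rho && equiv rho) orho rho).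
  rewrite mulr_sumr [RHS]big_mkcondr /=; apply: eq_bigr => rho _.
  by case: (equiv rho); rewrite ?mul1n ?mul0n ?mulr0 // mulrC.
rewrite orho_sum /G cardsE card_perm; congr (_ * _%:R).
pose emb (g : {ffun T -> U}) : {ffun T -> option (option U)} := [ffun i => Some (Some (g i))].
have embI : injective emb.
  by move=> g g' /ffunP e; apply/ffunP => i; have := e i; rewrite !ffunE => -[].
rewrite -[RHS](card_imset _ embI); congr #|pred_of_set _|; apply/setP => rho.
rewrite inE; apply/and3P/imsetP => [[/andP[/forallP gJ /forallP gI] /forallP er /forallP fr]|[g + ->]].
  have gP i : exists u, rho i == Some (Some u).
    by have := fr i; case: (rho i) => [[u|]|] // _; exists u.
  pose g := [ffun i => xchoose (gP i)].
  have gE i : rho i = Some (Some (g i)) by rewrite ffunE; apply/eqP; exact: (xchooseP (gP i)).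
  exists g; last by apply/ffunP => i; rewrite ffunE -gE.
  rewrite inE; apply/and3P; split.
  - apply/injectiveP => i i' e; have /forallP/(_ i') := gI i.
    by rewrite !gE e eqxx => /eqP.
  - by apply/forallP => i; have := gJ i; rewrite gE.
  by apply/forallP => i; have := er i; rewrite !gE.
rewrite inE => /and3P[/injectiveP gI /forallP gJ /forallP ge]; split.
- apply/andP; split; apply/forallP => i; first by rewrite ffunE.
  apply/forallP => i'; rewrite !ffunE; apply/implyP => /and3P[/eqP[/gI ->] _ _].
  exact: eqxx.
- by apply/forallP => i; rewrite !ffunE /= (eqP (ge i)).
by apply/forallP => i; rewrite ffunE.
Qed.

End Averaging.

Section StablePairing.
Variables (F : numFieldType) (T U : finType) (n : nat) (s : {perm T}) (w : 'S_n).
Implicit Types (f : {ffun 'I_n -> U}) (y : {perm U}).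

Definition cycle_sum y : F :=
  \sum_(h | equivariant y s h) orbit_sign F s h * (injectiveb (partial_kap h))%:R.

Hypothesis TU : (#|T| + n <= #|U|)%N.

Let J f := [set f j | j in 'I_n].

Let J_compl f : (#|T| <= #|~: J f|)%N.
Proof.
rewrite -(leq_add2l #|J f|) cardsC (leq_trans _ TU) // addnC leq_add2l.
by rewrite (leq_trans (leq_imset_card _ _)) // card_ord.
Qed.

(** The [y] compatible with [f] form the coset of [y0] by the permutations that fix the image of [f]
    pointwise. *)
Lemma cycle_sum_fiber f y0 : [forall j, f (w j) == y0 (f j)] ->
  \sum_(y : {perm U} | [forall j, f (w j) == y (f j)]) cycle_sum y =
  (#|~: J f|`!)%:R * #|[set g : {ffun T -> U} |
     [&& injectiveb g, [forall i, g i \in J f] & [forall i, g (s i) == y0 (g i)]]]|%:R.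
Proof.
move=> /forallP fy0.
have y0J u : (y0 u \in J f) = (u \in J f).
  apply/imsetP/imsetP => -[j _ e].
    exists (w^-1%g j) => //; apply: (@perm_inj _ y0).
    by rewrite e -(eqP (fy0 _)) permKV.
  by exists (w j); rewrite // e (eqP (fy0 _)).
rewrite -(averaged_sum F s y0J (J_compl f)) (reindex_inj (mulgI y0)) /=.
apply: eq_bigl => z; apply/forallP/idP => [fz|zJ j].
  apply/subsetP => u; rewrite !inE; apply: contra => /imsetP[j _ ->].
  have := fz (w^-1%g j); rewrite permM -(eqP (fy0 _)) permKV => /eqP e.
  by rewrite -e.
rewrite permM -(eqP (fy0 j)) (out_perm zJ) // inE negbK.
by apply/imsetP; exists (w j).
Qed.

Lemma cycle_sum_pairE :
  \sum_y cycle_sum y * (fix_count w y)%:R =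
  \sum_(f : {ffun 'I_n -> U}) \sum_(y : {perm U} | [forall j, f (w j) == y (f j)]) cycle_sum y.
Proof.
transitivity (\sum_(y : {perm U}) \sum_(f : {ffun 'I_n -> U} | [forall j, f (w j) == y (f j)]) cycle_sum y).
  apply: eq_bigr => y _; rewrite sumr_const -[RHS]mulr_natr /fix_count.
  by rewrite cardsE.
by rewrite (exchange_big_dep xpredT).
Qed.

(** The image of [f] has at most [n] points, too few for an injection of [T]. *)
Lemma cycle_sum_pair_lt : (n < #|T|)%N -> \sum_y cycle_sum y * (fix_count w y)%:R = 0.
Proof.
move=> nT; rewrite cycle_sum_pairE big1 // => f _.
case: (pickP (fun y : {perm U} => [forall j, f (w j) == y (f j)])) => [y0 fy0|no]; last first.
  by rewrite big1 // => y; rewrite no.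
rewrite (cycle_sum_fiber fy0) (_ : [set g | _] = finset.set0) ?cards0 ?mulr0 //.
apply/setP => g; rewrite !inE; apply/negbTE/negP => /and3P[/injectiveP gI /forallP gJ _].
have : (#|T| <= #|J f|)%N.
  rewrite -(card_imset _ gI); apply/subset_leq_card/subsetP => _ /imsetP[i _ ->].
  exact: gJ.
by rewrite leqNgt (leq_ltn_trans (leq_imset_card _ _)) // card_ord.
Qed.

End StablePairing.

(** Only injective [f] contribute, and then [g] is [f] after a permutation conjugating [s] to [w].
    The number of such [f] times [(#|U| - m)!] is [#|U|!]. *)
Lemma cycle_sum_pair_eq (F : numFieldType) (U : finType) m (s w : 'S_m) :
    (m + m <= #|U|)%N ->
  \sum_(y : {perm U}) cycle_sum F s y * (fix_count w y)%:R =
  (#|U|`!)%:R * \sum_(g : 'S_m) (w == (s ^ g)%g)%:R.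
Proof.
move=> mU; rewrite cycle_sum_pairE.
pose N := (\sum_(g : 'S_m) (w == (s ^ g)%g : nat))%N.
transitivity (\sum_(f : {ffun 'I_m -> U} | injectiveb f) ((#|U| - m)`!)%:R * N%:R : F).
  rewrite [RHS]big_mkcond /=; apply: eq_bigr => f _.
  have mU' : (#|'I_m| + m <= #|U|)%N by rewrite card_ord.
  case: (boolP (injectiveb f)) => [/injectiveP fI|nI]; last first.
    case: (pickP (fun y : {perm U} => [forall j, f (w j) == y (f j)])) => [y0 fy0|no]; last first.
      by rewrite big1 // => y; rewrite no.
    rewrite (cycle_sum_fiber F s mU' fy0) (_ : [set g | _] = finset.set0) ?cards0 ?mulr0 //.
    apply/setP => g; rewrite !inE; apply/negbTE; apply: contra nI => /and3P[/injectiveP gI /forallP gJ _].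
    apply/injectiveP; have : {in 'I_m &, injective f}.
      apply/imset_injP; rewrite eqn_leq leq_imset_card /= -(card_imset _ gI).
      by apply/subset_leq_card/subsetP => _ /imsetP[i _ ->]; exact: gJ.
    by move=> fI i j; apply: fI.
  have [||||y0 _ y0E] := @perm_on_extension 'I_m U [set: 'I_m] [set: U] f (fun j => f (w j)).
  - by move=> *; rewrite inE.
  - by move=> *; rewrite inE.
  - by move=> i j _ _; apply: fI.
  - by move=> i j _ _ /fI/perm_inj.
  have fy0 : [forall j, f (w j) == y0 (f j)] by apply/forallP => j; rewrite y0E ?inE.
  rewrite (cycle_sum_fiber F s mU' fy0).
  have -> : #|~: [set f j | j in 'I_m]| = (#|U| - m)%N.
    by rewrite cardsCs finset.setCK card_imset // card_ord.
  congr (_ * _%:R).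
  pose emb (g : 'S_m) := [ffun i => f (g i)].
  have embI : injective emb.
    by move=> g g' /ffunP e; apply/permP => i; have := e i; rewrite !ffunE => /fI.
  have NE : N = #|[set g : 'S_m | w == (s ^ g)%g]|.
    by rewrite /N -sum1_card [RHS]big_mkcond; apply: eq_bigr => g _; rewrite inE; case: (_ == _).
  have wE (g : 'S_m) : (w == (s ^ g)%g) = [forall i, g (s i) == w (g i)].
    apply/eqP/forallP => [-> i|e]; first by rewrite conjgE !permM permK.
    apply/permP => j; have := eqP (e (g^-1%g j)); rewrite permKV => <-.
    by rewrite conjgE !permM.
  rewrite NE -[RHS](card_imset _ embI); congr #|pred_of_set _|; apply/setP => g.
  rewrite inE; apply/and3P/imsetP => [[/injectiveP gI /forallP gJ /forallP ge]|[g' + ->]].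
    have gP i : exists j, g i == f j by have /imsetP[j _ ->] := gJ i; exists j.
    have [k gE] : exists k : 'I_m -> 'I_m, forall i, g i = f (k i).
      by exists (fun i => xchoose (gP i)) => i; apply/eqP; exact: (xchooseP (gP i)).
    have g'I : injective k by move=> i j e; apply: gI; rewrite !gE e.
    exists (perm g'I); last by apply/ffunP => i; rewrite ffunE permE -gE.
    rewrite inE wE; apply/forallP => i; apply/eqP/fI.
    by rewrite !permE -gE (eqP (ge i)) gE y0E ?inE.
  rewrite inE wE => /forallP ge; split.
  - by apply/injectiveP => i j; rewrite !ffunE => /fI/perm_inj.
  - by apply/forallP => i; rewrite ffunE; apply/imsetP; exists (g' i).
  by apply/forallP => i; rewrite !ffunE y0E ?inE // (eqP (ge i)).
rewrite sumr_const -[LHS]mulr_natr /N natr_sum.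
have -> : #|[pred f : {ffun 'I_m -> U} | injectiveb f]| = (#|U| ^_ m)%N.
  by rewrite -cardsE card_inj_ffuns card_ord.
rewrite mulrAC -natrM mulnC ffact_fact // (leq_trans _ mU) // leq_addr //.
Qed.

(** * Traces and completeness *)

Section RepresentationSums.
Variables (F : fieldType) (gT : finGroupType) (G : {group gT}).

Definition repr_sum (n : nat) (rG : mx_representation F G n) (z : gT -> F) : 'M[F]_n :=
  \sum_(x in G) z x *: rG x.

Lemma mx_rsim_trace n1 n2 (rG1 : mx_representation F G n1) (rG2 : mx_representation F G n2) x :
  x \in G -> mx_rsim rG1 rG2 -> \tr (rG1 x) = \tr (rG2 x).
Proof.
move=> xG [B e]; move: B rG2; case: n2 / e => B rG2 fB H.
have uB : B \in unitmx by rewrite -row_free_unit.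
by rewrite -[rG1 x](mulmxK uB) H // mxtrace_mulC mulmxA mulVmx // mul1mx.
Qed.

Lemma mx_rsim_repr_sum n1 n2 (rG1 : mx_representation F G n1)
    (rG2 : mx_representation F G n2) z :
  mx_rsim rG1 rG2 -> repr_sum rG2 z = 0 -> repr_sum rG1 z = 0.
Proof.
move=> [B _ fB H] z0; apply: (row_free_inj fB); rewrite /= mul0mx.
rewrite -[RHS](mulmx0 _ B) -z0 mulmx_suml mulmx_sumr; apply: eq_bigr => x xG.
by rewrite -scalemxAl -scalemxAr H.
Qed.

Lemma mxtrace_dadd (I : Type) (r : seq I) (rep : I -> representation F G) x :
  \tr ((\big[dadd_grepr/grepr0]_(i <- r) rep i) x) = \sum_(i <- r) \tr (rep i x).
Proof.
elim: r => [|i r IH]; first by rewrite !big_nil /= mxtrace1.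
by rewrite !big_cons /= mxtrace_block IH.
Qed.

Lemma mxtrace_muln (rep : representation F G) k x :
  \tr (muln_grepr rep k x) = \tr (rep x) *+ k.
Proof. by rewrite mxtrace_dadd sumr_const card_ord. Qed.

Lemma repr_sum_dadd (I : eqType) (r : seq I) (rep : I -> representation F G) z :
  {in r, forall i, repr_sum (rep i) z = 0} ->
  repr_sum (\big[dadd_grepr/grepr0]_(i <- r) rep i) z = 0.
Proof.
elim: r => [|i r IH] z0.
  by rewrite big_nil; apply/matrixP => -[].
have zi := z0 i (mem_head _ _); have {IH z0} := IH (fun j jr => z0 j (mem_behead (s := i :: r) jr)).
rewrite big_cons; move: (\big[_/_]_(_ <- _) _) => V IH.
rewrite /repr_sum /=; under eq_bigr do rewrite scale_block_mx !scaler0.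
transitivity (block_mx (repr_sum (rep i) z) 0 0 (repr_sum V z)); last first.
  by rewrite zi IH block_mx0.
rewrite /repr_sum; elim/big_rec3: _ => [|x A B C xG ->]; first by rewrite block_mx0.
by rewrite add_block_mx !addr0.
Qed.

Lemma repr_sum_muln (rep : representation F G) k z :
  repr_sum rep z = 0 -> repr_sum (muln_grepr rep k) z = 0.
Proof. by move=> z0; apply: repr_sum_dadd. Qed.

End RepresentationSums.

Section SpechtTrace.
Variables (F : numFieldType) (n : nat) (l : seq nat).
Hypothesis ln : sumn l = n.
Local Notation G := [set: 'S_n]%G.
Local Notation aG := (regular_repr F G).
Local Notation specht_row := (young_sum l (fun s => gring_row (aG s))).
Local Notation U := (cyclic_mx aG specht_row).

(* Left multiplication by the idempotent on the group algebra. *)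
Let P : 'M[F]_(gcard G) :=
  \matrix_(i, j) young_idem F l (enum_val j * (enum_val i)^-1)%g.

Let PE i j : P i j = young_idem F l (enum_val j * (enum_val i)^-1)%g.
Proof. by rewrite mxE. Qed.

Let aGE (x : 'S_n) i j : aG x i j = (enum_val j == enum_val i * x)%g%:R.
Proof.
rewrite mxE mxE eqxx /= -(inj_eq enum_val_inj) gring_indexK ?inE //.
Qed.

Let sumG (f : 'S_n -> F) : \sum_(i < gcard G) f (enum_val i) = \sum_g f g.
Proof.
rewrite -(big_enum_val (A := mem G) f); apply: eq_bigl => g.
by rewrite /= in_setT.
Qed.

Let P_aG x i j : (P *m aG x) i j = young_idem F l (enum_val j * x^-1 * (enum_val i)^-1)%g.
Proof.
rewrite mxE; transitivity (\sum_g young_idem F l (g * (enum_val i)^-1)%g *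
    (enum_val j == g * x :> 'S_n)%g%:R).
  by rewrite -sumG; apply: eq_bigr => k _; rewrite PE aGE.
rewrite (bigD1 (enum_val j * x^-1)%g) //= big1 => [|g ng]; last first.
  case: eqP => [e|_]; last by rewrite mulr0.
  by rewrite e mulgK eqxx in ng.
by rewrite mulgKV eqxx mulr1 addr0.
Qed.

Let P_comm x : P *m aG x = aG x *m P.
Proof.
apply/matrixP => i j; rewrite P_aG mxE.
transitivity (\sum_g (g == enum_val i * x :> 'S_n)%g%:R * young_idem F l (enum_val j * g^-1)%g).
  rewrite (bigD1 (enum_val i * x)%g) //= big1 => [|g /negbTE ->]; last by rewrite mul0r.
  by rewrite eqxx mul1r addr0 invMg mulgA.
by rewrite -sumG; apply: eq_bigr => k _; rewrite PE aGE.
Qed.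

Let P_idem : P *m P = P.
Proof.
apply/matrixP => i j; rewrite !mxE -(young_idem_idem F ln).
transitivity (\sum_g young_idem F l (g * (enum_val i)^-1)%g * young_idem F l (enum_val j * g^-1)%g).
  by rewrite -sumG; apply: eq_bigr => k _; rewrite !PE.
rewrite [RHS](reindex_inj (inj_comp (mulgI (enum_val j)) invg_inj)) /=.
apply: eq_bigr => g _; rewrite mulrC; congr (_ * young_idem F l _).
by rewrite invMg invgK !mulgA mulgKV.
Qed.

Let specht_rowE j : specht_row 0 j = young_coef F l (enum_val j).
Proof.
rewrite -young_coefE summxE (bigD1 (enum_val j)) //= big1 => [|g ng]; last first.
  rewrite mxE mxE aGE gring_indexK ?inE // mul1g.
  by rewrite eq_sym (negbTE ng) mulr0.
by rewrite mxE mxE aGE gring_indexK ?inE // mul1g eqxx mulr1 addr0.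
Qed.

Let s := sandwich_coef F l (1 : 'S_n)%g.
Let s0 : s != 0. Proof. exact: sandwich_coef1_neq0. Qed.

Let rowP : row (gring_index G 1) P = s^-1 *: specht_row.
Proof.
apply/rowP => j; rewrite [RHS]mxE specht_rowE !mxE gring_indexK ?inE //.
by rewrite invg1 mulg1 mulrC.
Qed.

Let rowPi i : row i P = row (gring_index G 1) P *m aG (enum_val i).
Proof.
rewrite -row_mul P_comm row_mul.
have -> : row (gring_index G 1) (aG (enum_val i)) = delta_mx 0 i.
  rewrite rowK gring_indexK ?inE // mul1g gring_valK //.
by rewrite -rowE.
Qed.

(** The rows of [P] are the translates of its row at the identity, a nonzero multiple of the
    symmetrizer. *)
Let P_eqmx : (P :=: U)%MS.
Proof.
apply/eqmxP/andP; split.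
  apply/row_subP => i; rewrite rowPi rowP.
  apply: mxmodule_trans (cyclic_mx_module _ _) _ _; rewrite ?inE //.
  by rewrite scalemx_sub // cyclic_mx_id.
apply: cyclic_mx_sub.
  by apply/mxmoduleP => x _; rewrite P_comm submxMl.
by rewrite -[specht_row](scalerKV s0) -rowP scalemx_sub // row_sub.
Qed.

Lemma specht_trace x : \tr (specht F n l x) = young_char F l x.
Proof.
rewrite /= /submod_mx (mxtrace_in_submod P_idem P_eqmx); last first.
  by apply: (mxmoduleP (cyclic_mx_module aG specht_row)); rewrite inE.
(* The diagonal of [P *m aG x] carries the idempotent at conjugates of the inverse of [x]. *)
rewrite -young_charV /young_char [RHS](reindex_inj invg_inj) -sumG.
by apply: eq_bigr => i _; rewrite P_aG conjgE invgK mulgA.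
Qed.

(** Up to a scalar, the sums in the hypothesis are the entries of [P *m Z], and the row space of [P]
    is the Specht module. *)
Lemma specht_sum_vanish z :
  (forall x y, \sum_g young_coef F l g * z (x * g * y)%g = 0) ->
  repr_sum (specht F n l) (fun x => z x^-1%g) = 0.
Proof.
move=> z0; pose Z := \sum_x z x^-1%g *: aG x.
have PZ : P *m Z = 0.
  apply/matrixP => i j; rewrite mulmx_sumr summxE mxE.
  transitivity (s^-1 * \sum_g young_coef F l g * z ((enum_val j)^-1 * g * enum_val i)%g).
    rewrite mulr_sumr (reindex_inj (inj_comp (mulgI (enum_val i)^-1%g)
      (inj_comp (mulIg (enum_val j)) invg_inj))) /=.
    apply: eq_bigr => g _; rewrite -scalemxAr mxE P_aG !invMg !invgK.
    by rewrite !mulgA mulgV mul1g mulgK mulrC mulrA [s^-1 * _]mulrC.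
  by rewrite z0 mulr0.
transitivity (in_submod U (val_submod (1%:M : 'M[F]_(\rank U)) *m Z)).
  rewrite in_submodE mulmx_sumr mulmx_suml; apply: eq_big => [x|x _]; first by rewrite inE.
  by rewrite -in_submodE linearZ linearZ.
have : (val_submod (1%:M : 'M[F]_(\rank U)) <= P)%MS by rewrite P_eqmx val_submodP.
by case/submxP => D ->; rewrite -mulmxA PZ mulmx0 linear0.
Qed.

End SpechtTrace.

Section SchurTrace.
Variables (F : numFieldType) (l : intpart) (t : nat).
Local Notation n := (psize l).
Local Notation index := {ffun 'I_n -> 'I_t}.

Let placeE (s : 'S_n) :
  place_mx F t s = fun_mx F (fun f : index => [ffun k => f (s^-1%g k)]).
Proof.
apply/matrixP => i j; rewrite !mxE; congr ((_ : bool)%:R); apply/forallP/eqP => [eqij|-> k].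
  by apply/ffunP => k; rewrite ffunE -(eqP (eqij _)) permKV.
by rewrite ffunE permK.
Qed.

Let tensorE (x : 'S_t) :
  tensor_mx n (perm_mx x) = fun_mx F (fun f : index => [ffun k => x (f k)]).
Proof.
apply/matrixP => i j; rewrite !mxE.
have [->|/eqP nij] := eqVneq (enum_val j) _.
  by rewrite big1 // => k _; rewrite !mxE ffunE eqxx.
have [k nk] : exists k, (enum_val j : index) k != x ((enum_val i : index) k).
  apply/existsP; apply: contra_notT nij; rewrite negb_exists => /forallP eqij.
  by apply/ffunP => k; rewrite ffunE; apply/eqP; have := eqij k; rewrite negbK.
by rewrite (bigD1 k) //= !mxE eq_sym (negbTE nk) mul0r.
Qed.

Lemma place_mxM (s s' : 'S_n) : place_mx F t s *m place_mx F t s' = place_mx F t (s * s')%g.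
Proof.
rewrite !placeE fun_mxM; apply: eq_fun_mx => f; apply/ffunP => k.
by rewrite !ffunE invMg permM.
Qed.

Lemma place_tensor_trace (w : 'S_n) (x : 'S_t) :
  \tr (place_mx F t w *m tensor_mx n (perm_mx x)) = (fix_count w x)%:R.
Proof.
rewrite placeE tensorE fun_mxM mxtrace_fun_mx; congr _%:R.
apply: eq_card => f; rewrite !inE; apply/eqP/forallP => [e k|H].
  by rewrite -{1}e !ffunE /= permK.
by apply/ffunP => k; rewrite !ffunE -(eqP (H _)) permKV.
Qed.

Lemma res_schur_trace (x : 'S_t) :
  \tr (res_schur F l t x) = \sum_(w : 'S_n) young_idem F l w * (fix_count w x)%:R.
Proof.
pose P := \sum_(w : 'S_n) young_idem F l w *: place_mx F t w.
have PE : P = (sandwich_coef F l (1 : 'S_n)%g)^-1 *: young_mx F l t.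
  rewrite /young_mx -young_coefE scaler_sumr; apply: eq_bigr => w _.
  by rewrite scalerA mulrC.
have PP : P *m P = P.
  rewrite -[RHS](idem_funE (place_mx F t) (young_idem_idem F (erefl n))).
  rewrite mulmx_suml; apply: eq_bigr => g _; rewrite mulmx_sumr; apply: eq_bigr => h _.
  by rewrite -scalemxAl -scalemxAr scalerA place_mxM.
have eqP : (P :=: young_mx F l t)%MS.
  by rewrite PE; apply: eqmx_scale; rewrite invr_eq0 sandwich_coef1_neq0.
rewrite /= /res_schur_mx /schur_mx (mxtrace_in_submod PP eqP); last first.
  by rewrite young_tensorC submxMl.
rewrite mulmx_suml linear_sum; apply: eq_bigr => w _.
by rewrite -scalemxAl linearZ /= place_tensor_trace.
Qed.

(** These sums are entries of the Young symmetrizer times the linear extension [Z] of the tensor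
    power, and [Z] kills the row space of the symmetrizer. *)
Lemma res_schur_sum_vanish (z : 'S_t -> F) (i j : index) :
  repr_sum (res_schur F l t) z = 0 ->
  \sum_(w : 'S_n) young_coef F l w *
    \sum_x z x * [forall k, j (w k) == x (i k)]%:R = 0.
Proof.
move=> z0; pose Z := \sum_x z x *: tensor_mx n (perm_mx x : 'M[F]_t).
have YZ : young_mx F l t *m Z = 0.
  have Z0 : val_submod (1%:M : 'M[F]_(\rank (young_mx F l t))) *m Z = 0.
    transitivity (val_submod (repr_sum (res_schur F l t) z)); last by rewrite z0 linear0.
    rewrite mulmx_sumr linear_sum; apply: eq_big => [x|x _]; first by rewrite inE.
    by rewrite -scalemxAr [RHS]linearZ /= /res_schur_mx /schur_mx in_submodK // tensor_mx_stable.
  by rewrite -(in_submodK (submx_refl (young_mx F l t))) val_submodE -mulmxA Z0 mulmx0.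
transitivity ((young_mx F l t *m Z) (enum_rank i) (enum_rank j)); last by rewrite YZ mxE.
rewrite /young_mx -young_coefE mulmx_suml summxE.
apply: eq_bigr => w _; rewrite -scalemxAl mxE; congr (_ * _).
rewrite mulmx_sumr summxE; apply: eq_bigr => x _; rewrite -scalemxAr mxE; congr (_ * _).
rewrite placeE tensorE fun_mxM !mxE !enum_rankK; congr ((_ : bool)%:R).
apply/forallP/eqP => [H|-> k]; last by rewrite !ffunE permK.
by apply/ffunP => k; rewrite !ffunE -(eqP (H _)) permKV.
Qed.

End SchurTrace.

Lemma padded_intpart (t : nat) (nu : intpart) :
  (0 < t)%N -> (head 0 nu + psize nu <= t)%N -> exists mu : intpart, intparts mu = padded t nu.
Proof.
case: nu => nu nuP t0; rewrite /padded /psize /= => nut.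
suff H : sorted geq (t - sumn nu :: nu)%N && (0%N \notin (t - sumn nu :: nu)%N).
  by exists (IntPart H).
move/andP: nuP => [so n0]; rewrite inE negb_or n0 andbT eq_sym subn_eq0 -ltnNge /=.
case: nu nut so n0 => [|a r] //= nut -> ; rewrite inE negb_or => /andP[a0 _].
have le_t : (a + sumn r <= t)%N by rewrite (leq_trans _ nut) ?leq_addl.
rewrite andbT leq_subRL // addnC nut /= (leq_trans _ nut) //.
by rewrite -[X in (X < _)%N]add0n ltn_add2r lt0n eq_sym.
Qed.

Lemma sumn_padded (t : nat) (nu : intpart) : (psize nu <= t)%N -> sumn (padded t nu) = t.
Proof. by move=> nut; rewrite /= -/(psize nu) subnK. Qed.

Lemma perm_lift0_inj (n : nat) (p q : 'S_n.+1) :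
  (forall k, p (lift ord0 k) = q (lift ord0 k)) -> p = q.
Proof.
move=> pq; apply/permP => i; have [k ->|->] := unliftP ord0 i; first exact: pq.
have [k e|e] := unliftP ord0 (q^-1%g (p ord0)); last by rewrite -[in RHS]e permKV.
have /perm_inj/eqP : p ord0 = p (lift ord0 k) by rewrite pq -e permKV.
by rewrite (negbTE (neq_lift _ _)).
Qed.

Section YoungComplete.
Variable F : numFieldType.
Hypothesis res_decomp : forall l : intpart, exists (r : seq intpart) (a : intpart -> nat),
  {in r, forall nu : intpart, (head 0 nu + psize nu <= (psize l).+1)%N} /\
  mx_rsim (res_schur F l (psize l).+1)
    (\big[dadd_grepr/grepr0]_(nu <- r) muln_grepr
       (Representation (specht F (psize l).+1 (padded (psize l).+1 nu))) (a nu)).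

Definition young_vanish (n : nat) (z : 'S_n -> F) := forall mu : intpart, psize mu = n ->
  forall x y, \sum_g young_coef F mu g * z (x * g * y)%g = 0.

(* Restricted to permutations of [psize l + 1] points, the Schur functor of [l]
   involves only Specht modules of that degree, while the tensors with distinct
   factors recover the group algebra of a point stabilizer. *)
Lemma young_vanish_step (l : intpart) (z : 'S_(psize l).+1 -> F) x y :
  young_vanish z ->
  \sum_(w : 'S_(psize l)) young_coef F l w *
    z (x * (lift_perm ord0 ord0 w)^-1 * y)%g = 0.
Proof.
move=> z0; have [r [a [rP sim]]] := res_decomp l.
have := mx_rsim_repr_sum (z := fun x => z x^-1%g) sim.
have -> : repr_sum (\big[dadd_grepr/grepr0]_(nu <- r) muln_grepr (Representation
    (specht F (psize l).+1 (padded (psize l).+1 nu))) (a nu)) (fun x => z x^-1%g) = 0.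
  apply: repr_sum_dadd => nu /rP nur; apply: repr_sum_muln.
  have [mu muE] := padded_intpart (ltn0Sn _) nur; rewrite -muE.
  have smu : psize mu = (psize l).+1.
    by rewrite /psize muE sumn_padded // (leq_trans _ nur) // leq_addl.
  exact: specht_sum_vanish smu _ (z0 mu smu).
move=> /(_ erefl) /(@res_schur_sum_vanish F l _ _
  [ffun k => y (lift ord0 k)] [ffun k => x^-1%g (lift ord0 k)]) E; rewrite -[RHS]E.
apply: eq_bigr => w _; congr (_ * _).
(* The group acts on one point more than there are tensor factors, and a permutation is determined
   by its values off one point, so a single [u] contributes. *)
rewrite (bigD1 (y^-1 * lift_perm ord0 ord0 w * x^-1)%g) //= big1 => [|u nu].
  rewrite !invMg !invgK mulgA addr0 (_ : [forall k, _]) ?mulr1 //.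
  by apply/forallP => k; rewrite !ffunE !permM permK lift_perm_lift.
rewrite (_ : [forall k, _] = false) ?mulr0 //; apply/negbTE; apply: contra nu => /forallP H.
suff -> : u = (y^-1 * (lift_perm ord0 ord0 w * x^-1))%g by rewrite mulgA.
apply: (mulgI y); rewrite mulKVg; apply: perm_lift0_inj => k.
by have /eqP := H k; rewrite !ffunE !permM lift_perm_lift.
Qed.

(** In place of a count of conjugacy classes, induction on the degree: a function killed by the
    symmetrizers of degree [n.+1] restricts, on cosets of a point stabilizer, to functions killed by
    those of degree [n]. *)
Lemma young_complete (n : nat) (z : 'S_n -> F) : young_vanish z -> forall x, z x = 0.
Proof.
elim: n z => [|n IH] z z0 x.
  have s0 : sorted geq [::] && (0%N \notin [::]) by [].
  have := z0 (IntPart s0) erefl 1%g x; rewrite (bigD1 1%g) //= big1 => [|g]; last first.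
    by case/eqP; apply/permP => -[].
  by rewrite young_coef1 // mul1r addr0 !mul1g.
pose z' (w : 'S_n) := z (x * (lift_perm ord0 ord0 w)^-1)%g.
have /IH/(_ 1%g) : young_vanish z'.
  move=> mu smu u v; rewrite /z'.
  have := @young_vanish_step mu.
  rewrite smu => /(_ z (x * (lift_perm ord0 ord0 v)^-1)%g (lift_perm ord0 ord0 u)^-1%g z0) E; rewrite -[RHS]E.
  by apply: eq_bigr => g _; rewrite -!(lift_permM _ ord0) !invMg !mulgA.
by rewrite /z' lift_perm1 invg1 mulg1.
Qed.

End YoungComplete.

(** * Class functions *)

Section ClassFunctions.
Variables (F : numFieldType) (n : nat).
Hypothesis complete : forall z : 'S_n -> F, young_vanish z -> forall x, z x = 0.
Implicit Types (psi : 'S_n -> F) (l : intpart).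

Definition class_fun psi := forall x y, psi (x ^ y)%g = psi x.

Definition young_eval l psi := \sum_w young_idem F l w * psi w.

Lemma class_fun_mulC psi x y : class_fun psi -> psi (x * y)%g = psi (y * x)%g.
Proof. by move=> cpsi; rewrite -(cpsi _ x) conjgE !mulgA mulVg mul1g. Qed.

Lemma young_char_class l : class_fun (young_char F l).
Proof. by move=> x y; rewrite young_charJ. Qed.

(** Idempotence doubles the idempotent, the class property places the two copies around [y x], and
    [young_idem_sandwich] leaves a multiple of [young_eval]. *)
Lemma class_fun_eq0 psi : class_fun psi ->
  (forall mu, psize mu = n -> young_eval mu psi = 0) -> forall x, psi x = 0.
Proof.
move=> cpsi psi0; apply: complete => mu smu x y.
pose f g : F^o := psi g.
have e0 : \sum_g young_idem F mu g * psi (x * g * y)%g = 0.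
  transitivity (\sum_g young_idem F mu g *: f (g * (y * x))%g).
    by apply: eq_bigr => g _; rewrite -mulgA (class_fun_mulC x) // /f -mulgA.
  rewrite -(idem_funE (fun g => f (g * (y * x))%g) (young_idem_idem F smu)).
  rewrite exchange_big /=; transitivity (\sum_g \sum_h
      (young_idem F mu g * young_idem F mu h) *: f (g * (y * x) * h)%g).
    apply: eq_bigr => g _; apply: eq_bigr => h _.
    by rewrite [_ * young_idem _ _ _]mulrC /f -mulgA (class_fun_mulC h) // !mulgA.
  rewrite young_idem_sandwich // [X in _ *: X](_ : _ = 0) ?scaler0 //.
  exact: psi0.
have s0 := sandwich_coef1_neq0 F smu.
apply: (mulfI (invr_neq0 s0)); rewrite mulr0 -[RHS]e0 mulr_sumr.
by apply: eq_bigr => g _; rewrite mulrA [_^-1 * _]mulrC.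
Qed.

Lemma young_char_pair l psi : class_fun psi ->
  \sum_w young_char F l w * psi w = n`!%:R * young_eval l psi.
Proof.
move=> cpsi; under eq_bigr do rewrite mulr_suml.
rewrite exchange_big /= (eq_bigr (fun=> young_eval l psi)) => [|g _]; last first.
  by rewrite [RHS](reindex_inj (conjg_inj g)); apply: eq_bigr => w _; rewrite cpsi.
by rewrite sumr_const card_Sn mulr_natl.
Qed.

Variable r : seq intpart.
Hypotheses (ur : uniq r) (rP : forall l, (l \in r) = (psize l == n)).

Lemma class_fun_expand psi : class_fun psi ->
  forall x, psi x = \sum_(l <- r) young_eval l psi * young_char F l x.
Proof.
move=> cpsi x; apply/eqP; rewrite -subr_eq0; apply/eqP; move: x.
apply: class_fun_eq0 => [x y|mu smu].
  by rewrite cpsi; under eq_bigr do rewrite young_charJ.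
rewrite /young_eval; under eq_bigr do rewrite mulrBr mulr_sumr.
rewrite sumrB exchange_big /= (bigD1_seq mu) ?rP ?smu //= [X in _ - (_ + X)]big1_seq.
  rewrite addr0; apply/eqP; rewrite subr_eq0; apply/eqP.
  under [RHS]eq_bigr do rewrite mulrCA.
  by rewrite -mulr_sumr young_char_idem // eqxx mulr1.
move=> l /andP[nl]; rewrite rP => /eqP sl; under eq_bigr do rewrite mulrCA.
by rewrite -mulr_sumr young_char_idem // eq_sym (negbTE nl) mulr0.
Qed.

(** Parseval identity in bilinear form; complex conjugation does not enter because [young_char] is
    invariant under inversion. *)
Lemma class_fun_pair psi psi' : class_fun psi -> class_fun psi' ->
  \sum_(l <- r) young_eval l psi * young_eval l psi' = n`!%:R^-1 * \sum_w psi w * psi' w.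
Proof.
move=> cpsi cpsi'; have n0 : n`!%:R != 0 :> F by rewrite pnatr_eq0 -lt0n fact_gt0.
apply: (mulfI n0); rewrite mulVKf //.
under [RHS]eq_bigr do rewrite (class_fun_expand cpsi) mulr_suml.
rewrite exchange_big mulr_sumr; apply: eq_bigr => l _.
by under [RHS]eq_bigr do rewrite -mulrA; rewrite -mulr_sumr young_char_pair // mulrCA.
Qed.

End ClassFunctions.

Fixpoint bounded_seqs (m k : nat) : seq (seq nat) :=
  if k is k'.+1 then
    [::] :: [seq a :: s | a <- iota 0 m.+1, s <- bounded_seqs m k']
  else [:: [::]].

Lemma mem_bounded_seqs m k s : (size s <= k)%N -> all (leq^~ m) s -> s \in bounded_seqs m k.
Proof.
elim: k s => [|k IH] [|a s] // sk /andP[am sm].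
rewrite in_cons; apply/orP; right; apply/allpairsPdep.
by exists a, s; rewrite mem_iota ltnS am IH.
Qed.

(** A partition of size at most [N] has at most [N] parts, each at most [N]. *)
Definition parts_le (N : nat) : seq intpart :=
  undup [seq l <- pmap insub (bounded_seqs N N) | (psize l <= N)%N].

Lemma parts_le_uniq N : uniq (parts_le N). Proof. exact: undup_uniq. Qed.

Lemma mem_parts_le N (l : intpart) : (l \in parts_le N) = (psize l <= N)%N.
Proof.
rewrite mem_undup mem_filter; apply: andb_idr => lN.
rewrite mem_pmap_sub; apply: mem_bounded_seqs.
  apply: leq_trans lN; case: l => l lP; rewrite /psize /=; case/andP: lP => _.
  elim: l => //= a r IH; rewrite in_cons negb_or => /andP[a0 /IH].
  by rewrite -add1n => H; rewrite leq_add // lt0n eq_sym.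
apply/allP => x xl; apply: leq_trans lN.
by rewrite /psize (perm_sumn (perm_to_rem xl)) leq_addr.
Qed.

(** * Cycle multiplicities and the norm of G_nu *)

Section CycleMultiplicity.
Variables (F : numFieldType) (zeta : nat -> F).
Hypothesis zetaP : forall n, (0 < n)%N -> n.-primitive_root (zeta n).

Let ex_mult (nu l : intpart) : exists k : nat,
  \sum_(s : 'S_(psize nu)) \sum_(w : 'S_(psize l))
    young_idem F nu s * young_idem F l w * cycle_char zeta s w == k%:R.
Proof.
have [k ->] := cycle_pair_nat zetaP (young_idem_idem F (erefl (psize nu)))
  (young_idem_idem F (erefl (psize l))).
by exists k.
Qed.

Definition cycle_mult nu l : nat := xchoose (ex_mult nu l).

(** With [n] a variable, all shapes of size [n] share the group ['S_n] and no transport along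
    [psize l = n] is needed. *)
Lemma cycle_multE (n : nat) (nu l : intpart) : psize l = n ->
  (cycle_mult nu l)%:R = \sum_(s : 'S_(psize nu)) \sum_(w : 'S_n)
    young_idem F nu s * young_idem F l w * cycle_char zeta s w.
Proof. by move=> <-; rewrite (eqP (xchooseP (ex_mult nu l))). Qed.

Lemma cycle_mult_gt (nu l : intpart) : (psize nu < psize l)%N -> cycle_mult nu l = 0%N.
Proof.
move=> nl; apply/eqP; rewrite -(pnatr_eq0 F) (cycle_multE _ (erefl _)); apply/eqP.
rewrite big1 // => s _; rewrite big1 // => w _.
by rewrite cycle_char_gt ?card_ord ?mulr0.
Qed.

Lemma young_conj_pair (nu l : intpart) : psize l = psize nu ->
  \sum_s \sum_w young_idem F nu s * young_idem F l w *
    \sum_(g : 'S_(psize nu)) (w == s ^ g)%g%:R = (nu == l)%:R.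
Proof.
move=> nl; rewrite eq_sym -(young_char_idem F nl (erefl _)) exchange_big.
apply: eq_bigr => w _; rewrite /young_char mulr_sumr.
under eq_bigr do rewrite mulr_sumr.
rewrite exchange_big [RHS](reindex_inj invg_inj); apply: eq_bigr => g _.
rewrite (bigD1 (w ^ g^-1)%g) //= conjgKV eqxx mulr1 big1 ?addr0 => [|s ns].
  exact: mulrC.
case: eqP => [e|_]; last by rewrite mulr0.
by rewrite e conjgK eqxx in ns.
Qed.

Lemma cycle_mult_diag (nu l : intpart) : psize l = psize nu -> cycle_mult nu l = (nu == l).
Proof.
move=> nl; apply/eqP; rewrite -(eqr_nat F) (cycle_multE _ nl) -young_conj_pair //.
apply/eqP; apply: eq_bigr => s _; apply: eq_bigr => w _.
by rewrite (cycle_char_diag _ _ zetaP).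
Qed.

Definition signed_mult nu l : int := (-1) ^+ (psize nu + psize l) * (cycle_mult nu l)%:Z.

Lemma signed_mult_gt (nu l : intpart) : (psize nu < psize l)%N -> signed_mult nu l = 0.
Proof. by move=> nl; rewrite /signed_mult cycle_mult_gt // mulr0. Qed.

Lemma signed_mult_diag (nu l : intpart) : psize l = psize nu -> signed_mult nu l = (nu == l)%:R.
Proof.
move=> nl; rewrite /signed_mult cycle_mult_diag // nl addnn -mul2n exprM sqrrN !expr1n mul1r.
by case: eqP.
Qed.

Hypothesis complete : forall n (z : 'S_n -> F), young_vanish z -> forall x, z x = 0.
Variables (N t : nat) (tN : (N + N <= t)%N).
Local Notation L := (parts_le N).

(** The virtual character G_nu, given by counts of equivariant partial injections;
    [stable_char_schur] is its expansion in Schur functors. *)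
Definition stable_char (nu : intpart) (x : 'S_t) : F :=
  \sum_(s : 'S_(psize nu)) young_idem F nu s * cycle_sum F s x.

Definition schur_char (l : intpart) (x : 'S_t) : F :=
  \sum_(w : 'S_(psize l)) young_idem F l w * (fix_count w x)%:R.

Lemma parts_filter (n : nat) : (n <= N)%N -> let r := [seq l <- L | psize l == n] in
  uniq r /\ (forall l, (l \in r) = (psize l == n)).
Proof.
move=> nN /=; split=> [|l]; first by rewrite filter_uniq ?parts_le_uniq.
by rewrite mem_filter mem_parts_le; apply: andb_idr => /eqP ->.
Qed.

(** [cycle_char_sum] expands [cycle_sum] by size. In each size [class_fun_pair] splits the sum over
    ['S_n] by shapes, [cycle_char] giving the multiplicities and [fix_count] the Schur
    characters. *)
Lemma stable_char_schur (nu : intpart) x : (psize nu <= N)%N ->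
  stable_char nu x = \sum_(l <- L) (signed_mult nu l)%:~R * schur_char l x.
Proof.
move=> nuN; set m := psize nu.
transitivity (\sum_(n < m.+1) \sum_(l <- L | psize l == n)
   (signed_mult nu l)%:~R * schur_char l x); last first.
  transitivity (\sum_(l <- L | (psize l < m.+1)%N) (signed_mult nu l)%:~R * schur_char l x).
    rewrite (partition_big (fun l => inord (psize l) : 'I_m.+1) xpredT) //=.
    apply: eq_bigr => n _; apply: eq_bigl => l; apply/eqP/andP => [ln|[lm /eqP <-]]; last by rewrite inordK.
    have lm : (psize l < m.+1)%N by rewrite ln.
    by split=> //; apply/eqP/val_inj; rewrite /= inordK.
  rewrite big_mkcond; apply: eq_bigr => l _; rewrite ltnS leqNgt; case: ltnP => //= ml.
  by rewrite signed_mult_gt // mul0r.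
rewrite /stable_char /cycle_sum.
under eq_bigr do rewrite -(cycle_char_sum zetaP) card_ord mulr_sumr.
rewrite exchange_big /=; apply: eq_bigr => n _.
have nN : (n <= N)%N by rewrite (leq_trans _ nuN) // -ltnS ltn_ord.
have [ur rP] := parts_filter nN.
have E (s : 'S_m) : n`!%:R^-1 * \sum_(w : 'S_n) (-1) ^+ (m + n) * cycle_char zeta s w *
      (fix_count w x)%:R = (-1) ^+ (m + n) * \sum_(l <- [seq l <- L | psize l == n])
    young_eval l (fun w : 'S_n => cycle_char zeta s w) *
    young_eval l (fun w : 'S_n => (fix_count w x)%:R).
  rewrite (class_fun_pair (@complete n) ur rP); last 2 first.
  - by move=> w g; rewrite cycle_char_classfun.
  - by move=> w g; rewrite fix_count_classfun.
  rewrite [RHS]mulrCA; congr (_ * _); rewrite mulr_sumr.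
  by apply: eq_bigr => w _; rewrite mulrA.
under eq_bigr do rewrite E.
rewrite -[RHS]big_filter.
under eq_bigr do rewrite !mulr_sumr.
rewrite exchange_big /=; apply: eq_big_seq => l; rewrite rP => /eqP ln.
rewrite /signed_mult ln rmorphM /= rmorphXn rmorphN1 /= -pmulrn (cycle_multE _ ln).
rewrite -[in RHS]mulrA mulr_suml mulr_sumr; apply: eq_bigr => s _.
rewrite mulrCA; congr (_ * _); rewrite mulrA; congr (_ * _).
  by rewrite mulr_sumr; apply: eq_bigr => w _; rewrite mulrA.
by rewrite /schur_char ln.
Qed.

Lemma stable_schur_pairE (n : nat) (nu l : intpart) : psize l = n ->
  \sum_x stable_char nu x * schur_char l x =
  \sum_(s : 'S_(psize nu)) \sum_(w : 'S_n) young_idem F nu s * young_idem F l w *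
    \sum_(x : 'S_t) cycle_sum F s x * (fix_count w x)%:R.
Proof.
move=> <-; rewrite /stable_char /schur_char.
under eq_bigr => x _ do (rewrite mulr_suml; under eq_bigr do rewrite mulr_sumr).
rewrite exchange_big; apply: eq_bigr => s _; rewrite exchange_big; apply: eq_bigr => w _.
by rewrite mulr_sumr; apply: eq_bigr => x _; rewrite mulrACA.
Qed.

Lemma stable_schur_pair_lt (nu l : intpart) : (psize nu <= N)%N -> (psize l < psize nu)%N ->
  \sum_x stable_char nu x * schur_char l x = 0.
Proof.
move=> nuN ln; rewrite (stable_schur_pairE _ erefl) big1 // => s _; rewrite big1 // => w _.
rewrite cycle_sum_pair_lt ?mulr0 ?card_ord // (leq_trans _ tN) // leq_add //.
exact: leq_trans (ltnW ln) nuN.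
Qed.

Lemma stable_schur_pair_eq (nu l : intpart) : (psize nu <= N)%N -> psize l = psize nu ->
  \sum_x stable_char nu x * schur_char l x = t`!%:R * (nu == l)%:R.
Proof.
move=> nuN ln; rewrite (stable_schur_pairE _ ln) -young_conj_pair // mulr_sumr.
apply: eq_bigr => s _; rewrite mulr_sumr; apply: eq_bigr => w _.
by rewrite cycle_sum_pair_eq ?card_ord ?(leq_trans _ tN) ?leq_add // mulrCA.
Qed.

(** One factor is expanded in Schur characters: larger shapes do not occur, smaller ones pair to
    zero, and among shapes of the same size only [nu] contributes. *)
Lemma stable_char_norm (nu : intpart) : (psize nu <= N)%N ->
  \sum_x stable_char nu x * stable_char nu x = t`!%:R.
Proof.
move=> nuN; transitivity (\sum_(l <- L) (signed_mult nu l)%:~R *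
    \sum_x stable_char nu x * schur_char l x).
  under eq_bigr do rewrite {2}stable_char_schur // mulr_sumr.
  rewrite exchange_big; apply: eq_bigr => l _; rewrite mulr_sumr; apply: eq_bigr => x _.
  by rewrite mulrCA.
rewrite (bigD1_seq nu) ?parts_le_uniq ?mem_parts_le //= [X in _ + X]big1 => [|l nl].
  by rewrite addr0 stable_schur_pair_eq // signed_mult_diag // eqxx mulr1 mul1r.
case: (ltngtP (psize l) (psize nu)) => [ln|ln|ln].
- by rewrite stable_schur_pair_lt ?mulr0.
- by rewrite signed_mult_gt // mul0r.
by rewrite stable_schur_pair_eq // eq_sym (negbTE nl) !mulr0.
Qed.

Variables (ps : seq intpart) (a : intpart -> intpart -> nat).
Hypotheses (t0 : (0 < t)%N) (ups : uniq ps).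
Hypothesis psP : {in ps, forall nu : intpart, (head 0 nu + psize nu <= t)%N}.
Hypothesis schurE : forall l x, (psize l <= N)%N -> schur_char l x =
  \sum_(k <- ps) (a l k)%:R * young_char F (padded t k) x.

Lemma padded_char_pair (k k' : intpart) : k \in ps -> k' \in ps ->
  \sum_(x : 'S_t) young_char F (padded t k) x * young_char F (padded t k') x =
  t`!%:R * (k == k')%:R.
Proof.
move=> /psP kt /psP kt'.
have [mu muE] := padded_intpart t0 kt; have [mu' muE'] := padded_intpart t0 kt'.
have s_mu (nu : intpart) : (head 0 nu + psize nu <= t)%N -> sumn (padded t nu) = t.
  by move=> ?; rewrite sumn_padded // (leq_trans _ (_ : head 0 nu + psize nu <= _)%N) ?leq_addl.
have smu : psize mu = t by rewrite /psize muE s_mu.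
have smu' : psize mu' = t by rewrite /psize muE' s_mu.
rewrite -muE -muE' young_char_pair; last exact: young_char_class.
rewrite /young_eval young_char_idem //; congr (_ * (_ : bool)%:R).
apply/eqP/eqP => [e|e]; apply: val_inj; rewrite /=.
  have : padded t k = padded t k' by rewrite -muE -muE' e.
  by case.
by rewrite muE muE' e.
Qed.

(** The inner sums are the coordinates of G_nu in the orthogonal Specht characters, so the norm of
    G_nu is their sum of squares. *)
Lemma stable_row_norm (nu : intpart) : (psize nu <= N)%N ->
  \sum_(k <- ps) (\sum_(l <- L) signed_mult nu l * (a l k)%:Z) ^+ 2 = 1.
Proof.
move=> nuN; set c := fun k => \sum_(l <- L) signed_mult nu l * (a l k)%:Z.
have GE x : stable_char nu x = \sum_(k <- ps) (c k)%:~R * young_char F (padded t k) x.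
  rewrite stable_char_schur //.
  transitivity (\sum_(l <- L) \sum_(k <- ps) (signed_mult nu l * (a l k)%:Z)%:~R *
      young_char F (padded t k) x).
    apply: eq_big_seq => l; rewrite mem_parts_le => lN.
    by rewrite schurE // mulr_sumr; apply: eq_bigr => k _; rewrite mulrA intrM.
  rewrite exchange_big; apply: eq_bigr => k _.
  by rewrite -mulr_suml; congr (_ * _); rewrite /c rmorph_sum.
have t1 : t`!%:R != 0 :> F by rewrite pnatr_eq0 -lt0n fact_gt0.
apply/eqP; rewrite -(eqr_int F); apply/eqP/(mulfI t1).
rewrite [RHS]mulr1 -[RHS](stable_char_norm nuN); symmetry.
under eq_bigr do rewrite GE mulr_suml.
rewrite exchange_big rmorph_sum mulr_sumr; apply: eq_big_seq => k kps.
under eq_bigr do rewrite mulr_sumr.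
rewrite exchange_big (bigD1_seq k) //= [X in _ + X]big1_seq => [|k' /andP[nk k'ps]].
  under eq_bigr do rewrite mulrACA.
  by rewrite -mulr_sumr padded_char_pair // eqxx mulr1 addr0 mulrC rmorphXn expr2.
under eq_bigr do rewrite mulrACA.
by rewrite -mulr_sumr padded_char_pair // eq_sym (negbTE nk) !mulr0.
Qed.

End CycleMultiplicity.

(** * The inverse matrix *)

Section InverseMultiplicities.
Variables (a : intpart -> intpart -> nat) (b : intpart -> intpart -> int).
Hypothesis b_inv : forall N (nu k : intpart), (psize nu <= N)%N ->
  \sum_(l <- parts_le N) b l nu * (a l k)%:Z = (nu == k)%:R.

(** Truncation to sizes at most [N] makes both matrices square, where a left inverse is also a right
    inverse. *)
Lemma inverse_right N (l m : intpart) : (psize l <= N)%N -> (psize m <= N)%N ->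
  \sum_(k <- parts_le N) (a l k)%:Z * b m k = (l == m)%:R.
Proof.
move=> lN mN; set L := parts_le N; pose part (i : 'I_(size L)) := nth l L i.
have sumE (f : intpart -> int) : \sum_(k <- L) f k = \sum_i f (part i).
  by rewrite (big_nth l) big_mkord.
have partP k : (psize k <= N)%N -> exists i, part i = k.
  rewrite -mem_parts_le -/L => kL; have kL' := kL; rewrite -index_mem in kL'.
  by exists (Ordinal kL'); rewrite /part nth_index.
have partN i : (psize (part i) <= N)%N by rewrite -mem_parts_le mem_nth.
pose A := \matrix_(i, j) (a (part i) (part j))%:Z : 'M[int]_(size L).
pose B := \matrix_(i, j) b (part j) (part i) : 'M[int]_(size L).
have BA : B *m A = 1%:M.
  apply/matrixP => i j; rewrite !mxE; under eq_bigr do rewrite !mxE.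
  rewrite -(sumE (fun l => b l (part i) * (a l (part j))%:Z)) b_inv //.
  by rewrite /part nth_uniq ?parts_le_uniq.
have [[i <-] [j <-]] := (partP _ lN, partP _ mN).
have /matrixP/(_ i j) := mulmx1C BA; rewrite !mxE; under eq_bigr do rewrite !mxE.
by rewrite -(sumE (fun k => (a (part i) k)%:Z * b (part j) k)) /part nth_uniq ?parts_le_uniq.
Qed.

(** [b_inv] also holds for a column [k] beyond the truncation at [psize l], where it gives 0.
    Multiplying by the truncated [a] and applying [inverse_right] isolates [a l k]. *)
Lemma mult_eq0 (l k : intpart) : (psize l < psize k)%N -> a l k = 0%N.
Proof.
move=> lk; apply/eqP; rewrite -[_ == _]/((a l k)%:Z == 0); set L := parts_le (psize l).
have lL : l \in L by rewrite mem_parts_le.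
suff -> : (a l k)%:Z = \sum_(m <- L) (\sum_(k' <- L) (a l k')%:Z * b m k') * (a m k)%:Z.
  under eq_bigr do rewrite mulr_suml.
  rewrite exchange_big big1_seq // => k' /andP[_]; rewrite mem_parts_le => k'l.
  under eq_bigr do rewrite -mulrA.
  rewrite -mulr_sumr b_inv // (_ : k' == k = false) ?mulr0 //.
  by apply: contraTF lk => /eqP <-; rewrite -leqNgt.
rewrite (bigD1_seq l) ?parts_le_uniq //= inverse_right // eqxx mul1r big1_seq ?addr0 // => m.
rewrite mem_parts_le => /andP[nm ml].
by rewrite inverse_right // eq_sym (negbTE nm) mul0r.
Qed.

Variables (k0 : intpart) (c : intpart -> intpart -> int).
Local Notation L := (parts_le (psize k0)).
Hypothesis c_gt : forall nu l : intpart, (psize nu < psize l)%N -> c nu l = 0.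
Hypothesis c_diag : forall nu l : intpart, psize l = psize nu -> c nu l = (nu == l)%:R.
(** An inequality, since the full sum of squares runs over all constituents at a finite degree and
    [L] keeps only some of them. *)
Hypothesis c_row : forall nu : intpart, (psize nu <= psize k0)%N ->
  \sum_(k <- L) (\sum_(l <- L) c nu l * (a l k)%:Z) ^+ 2 <= 1.

Let d nu k := \sum_(l <- L) c nu l * (a l k)%:Z.

(** If column [k0] of the product of [c] and [a] were zero, triangularity of [c] would make column
    [k0] of [a] vanish by induction on size, contradicting [b_inv]. *)
Let d_neq0 : exists2 nu, (psize nu <= psize k0)%N & d nu k0 != 0.
Proof.
case: (boolP (has (fun nu => d nu k0 != 0) L)) => [/hasP[nu]|].
  by rewrite mem_parts_le; exists nu.
move=> /hasPn d0; have a0 : forall n (l : intpart), (psize l < n)%N ->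
    (psize l <= psize k0)%N -> a l k0 = 0%N.
  elim=> // n IH l ln lk; have lL : l \in L by rewrite mem_parts_le.
  have /d0 := lL; rewrite negbK /d (bigD1_seq l) ?parts_le_uniq //= c_diag // eqxx mul1r.
  rewrite big1_seq ?addr0 => [/eqP[]//|m]; rewrite mem_parts_le => /andP[nm mk].
  case: (ltngtP (psize m) (psize l)) => [ml|ml|ml].
  - by rewrite IH ?mulr0 // (leq_trans ml).
  - by rewrite c_gt ?mul0r.
  by rewrite c_diag // eq_sym (negbTE nm) mul0r.
have := b_inv k0 (leqnn (psize k0)); rewrite eqxx big1_seq => [/eqP|l].
  by rewrite eq_sym oner_eq0.
by rewrite mem_parts_le => /andP[_ lk]; rewrite (a0 _ _ (ltnSn _)) ?mulr0.
Qed.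

(** Integers with sum of squares at most 1 and a nonzero entry at [k0] form a unit vector up to
    sign. Triangularity forces [nu] to have the size of [k0], and the entry is then [a nu k0], hence
    1. Multiplying this row by the right inverse [b] yields [b l k0 = c nu l]. *)
Lemma inverse_mult_row : exists nu : intpart, psize nu = psize k0 /\
  forall l : intpart, (psize l <= psize k0)%N -> b l k0 = c nu l.
Proof.
have [nu nuk dnu] := d_neq0; exists nu.
have nuE : psize nu = psize k0.
  apply/eqP; rewrite eqn_leq nuk leqNgt; apply: contra dnu => lt_nu.
  apply/eqP; rewrite /d big1 // => l _; case: (ltnP (psize nu) (psize l)) => [nul|lnu].
    by rewrite c_gt ?mul0r.
  by rewrite mult_eq0 ?mulr0 // (leq_ltn_trans lnu).
split=> // l lk.
have nuL : nu \in L by rewrite mem_parts_le.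
have k0L : k0 \in L by rewrite mem_parts_le.
have dE : d nu k0 = (a nu k0)%:Z.
  rewrite /d (bigD1_seq nu) ?parts_le_uniq //= c_diag // eqxx mul1r big1_seq ?addr0 // => m.
  rewrite mem_parts_le => /andP[nm mk]; have := mk; rewrite leq_eqVlt => /orP[/eqP mE|mlt].
    by rewrite c_diag ?mE // eq_sym (negbTE nm) mul0r.
  by rewrite mult_eq0 ?mulr0.
have sq_ge0 (s : seq intpart) (P : pred intpart) : 0 <= \sum_(k <- s | P k) d nu k ^+ 2.
  by apply: sumr_ge0 => k _; exact: sqr_ge0.
have d_le1 : d nu k0 ^+ 2 + \sum_(k <- L | k != k0) d nu k ^+ 2 <= 1.
  by have := c_row nuk; rewrite (bigD1_seq k0) ?parts_le_uniq.
have d1 : d nu k0 = 1.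
  have : d nu k0 ^+ 2 <= 1 by apply: le_trans d_le1; rewrite lerDl.
  move: dnu; rewrite dE expr_le1 // lez_nat; by case: (a nu k0) => [|[|]].
have dk k : k \in L -> k != k0 -> d nu k = 0.
  move=> kL nk; have : d nu k ^+ 2 <= 0.
    move: d_le1; rewrite d1 expr1n gerDl big_mkcond (bigD1_seq k) ?parts_le_uniq //= nk.
    by apply: le_trans; rewrite lerDl -big_mkcondr sq_ge0.
  by rewrite exprn_even_le0 //= => /eqP.
rewrite -[LHS]mul1r -{1}d1.
transitivity (\sum_(k <- L) d nu k * b l k).
  rewrite (bigD1_seq k0) ?parts_le_uniq //= big1_seq ?addr0 // => k /andP[nk kL].
  by rewrite dk ?mul0r.
under eq_bigr do rewrite mulr_suml.
rewrite exchange_big (bigD1_seq l) ?parts_le_uniq ?mem_parts_le //=.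
under eq_bigr do rewrite -mulrA.
rewrite -mulr_sumr inverse_right // eqxx mulr1 big1_seq ?addr0 // => m.
rewrite mem_parts_le => /andP[nm mk]; under eq_bigr do rewrite -mulrA.
by rewrite -mulr_sumr inverse_right // (negbTE nm) mulr0.
Qed.
End InverseMultiplicities.

Lemma prim_root_exists (F : numClosedFieldType) (n : nat) :
  (0 < n)%N -> exists z : F, n.-primitive_root z.
Proof.
move=> n0; have [r rE] := closed_field_poly_normal ('X^n - 1 : {poly F}).
rewrite (monicP _) ?monicXnsubC // scale1r in rE.
suff /hasP[z _ zP] : has n.-primitive_root r by exists z.
apply: has_prim_root => //.
- by apply/allP => z zr; rewrite -[n.-unity_root z]/(root _ z) rE root_prod_XsubC.
- by rewrite -separable_prod_XsubC -rE separable_Xn_sub_1 // pnatr_eq0 -lt0n.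
by rewrite -ltnS -(size_prod_XsubC r id) -rE size_XnsubC.
Qed.

From mathcomp Require Import finmap.
From mathcomp Require Import all_classical all_reals all_analysis complex.
Local Open Scope classical_set_scope.

(** * From finite degree to stable multiplicities *)

Section StableLimit.
Variables (R : realType) (a_t : nat -> intpart -> intpart -> nat).
Hypothesis a_t_mult : forall (t : nat) (l : intpart), restriction_mult R[i] l t (a_t t l).

(** [fset_set] is empty on infinite sets, so membership in the index of the direct sum depends on
    this. *)
Lemma finite_paddable t : finite_set (paddable t).
Proof.
apply: (@sub_finite_set _ _ [set` parts_le t]) => // nu /= nut.
by rewrite mem_parts_le (leq_trans _ nut) // leq_addl.
Qed.

Lemma mem_fset_paddable t (nu : intpart) :
  (nu \in fset_set (paddable t)) = (head 0 nu + psize nu <= t)%N.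
Proof.
rewrite (in_fset_set (finite_paddable t)).
by apply/idP/idP => [/set_mem|H]; last exact: mem_set.
Qed.

(** Completeness in all degrees uses the decomposition of each [l] at the single value [psize l + 1]
    of [t]. *)
Lemma complete_res n (z : 'S_n -> R[i]) : young_vanish z -> forall x, z x = 0.
Proof.
apply: young_complete => l.
exists (fset_set (paddable (psize l).+1)), (a_t (psize l).+1 l); split => [nu|].
  by rewrite mem_fset_paddable.
exact: a_t_mult.
Qed.

Lemma res_schurE t (l : intpart) (x : 'S_t) :
  schur_char R[i] l x = \sum_(k <- fset_set (paddable t))
    (a_t t l k)%:R * young_char R[i] (padded t k) x.
Proof.
rewrite /schur_char -res_schur_trace (mx_rsim_trace _ (a_t_mult t l)) ?inE //.
rewrite mxtrace_dadd; apply: eq_big_seq => k; rewrite mem_fset_paddable => kt.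
by rewrite mxtrace_muln specht_trace ?mulr_natl // sumn_padded // (leq_trans _ kt) ?leq_addl.
Qed.

End StableLimit.

Lemma fsbig_parts (V : nmodType) (N : nat) (f : intpart -> V) :
  (forall l : intpart, ~~ (psize l <= N)%N -> f l = 0) ->
  \sum_(l \in [set: intpart]) f l = \sum_(l <- parts_le N) f l.
Proof.
move=> f0; rewrite [RHS]fsbig_seq ?parts_le_uniq //; symmetry.
apply: fsbig_widen => // l [_ /= lN]; apply: f0.
by apply/negP; rewrite -mem_parts_le.
Qed.

Lemma near_seq (I : eqType) (s : seq I) (P : nat -> I -> Prop) :
  (forall i, \forall t \near \oo, P t i) ->
  \forall t \near \oo, forall i, i \in s -> P t i.
Proof.
move=> Pi; elim: s => [|i s IH]; first by near=> t.
near=> t => j; rewrite inE => /orP[/eqP ->|].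
  by near: t; exact: Pi.
by move: j; near: t.
Unshelve. all: by end_near. Qed.

Lemma ler_sum_subseq (I : eqType) (r s : seq I) (f : I -> int) :
  uniq r -> uniq s -> {subset r <= s} -> (forall i, 0 <= f i) ->
  \sum_(i <- r) f i <= \sum_(i <- s) f i.
Proof.
move=> ur us rs f0; rewrite [leRHS](bigID (mem r)) /= -[X in X + _]big_filter.
have rE : perm_eq [seq i <- s | i \in r] r.
  apply: uniq_perm; rewrite ?filter_uniq // => i.
  by rewrite mem_filter; apply: andb_idr; exact: rs.
by rewrite (perm_big _ rE) lerDl sumr_ge0.
Qed.

Lemma signr_exprz (m n : nat) : (-1 : int) ^ (m%:Z - n%:Z) = (-1) ^+ (n + m).
Proof.
by rewrite exprzDr ?unitrN1 // -exprz_inv invrN1 mulrC exprD.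
Qed.

Theorem corollary4 (R : realType)
  (a_t : nat -> intpart -> intpart -> nat)
  (a : intpart -> intpart -> nat)
  (b : intpart -> intpart -> int)
  (sdag : intpart -> fseries)
  (a_t_mult : forall (t : nat) (l : intpart),
     restriction_mult R[i] l t (a_t t l))
  (a_lim : forall l nu : intpart, \forall t \near \oo, a_t t l nu = a l nu)
  (b_supp : forall l nu : intpart,
     ~~ (psize l <= psize nu)%N -> b l nu = 0)
  (b_inv : forall nu kappa : intpart,
     \sum_(l \in [set: intpart]) b l nu * (a l kappa)%:Z
       = (nu == kappa)%:R)
  (sdag_sym : forall nu : intpart, symmetric_function (sdag nu))
  (sdag_def : forall l : intpart,
     schur_function l = \sum_(nu \in [set: intpart]) sdag nu *+ a l nu)
  (nu : intpart) :
  sdag nu = \sum_(l \in [set: intpart]) schur_function l *~ b l nu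
  /\ forall l : intpart,
       0 <= (-1) ^ ((psize l)%:Z - (psize nu)%:Z) * b l nu.
Proof.

have b_invN N (mu k : intpart) : (psize mu <= N)%N ->
    \sum_(l <- parts_le N) b l mu * (a l k)%:Z = (mu == k)%:R.
  move=> muN; rewrite -b_inv [RHS](@fsbig_parts _ N) // => l lN.
  by rewrite b_supp ?mul0r //; apply: contra lN => /leq_trans; apply.
split.
  (* Triangularity of [a] gives the sum in [sdag_def] finite support, so it can be exchanged with
     the sum over [l]. *)
  have aN0 (l k : intpart) : (psize l <= psize nu)%N -> ~~ (psize k <= psize nu)%N -> a l k = 0%N.
    by move=> lnu; rewrite -ltnNge => nuk; rewrite (mult_eq0 b_invN) // (leq_ltn_trans lnu).
  rewrite (@fsbig_parts _ (psize nu)) => [|l lnu]; last by rewrite b_supp // mulr0z.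
  transitivity (\sum_(l <- parts_le (psize nu)) \sum_(k <- parts_le (psize nu))
      sdag k *~ (b l nu * (a l k)%:Z)).
    rewrite exchange_big /=; under eq_bigr => k _.
      rewrite -mulrz_sumr b_invN //; over.
    rewrite (bigD1_seq nu) ?parts_le_uniq ?mem_parts_le //= eqxx mulr1z.
    rewrite big1 ?addr0 // => k nk; by rewrite eq_sym (negbTE nk) mulr0z.
  apply: eq_big_seq => l; rewrite mem_parts_le => lnu.
  rewrite sdag_def (@fsbig_parts _ (psize nu)) => [|k kn]; last by rewrite aN0 // mulr0n.
  rewrite mulrz_suml; apply: eq_bigr => k _.
  by rewrite mulrC mulrzA pmulrn.
(* The value of [zeta] at 0 is a dummy. *)
have /choice[zeta zetaP] : forall n, exists z : R[i], (0 < n)%N -> n.-primitive_root z.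
  by move=> n; case: (ltnP 0 n) => [/(prim_root_exists R[i])[z]|n0]; [exists z|exists 0].
set N := psize nu; set L := parts_le N.
(* Only the finitely many limits indexed by [L] and [L] are involved, so one [t] realizes them
   all. *)
have [t [t0 tN aE]] : exists t, [/\ (0 < t)%N, (N + N <= t)%N &
    forall l k, l \in L -> k \in L -> a_t t l k = a l k].
  have : \forall t \near \oo, forall p, p \in [seq (l, k) | l <- L, k <- L] ->
      a_t t p.1 p.2 = a p.1 p.2.
    by apply: near_seq => p; exact: a_lim.
  move=> H; near \oo => t; exists t; split.
  - by near: t; exact: nbhs_infty_gt.
  - by near: t; exact: nbhs_infty_ge.
  have Ht : forall p, p \in [seq (l, k) | l <- L, k <- L] -> a_t t p.1 p.2 = a p.1 p.2.
    by near: t; exact: H.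
  by move=> l k lL kL; apply: (Ht (l, k)); exact: allpairs_f.
have c_row (mu : intpart) : (psize mu <= N)%N ->
    \sum_(k <- L) (\sum_(l <- L) signed_mult zetaP mu l * (a l k)%:Z) ^+ 2 <= 1.
  move=> muN; have psP : {in fset_set (paddable t), forall k : intpart, (head 0 k + psize k <= t)%N}.
    by move=> k; rewrite mem_fset_paddable.
  rewrite -[leRHS](stable_row_norm zetaP (complete_res a_t_mult) tN t0
    (fset_uniq (fset_set (paddable t))) psP (fun l x _ => res_schurE a_t_mult l x) muN).
  apply: le_trans (ler_sum_subseq (parts_le_uniq N) (fset_uniq _) _ _) => [|k|k]; last exact: sqr_ge0.
    rewrite le_eqVlt; apply/orP; left; apply/eqP; apply: eq_big_seq => k kL; congr (_ ^+ 2).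
    by apply: eq_big_seq => l lL; rewrite aE.
  (* The first part of [k] is at most its size, so twice [N] bounds their sum. *)
  rewrite mem_parts_le mem_fset_paddable => kN.
  apply: leq_trans tN; apply: leq_add => //; apply: leq_trans kN.
  by rewrite /psize; case: (intparts k) => //= i s; rewrite leq_addr.
have [mu [muN bE]] := inverse_mult_row b_invN (signed_mult_gt zetaP) (signed_mult_diag zetaP) c_row.
move=> l; have [lN|lN] := boolP (psize l <= N)%N; last by rewrite b_supp ?mulr0.
(* As [mu] and [nu] have the same size, the two signs square to 1 and a natural number remains. *)
rewrite bE // /signed_mult muN signr_exprz mulrA -exprD addnn -mul2n exprM sqrrN !expr1n mul1r.
by [].

Unshelve. all: by end_near. Qed.
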